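(* There exists a constant $K$, not depending on $h$ (nor on the quantization parameters $\delta,R,N$), such that for all $(t_k,x,i)\in\mathbb{T}_h\times\mathbb{X}\times\mathbb{I}_q$, $$\begin{aligned}\big|\bar v_i(t_k,x)-\hat v_i(t_k,x)\big|\;\le\;& K\exp\!\big(Kh^{-1}\|\vartheta-\hat\vartheta\|_2^2\big)\Big(1+|x|+\frac{\delta}{h}\Big)\Big[\frac{\delta}{h}+h^{-1/2}\|\vartheta-\hat\vartheta\|_2\Big(1+|x|+\frac{\delta}{h}\Big)\\ &\quad+\frac{1}{Rh}\exp\!\big(Kh^{-2}\|\vartheta-\hat\vartheta\|_4^4\big)\Big(1+|x|^2+\Big(\frac{\delta}{h}\Big)^2\Big)\Big].\end{aligned}$$ In the case where the switching costs $c_{ij}$ do not depend on $x$, the estimate is strengthened into $$\begin{aligned}\big|\bar v_i(t_k,x)-\hat v_i(t_k,x)\big|\;\le\;& K\Big[h^{-1/2}\|\vartheta-\hat\vartheta\|_2\exp\!\big(Kh^{-1}\|\vartheta-\hat\vartheta\|_2^2\big)\Big(1+|x|+\frac{\delta}{h}\Big)\\ &\quad+\frac{\delta}{h}+\frac{1}{Rh}\exp\!\big(Kh^{-2}\|\vartheta-\hat\vartheta\|_4^4\big)\Big(1+|x|^2+\Big(\frac{\delta}{h}\Big)^2\Big)\Big].\end{aligned}$$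
   Context: Fix $T\in(0,\infty)$, a filtered probability space $(\Omega,\mathcal{F},\mathbb{F}=(\mathcal{F}_t)_{t\ge 0},\mathbb{P})$ satisfying the usual conditions, a standard $d$-dimensional $\mathbb{F}$-Brownian motion $W$, and the finite set of regimes $\mathbb{I}_q=\{1,\dots,q\}$. For a function $\phi$ on $\mathbb{R}^d\times\mathbb{I}_q$ write $\phi_i=\phi(\cdot,i)$, and write $c_{ij}=c(\cdot,i,j)$. For a random variable $Y$, $\|Y\|_p=(\mathbb{E}|Y|^p)^{1/p}$. Standing assumptions: $b_i:\mathbb{R}^d\to\mathbb{R}^d$ and $\sigma_i:\mathbb{R}^d\to\mathbb{R}^{d\times d}$ are Lipschitz; $f_i,g_i,c_{ij}:\mathbb{R}^d\to\mathbb{R}$ are Lipschitz for all $i,j\in\mathbb{I}_q$; the switching costs satisfy $c_{ii}=0$, $\inf_x c_{ij}(x)>0$ for $j\ne i$, and $\inf_x[c_{ij}(x)+c_{jk}(x)-c_{ik}(x)]>0$ for $j\neq i,k$; and $g_i(x)\ge\max_{j}[g_j(x)-c_{ij}(x)]$ for all $x,i$. Discretization and controls: $m\ge1$ is an integer, $h=T/m\le1$, $t_k=kh$, $\mathbb{T}_h=\{t_k:k=0,\dots,m\}$. $\mathcal{A}^h_{t_k,i}$ is the set of double sequences $\alpha=(\tau_n,\iota_n)_{n\ge0}$ with $(\tau_n)$ a nondecreasing sequence of $[0,\infty]$-valued stopping times which on $\{\tau_n\le T\}$ take values in $\{\ell h:\ell=k,\dots,m\}$, $\iota_n$ an $\mathcal{F}_{\tau_n}$-measurable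 $\mathbb{I}_q$-valued random variable, $\tau_0=t_k$, $\iota_0=i$, and $\tau_N>T$ a.s. for some integer-valued random variable $N$. Set $I_s=\iota_n$ for $\tau_n\le s<\tau_{n+1}$ and $N(\alpha)=\#\{n\ge1:\tau_n\le T\}$. Euler value function: with $\vartheta_{k+1}=(W_{t_{k+1}}-W_{t_k})/\sqrt h$ and $F_i^h(x,w)=x+b_i(x)h+\sigma_i(x)\sqrt h\,w$, for $\alpha\in\mathcal{A}^h_{t_k,i}$ set $\bar X_{t_k}^{t_k,x,\alpha}=x$, $\bar X_{t_{\ell+1}}^{t_k,x,\alpha}=F^h_{I_{t_\ell}}(\bar X_{t_\ell}^{t_k,x,\alpha},\vartheta_{\ell+1})$ for $k\le\ell\le m-1$, and $$\bar v_i(t_k,x)=\sup_{\alpha\in\mathcal{A}^h_{t_k,i}}\mathbb{E}\Big[\sum_{\ell=k}^{m-1}f(\bar X_{t_\ell}^{t_k,x,\alpha},I_{t_\ell})h+g(\bar X_{t_m}^{t_k,x,\alpha},I_{t_m})-\sum_{n=1}^{N(\alpha)}c(\bar X_{\tau_n}^{t_k,x,\alpha},\iota_{n-1},\iota_n)\Big].$$ Space grid: for $\delta,R>0$, $\mathbb{X}=(\delta/d)\mathbb{Z}^d\cap\{x\in\mathbb{R}^d:|x|\le R\}$, and $\mathrm{Proj}_{\mathbb{X}}$ is a closest-neighbour projection of $\mathbb{R}^d$ onto $\mathbb{X}$; it satisfies $|x-\mathrm{Proj}_{\mathbb{X}}(x)|\le\max(|x|-R,0)+\delta$. Quantization of the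 Gaussian law: $\vartheta\sim\mathcal{N}(0,I_d)$, and $\hat\vartheta$ is the closest-neighbour projection of $\vartheta$ on a grid $\{w_1,\dots,w_N\}\subset\mathbb{R}^d$ of $N$ points which is $L^2$-optimal, i.e. minimizes $\|\vartheta-\hat\vartheta\|_2$ among $N$-point grids (in particular $\mathbb{E}[\hat\vartheta]=0$). Let $\pi_l=\mathbb{P}[\hat\vartheta=w_l]$. Quantized value functions, defined on $\mathbb{T}_h\times\mathbb{X}$ by backward induction: $\hat v_i(t_m,x)=g_i(x)$ and, for $k=0,\dots,m-1$, $$\hat v_i(t_k,x)=\max_{j\in\mathbb{I}_q}\Big[\sum_{l=1}^N\pi_l\,\hat v_j\big(t_{k+1},\mathrm{Proj}_{\mathbb{X}}(F_j^h(x,w_l))\big)+f_j(x)h-c_{ij}(x)\Big].$$ *)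

(* Defs.v *)
From HB Require Import structures.
From mathcomp Require Import all_boot all_order all_algebra.
From mathcomp Require Import finmap.
From mathcomp Require Import all_classical all_reals all_analysis.

Set Implicit Arguments.
Unset Strict Implicit.
Unset Printing Implicit Defensive.

Import Order.TTheory GRing.Theory Num.Theory.
Import numFieldNormedType.Exports.

Local Open Scope classical_set_scope.
Local Open Scope ring_scope.

(* The canonical norm on 'cV[R]_d is the sup norm; |x| is the Euclidean one. *)
Definition enorm (R : realType) (d : nat) (x : 'cV[R]_d) : R :=
  Num.sqrt (\sum_(i < d) x i 0 ^+ 2).

(* The library has no measurable structure on 'cV[R]_d, so the events
   generated by a random vector X are described by the pi-system of
   rectangles [X_j \in B_j for all j]. *)

Definition in_rect (T : Type) (R : realType) (d : nat) (X : T -> 'cV[R]_d)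
    (B : 'I_d -> set R) : set T :=
  [set w | forall j, B j (X w j 0)].

Definition measurable_wrt (T : Type) (R : realType) (d : nat)
    (G : set (set T)) (X : T -> 'cV[R]_d) : Prop :=
  forall (j : 'I_d) (B : set R), measurable B -> G [set w | B (X w j 0)].

(* X has law N(0, s^2 I_d), for s <> 0 *)
Definition gaussian_vector disp (T : measurableType disp) (R : realType)
    (P : probability T R) (d : nat) (s : R) (X : T -> 'cV[R]_d) : Prop :=
  measurable_wrt measurable X /\
  forall B : 'I_d -> set R, (forall j, measurable (B j)) ->
    P (in_rect X B) = (\prod_(j < d) normal_prob 0 s (B j))%E.

Definition independent_of disp (T : measurableType disp) (R : realType)
    (P : probability T R) (d : nat) (G : set (set T)) (X : T -> 'cV[R]_d) :
    Prop :=
  forall (A : set T) (B : 'I_d -> set R), G A -> (forall j, measurable (B j)) ->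
    P (A `&` in_rect X B) = (P A * P (in_rect X B))%E.

(* Times are reals, but only times t >= 0 are ever constrained. *)

Record usual_filtration disp (T : measurableType disp) (R : realType)
    (P : probability T R) (F : R -> set (set T)) : Prop := UsualFiltration {
  filtration_sigma_algebra : forall t, 0 <= t -> sigma_algebra setT (F t);
  filtration_measurable : forall t, 0 <= t -> F t `<=` measurable;
  filtration_nondecreasing : forall s t, 0 <= s -> s <= t -> F s `<=` F t;
  filtration_right_continuous : forall t, 0 <= t ->
    \bigcap_(s in [set s | t < s]) F s `<=` F t;
  filtration_complete : P.-negligible `<=` F 0 }.

Definition stopping_time (T : Type) (R : realType) (F : R -> set (set T))
    (tau : T -> \bar R) : Prop :=
  (forall w, (0 <= tau w)%E) /\
  forall t, 0 <= t -> F t [set w | (tau w <= t%:E)%E].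

Definition stopped_sigma disp (T : measurableType disp) (R : realType)
    (F : R -> set (set T)) (tau : T -> \bar R) : set (set T) :=
  [set A | measurable A /\
           forall t, 0 <= t -> F t (A `&` [set w | (tau w <= t%:E)%E])].

Record brownian_motion disp (T : measurableType disp) (R : realType)
    (P : probability T R) (F : R -> set (set T)) (d : nat)
    (W : R -> T -> 'cV[R]_d) : Prop := BrownianMotion {
  brownian_adapted : forall t, 0 <= t -> measurable_wrt (F t) (W t);
  brownian_start : {ae P, forall w, W 0 w = 0};
  brownian_independent : forall s t, 0 <= s -> s < t ->
    independent_of P (F s) (fun w => W t w - W s w);
  brownian_gaussian : forall s t, 0 <= s -> s < t ->
    gaussian_vector P (Num.sqrt (t - s)) (fun w => W t w - W s w);
  brownian_continuous :
    {ae P, forall w, {within `[0, +oo[, continuous (fun t => W t w)}} }.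

Record switching_data (R : realType) (d q : nat) := SwitchingData {
  drift : 'I_q -> 'cV[R]_d -> 'cV[R]_d;
  vol : 'I_q -> 'cV[R]_d -> 'M[R]_d;
  running : 'I_q -> 'cV[R]_d -> R;
  terminal : 'I_q -> 'cV[R]_d -> R;
  cost : 'I_q -> 'I_q -> 'cV[R]_d -> R }.

(* Being Lipschitz does not depend on the norms chosen on R^d, R^(d x d).
   In mathcomp-analysis, inf is 0 on a set without a lower bound, so that
   0 < inf E does entail that E is bounded below. *)
Record switching_assumptions (R : realType) (d q : nat)
    (D : switching_data R d q) : Prop := SwitchingAssumptions {
  drift_lipschitz : forall i, exists L : R, L.-lipschitz (drift D i);
  vol_lipschitz : forall i, exists L : R, L.-lipschitz (vol D i);
  running_lipschitz : forall i, exists L : R, L.-lipschitz (running D i);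
  terminal_lipschitz : forall i, exists L : R, L.-lipschitz (terminal D i);
  cost_lipschitz : forall i j, exists L : R, L.-lipschitz (cost D i j);
  cost_diag : forall i x, cost D i i x = 0;
  cost_pos : forall i j, j != i -> 0 < inf (range (cost D i j));
  cost_triangular : forall i j k, j != i -> j != k ->
    0 < inf (range (fun x => cost D i j x + cost D j k x - cost D i k x));
  terminal_obstacle : forall i j x,
    terminal D j x - cost D i j x <= terminal D i x }.

Definition euler_step (R : realType) (d q : nat) (D : switching_data R d q)
    (h : R) (i : 'I_q) (x w : 'cV[R]_d) : 'cV[R]_d :=
  x + h *: drift D i x + Num.sqrt h *: (vol D i x *m w).

Record control (T : Type) (R : realType) (q : nat) := Control {
  switch_time : nat -> T -> \bar R;
  switch_regime : nat -> T -> 'I_q }.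

(* The set A^h_{t_k, i}, where t_k = k h, the horizon is Th, and m h = Th *)
Record admissible disp (T : measurableType disp) (R : realType)
    (P : probability T R) (F : R -> set (set T)) (q : nat) (Th h : R)
    (m k : nat) (i : 'I_q) (a : control T R q) : Prop := Admissible {
  adm_stopping : forall n, stopping_time F (switch_time a n);
  adm_nondecreasing : forall n w,
    (switch_time a n w <= switch_time a n.+1 w)%E;
  adm_grid : forall n w, (switch_time a n w <= Th%:E)%E ->
    exists l, [/\ (k <= l)%N, (l <= m)%N &
                  switch_time a n w = (l%:R * h)%:E];
  adm_regime : forall n j,
    stopped_sigma F (switch_time a n) [set w | switch_regime a n w = j];
  adm_start_time : forall w, switch_time a 0%N w = (k%:R * h)%:E;
  adm_start_regime : forall w, switch_regime a 0%N w = i;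
  adm_finite : exists N : T -> nat, measurable_fun setT N /\
    {ae P, forall w, (Th%:E < switch_time a (N w) w)%E} }.

(* I_s: the regime iota_n for the (unique) n with tau_n <= s < tau_(n+1); the
   default value is only used on the null set where no such n exists. *)
Definition regime_at (T : Type) (R : realType) (q : nat) (a : control T R q)
    (s : R) (w : T) : 'I_q :=
  switch_regime a
    (xget 0%N [set n | (switch_time a n w <= s%:E < switch_time a n.+1 w)%E]) w.

Definition nb_switches (T : Type) (R : realType) (q : nat) (Th : R)
    (a : control T R q) (w : T) : nat :=
  #|` fset_set [set n | (1 <= n)%N /\ (switch_time a n w <= Th%:E)%E] |.

Definition brownian_incr (T : Type) (R : realType) (d : nat)
    (W : R -> T -> 'cV[R]_d) (h : R) (l : nat) (w : T) : 'cV[R]_d :=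
  (Num.sqrt h)^-1 *: (W (l.+1%:R * h) w - W (l%:R * h) w).

(* The Euler scheme at time t_l, started from x at time t_k; it is constant,
   equal to x, for l <= k. *)
Fixpoint euler_scheme (T : Type) (R : realType) (d q : nat)
    (D : switching_data R d q) (W : R -> T -> 'cV[R]_d) (h : R) (k : nat)
    (x : 'cV[R]_d) (a : control T R q) (l : nat) (w : T) : 'cV[R]_d :=
  if l is p.+1 then
    if (p < k)%N then x
    else euler_step D h (regime_at a (p%:R * h) w)
           (euler_scheme D W h k x a p w) (brownian_incr W h p w)
  else x.

(* The l such that t = l h, when t lies on the time grid *)
Definition grid_index (R : realType) (h : R) (t : \bar R) : nat :=
  Num.truncn (fine t / h).

Definition euler_payoff (T : Type) (R : realType) (d q : nat)
    (D : switching_data R d q) (W : R -> T -> 'cV[R]_d) (Th h : R)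
    (m k : nat) (x : 'cV[R]_d) (a : control T R q) (w : T) : R :=
  let X l := euler_scheme D W h k x a l w in
  let I l := regime_at a (l%:R * h) w in
  \sum_(k <= l < m) running D (I l) (X l) * h + terminal D (I m) (X m)
  - \sum_(1 <= n < (nb_switches Th a w).+1)
      cost D (switch_regime a n.-1 w) (switch_regime a n w)
        (X (grid_index h (switch_time a n w))).

(* \bar v_i(t_k, x) for h = Th / m. The switching costs are nonnegative, so the
   expected payoff is well defined in [-oo, +oo[. *)
Definition euler_value disp (T : measurableType disp) (R : realType)
    (P : probability T R) (F : R -> set (set T)) (d q : nat)
    (D : switching_data R d q) (W : R -> T -> 'cV[R]_d) (Th : R)
    (m : nat) (i : 'I_q) (k : nat) (x : 'cV[R]_d) : \bar R :=
  let h := Th / m%:R in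
  ereal_sup [set ('E_P[euler_payoff D W Th h m k x a])%E |
             a in admissible P F Th h m k i].

Definition space_grid (R : realType) (d : nat) (delta Rad : R) :
    set 'cV[R]_d :=
  [set x | (exists z : 'cV[int]_d,
              x = \col_j (delta / d%:R * (z j 0)%:~R)) /\ enorm x <= Rad].

Definition closest_projection (R : realType) (d : nat) (A : set 'cV[R]_d)
    (p : 'cV[R]_d -> 'cV[R]_d) : Prop :=
  forall x, A (p x) /\ forall y, A y -> enorm (x - p x) <= enorm (x - y).

Definition quant_error disp (T : measurableType disp) (R : realType)
    (P : probability T R) (d : nat) (theta : T -> 'cV[R]_d)
    (p : 'cV[R]_d -> 'cV[R]_d) (r : R) : \bar R :=
  Lnorm P r%:E (fun w => (enorm (theta w - p (theta w)))%:E).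

Definition quantizer disp (T : measurableType disp) (R : realType)
    (d N : nat) (theta : T -> 'cV[R]_d) (w : 'I_N -> 'cV[R]_d)
    (p : 'cV[R]_d -> 'cV[R]_d) : Prop :=
  [/\ injective w, closest_projection (range w) p &
      measurable_wrt measurable (p \o theta)].

Definition optimal_quantizer disp (T : measurableType disp) (R : realType)
    (P : probability T R) (d N : nat) (theta : T -> 'cV[R]_d)
    (w : 'I_N -> 'cV[R]_d) (p : 'cV[R]_d -> 'cV[R]_d) : Prop :=
  quantizer theta w p /\
  forall (w' : 'I_N -> 'cV[R]_d) (p' : 'cV[R]_d -> 'cV[R]_d),
    quantizer theta w' p' ->
    (quant_error P theta p 2 <= quant_error P theta p' 2)%E.

(* pi_l = P[p(theta) = w_l] *)
Definition quant_weight disp (T : measurableType disp) (R : realType)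
    (P : probability T R) (d N : nat) (theta : T -> 'cV[R]_d)
    (w : 'I_N -> 'cV[R]_d) (p : 'cV[R]_d -> 'cV[R]_d) (l : 'I_N) : R :=
  fine (P [set u | p (theta u) = w l]).

(* \hat v_i(t_(m - n), x): n is the number of time steps left before the
   horizon. The maximum over j is taken with its own term at j = i as neutral
   element. *)
Fixpoint quant_value (R : realType) (d q N : nat) (D : switching_data R d q)
    (h : R) (proj : 'cV[R]_d -> 'cV[R]_d) (w : 'I_N -> 'cV[R]_d)
    (prob : 'I_N -> R) (n : nat) (i : 'I_q) (x : 'cV[R]_d) : R :=
  if n is n'.+1 then
    let V j := \sum_(l < N)
                 prob l * quant_value D h proj w prob n' j
                          (proj (euler_step D h j x (w l)))
               + running D j x * h - cost D i j x in
    \big[Num.max/V i]_(j < q) V j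
  else terminal D i x.

(* Main.v *)
From HB Require Import structures.
Require Import Defs.
From mathcomp Require Import all_boot all_order all_algebra.
From mathcomp Require Import finmap.
From mathcomp Require Import all_classical all_reals all_analysis.
From mathcomp Require Import measurable_realfun.
From mathcomp Require Import ring lra zify.
Import Order.TTheory GRing.Theory Num.Theory.
Import numFieldNormedType.Exports.
Local Open Scope classical_set_scope.
Local Open Scope ring_scope.
Set Implicit Arguments.
Unset Strict Implicit.
Unset Printing Implicit Defensive.

(* The Euler value function satisfies the backward recursion [dpv]: the payoff
   of any control is at most the value plus a sum of martingale increments, with
   equality for the greedy feedback control. Both value functions being maxima
   of the same kind, their difference is the accumulation, along the quantized
   and projected chain, of the one-step errors
   E|V(F_j(x, theta)) - V(Proj F_j(x, theta^))|, which are controlled by the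
   regularity of V and by the moments of that chain.

   If the costs are constant, V is Lipschitz uniformly in h. Otherwise let
   w(x) = sqrt(1 + |x|^2), let G = C rho^n w - V >= 0 be the gap between V and
   its growth bound, and let Q = w^2 + 2 L w G - G^2, where G <= L w. Along an
   optimal decision G loses at least the cost of a switch, so that G bounds the
   number of remaining switches, and Q loses half of the variance of G. Hence
   M rho^n ((G(x) + 1) |x - y| + 2 eps Q(x) + |x - y|^2 / eps) dominates
   V(x) - V(y) for all eps > 0, and optimizing in eps yields
   |V(x) - V(y)| <= K (w(x) + w(y)) |x - y|. *)

(** * Euclidean norm and uniform constants *)

(** With costs depending on [x], imposing one decision on two starting points charges a Lipschitz
    constant for each switch; a step-by-step bound such as [lipc] charges it at all steps and
    explodes as h tends to 0. The number of switches is controlled only in mean and is correlated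
    with the distance of the two trajectories. The energy [Q] is there to absorb this correlation,
    and the price is the factor w(x) + w(y).

    The exponentials of the estimate come from the quantized chain. With eta the quantization error,
    one step multiplies second moments by 1 + K (h + E|eta|^2) and fourth moments by 1 + K (h +
    E|eta|^4 / h); over at most Th / h steps this yields exponentials of E|eta|^2 / h and E|eta|^4 /
    h^2. A projection can push the chain outwards by [delta], so delta / h is built into the weight
    [qwt], relative to which a projection costs a mere factor 1 + 2h. Leaving the ball of radius R
    is paid by |y| <= |y|^2 / R, which raises the degree by one; with the local Lipschitz weight
    this calls for third moments, interpolated from fourth ones. *)

Section euclidean.
Context {R : realType} {d : nat}.
Implicit Types (x y z : 'cV[R]_d) (a b : R).

Definition dotv x y : R := \sum_i x i 0 * y i 0.

Lemma dotvC x y : dotv x y = dotv y x.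
Proof. by apply: eq_bigr => i _; rewrite mulrC. Qed.

Lemma dotvDl x y z : dotv (x + y) z = dotv x z + dotv y z.
Proof. by rewrite -big_split; apply: eq_bigr => i _; rewrite !mxE mulrDl. Qed.

Lemma dotvZl a x y : dotv (a *: x) y = a * dotv x y.
Proof. by rewrite mulr_sumr; apply: eq_bigr => i _; rewrite !mxE mulrA. Qed.

Lemma dotvDr x y z : dotv z (x + y) = dotv z x + dotv z y.
Proof. by rewrite dotvC dotvDl !(dotvC _ z). Qed.

Lemma dotvZr a x y : dotv y (a *: x) = a * dotv y x.
Proof. by rewrite dotvC dotvZl dotvC. Qed.

Lemma dotvv_ge0 x : 0 <= dotv x x.
Proof. by apply: sumr_ge0 => i _; rewrite -expr2 sqr_ge0. Qed.

Lemma enorm_ge0 x : 0 <= enorm x. Proof. exact: sqrtr_ge0. Qed.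

Lemma enorm_sqr x : enorm x ^+ 2 = dotv x x.
Proof.
rewrite sqr_sqrtr; last by apply: sumr_ge0 => i _; rewrite sqr_ge0.
by apply: eq_bigr => i _; rewrite expr2.
Qed.

Lemma coord_le_enorm x i : `|x i 0| <= enorm x.
Proof.
rewrite -sqrtr_sqr; apply: ler_wsqrtr; rewrite (bigD1 i)//= lerDl.
by apply: sumr_ge0 => j _; rewrite sqr_ge0.
Qed.

Lemma enorm_eq0 x : enorm x = 0 -> x = 0.
Proof.
move=> x0; apply/colP => i; rewrite mxE.
by have := coord_le_enorm x i; rewrite x0 normr_le0 => /eqP.
Qed.

Lemma dotv0 x : dotv 0 x = 0.
Proof. by apply: big1 => i _; rewrite mxE mul0r. Qed.

(** Cauchy-Schwarz: the squared norm of |y| x - |x| y is nonnegative and factors as 2 |x| |y| (|x|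
    |y| - x.y); when |x| |y| = 0, one of the vectors is zero. *)
Lemma dotv_le x y : dotv x y <= enorm x * enorm y.
Proof.
have [/eqP|xy0] := eqVneq (enorm x * enorm y) 0.
  rewrite mulf_eq0 => /orP[] /eqP /[dup] e0 /enorm_eq0 ->.
    by rewrite dotv0 mulr_ge0 ?enorm_ge0.
  by rewrite dotvC dotv0 mulr_ge0 ?enorm_ge0.
have p0 : 0 < enorm x * enorm y by rewrite lt_def xy0 mulr_ge0 ?enorm_ge0.
have := dotvv_ge0 (enorm y *: x + (- enorm x) *: y).
rewrite !(dotvDl, dotvDr, dotvZl, dotvZr) -!enorm_sqr (dotvC y x).
set u := enorm x in p0 *; set v := enorm y in p0 *; set t := dotv x y.
rewrite (_ : _ + _ = 2 * (u * v) * (u * v - t)); last by ring.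
by rewrite pmulr_rge0 ?subr_ge0// mulr_gt0.
Qed.

Lemma enormZ a x : enorm (a *: x) = `|a| * enorm x.
Proof.
apply/eqP; rewrite -(@eqrXn2 _ 2) ?enorm_ge0 ?mulr_ge0 ?enorm_ge0//.
by rewrite exprMn !enorm_sqr dotvZl dotvZr mulrA -expr2 real_normK ?num_real.
Qed.

Lemma enormN x : enorm (- x) = enorm x.
Proof. by rewrite -scaleN1r enormZ normrN1 mul1r. Qed.

Lemma enormB x y : enorm (x - y) = enorm (y - x).
Proof. by rewrite -enormN opprB. Qed.

Lemma enorm0 : enorm (0 : 'cV[R]_d) = 0.
Proof. by rewrite -(scale0r 0) enormZ normr0 mul0r. Qed.

Lemma enormD x y : enorm (x + y) <= enorm x + enorm y.
Proof.
rewrite -(@ler_pXn2r _ 2) ?nnegrE ?enorm_ge0 ?addr_ge0 ?enorm_ge0//.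
rewrite enorm_sqr dotvDl !dotvDr -!enorm_sqr (dotvC y x).
by have := dotv_le x y; lra.
Qed.

Lemma enorm_dist x y : `|enorm x - enorm y| <= enorm (x - y).
Proof.
have h1 : enorm x <= enorm (x - y) + enorm y.
  by rewrite -{1}(subrK y x) enormD.
have h2 : enorm y <= enorm (x - y) + enorm x.
  by rewrite -{1}(subrK x y) enormB enormD.
by rewrite ler_norml; lra.
Qed.

Lemma enorm_le_sum x : enorm x <= \sum_i `|x i 0|.
Proof.
rewrite -(@ler_pXn2r _ 2) ?nnegrE ?enorm_ge0 ?sumr_ge0//.
rewrite enorm_sqr [leRHS]expr2 mulr_suml; apply: ler_sum => i _.
rewrite (le_trans (ler_norm _))// normrM ler_wpM2l//.
by rewrite (bigD1 i)//= lerDl sumr_ge0.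
Qed.

Lemma normr_dotv_le x y : `|dotv x y| <= enorm x * enorm y.
Proof.
rewrite ler_norml dotv_le andbT lerNl -[- _]mulN1r -dotvZl.
by rewrite (le_trans (dotv_le _ _))// scaleN1r enormN.
Qed.

Lemma normr_le_enorm x : `|x| <= enorm x.
Proof.
have [->|x0] := eqVneq x 0; first by rewrite normr0 enorm_ge0.
have /mx_norm_neq0[[i j] e] : mx_norm x != 0 by apply: contra_neq x0; exact: mx_norm_eq0.
have -> : `|x| = `|x i j| by exact: e.
by rewrite (ord1 j) coord_le_enorm.
Qed.

End euclidean.

Lemma mxcoord_le_norm {R : realType} {m n : nat} (A : 'M[R]_(m, n)) i j :
  `|A i j| <= `|A|.
Proof.
have -> : `|A| = mx_norm A by [].
rewrite mx_normrE; exact: (le_bigmax _ (fun i : 'I_m * 'I_n => `|A i.1 i.2|) (i, j)).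
Qed.

Section euclidean_matrix.
Context {R : realType} {d : nat}.
Implicit Types (x y z : 'cV[R]_d).

Lemma enorm_le_norm x : enorm x <= d%:R * `|x|.
Proof.
apply: (le_trans (enorm_le_sum x)).
rewrite -[X in X%:R * _](card_ord d) -sum1_card natr_sum mulr_suml.
by apply: ler_sum => i _; rewrite mul1r mxcoord_le_norm.
Qed.

Lemma enorm_mulmx_le (A : 'M[R]_d) x :
  enorm (A *m x) <= d%:R ^+ 2 * `|A| * enorm x.
Proof.
apply: (le_trans (enorm_le_norm _)).
rewrite expr2 -!mulrA ler_wpM2l// -[leLHS]/(mx_norm _) mx_normrE.
apply: bigmax_le => [|[i j] _ /=].
  by rewrite !mulr_ge0 ?enorm_ge0.
rewrite mxE (le_trans (ler_norm_sum _ _ _))//.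
rewrite -[X in _ <= X%:R * _](card_ord d) -sum1_card natr_sum mulr_suml.
apply: ler_sum => k _; rewrite mul1r normrM (ord1 j).
by rewrite ler_pM ?mxcoord_le_norm ?coord_le_enorm.
Qed.

End euclidean_matrix.

Section data_bounds.
Context {R : realType} {d : nat}.

Definition elip {R : realType} {d : nat} (L : R) (phi : 'cV[R]_d -> R) :=
  forall x y, `|phi x - phi y| <= L * enorm (x - y).

(** A 1-Lipschitz substitute for 1 + |x| whose square is exactly 1 + |x|^2, so that its second
    moment along an Euler step closes up without an additive constant. *)
Definition wgt (x : 'cV[R]_d) : R := Num.sqrt (1 + enorm x ^+ 2).

Lemma wgt_sqr x : wgt x ^+ 2 = 1 + enorm x ^+ 2.
Proof. by rewrite sqr_sqrtr// addr_ge0// sqr_ge0. Qed.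

Lemma wgt_ge1 x : 1 <= wgt x.
Proof. by rewrite -{1}sqrtr1 ler_wsqrtr// lerDl sqr_ge0. Qed.

Lemma wgt_gt0 x : 0 < wgt x.
Proof. exact: lt_le_trans (wgt_ge1 x). Qed.

Lemma wgt_ge0 x : 0 <= wgt x.
Proof. exact/ltW/wgt_gt0. Qed.

Lemma enorm_le_wgt x : enorm x <= wgt x.
Proof.
by rewrite -(@ler_pXn2r _ 2) ?nnegrE ?enorm_ge0 ?wgt_ge0// wgt_sqr lerDr.
Qed.

Lemma wgt_le x : wgt x <= 1 + enorm x.
Proof.
have e0 := enorm_ge0 x.
rewrite -(@ler_pXn2r _ 2) ?nnegrE ?addr_ge0 ?wgt_ge0// wgt_sqr; nra.
Qed.

Lemma wgt_dist x y : `|wgt x - wgt y| <= enorm (x - y).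
Proof.
have h u v : wgt u - wgt v <= enorm (u - v).
  have hu := wgt_gt0 u; have hv := wgt_gt0 v.
  have := enorm_dist u v; rewrite ler_norml => /andP[_ h].
  have [le0|gt0] := leP (enorm u) (enorm v).
    apply: (@le_trans _ _ 0); last exact: enorm_ge0.
    rewrite subr_le0 -(@ler_pXn2r _ 2) ?nnegrE ?wgt_ge0// !wgt_sqr lerD2l.
    by rewrite ler_pXn2r ?nnegrE ?enorm_ge0.
  apply: le_trans h.
  have := wgt_sqr u; have := wgt_sqr v; have := enorm_le_wgt u; have := enorm_le_wgt v.
  move=> h1 h2 h3 h4.
  have : (wgt u - wgt v) * (wgt u + wgt v) <= (enorm u - enorm v) * (wgt u + wgt v).
    have -> : (wgt u - wgt v) * (wgt u + wgt v) = (enorm u - enorm v) * (enorm u + enorm v).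
      by lra.
    by rewrite ler_pM2l ?subr_gt0//; lra.
  by rewrite ler_pM2r//; lra.
by rewrite ler_norml h andbT lerNl opprB enormB h.
Qed.

Variable q : nat.

(** The assumptions in quantitative form: one [C] for all regimes and coefficients, one lower bound
    [c0] for the costs. Matrices are bounded through their action on vectors, and the triangular
    inequality is made non-strict so that it also covers repeated regimes. *)
Record regular_data (C c0 : R) (D : switching_data R d q) : Prop := RegularData {
  reg_ge1 : 1 <= C;
  reg_gt0 : 0 < c0;
  reg_drift_lip : forall i x y, enorm (drift D i x - drift D i y) <= C * enorm (x - y);
  reg_vol_lip : forall i x y v,
    enorm ((vol D i x - vol D i y) *m v) <= C * enorm (x - y) * enorm v;
  reg_running_lip : forall i, elip C (running D i);
  reg_terminal_lip : forall i, elip C (terminal D i);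
  reg_cost_lip : forall i j, elip C (cost D i j);
  reg_drift_growth : forall i x, enorm (drift D i x) <= C * wgt x;
  reg_vol_growth : forall i x v, enorm (vol D i x *m v) <= C * wgt x * enorm v;
  reg_running_growth : forall i x, `|running D i x| <= C * wgt x;
  reg_terminal_growth : forall i x, `|terminal D i x| <= C * wgt x;
  reg_cost_diag : forall i x, cost D i i x = 0;
  reg_cost_lb : forall i j x, j != i -> c0 <= cost D i j x;
  reg_cost_tri : forall i j k x, cost D i k x <= cost D i j x + cost D j k x;
  reg_obstacle : forall i j x, terminal D j x - cost D i j x <= terminal D i x }.

(** The conclusion holds above a threshold rather than at one value, so that a single constant can
    later exceed the thresholds of all the assumptions at once. *)
Lemma fin_uniform (T : finType) (Q : T -> R -> Prop) :
  (forall t C C', C <= C' -> Q t C -> Q t C') ->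
  (forall t, exists C, Q t C) -> exists C, forall C', C <= C' -> forall t, Q t C'.
Proof.
move=> Qmono /choice[f fQ]; exists (\sum_t `|f t|) => C' hC' t.
apply: Qmono (fQ t); apply: le_trans hC'; apply: (le_trans (ler_norm _)).
by rewrite (bigD1 t)//= lerDl sumr_ge0.
Qed.

Lemma lipschitzP (V : normedModType R) (L : R) (f : 'cV[R]_d -> V) :
  L.-lipschitz f -> forall x y, `|f x - f y| <= `|L| * enorm (x - y).
Proof.
move=> fL x y; apply: (le_trans (fL (x, y) _)) => //=.
rewrite (le_trans (ler_norm _))// normrM normr_id.
by rewrite ler_wpM2l// normr_le_enorm.
Qed.

Lemma elip_growth (L : R) (f : 'cV[R]_d -> R) : elip L f ->
  exists C, forall C', C <= C' -> forall x, `|f x| <= C' * wgt x.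
Proof.
move=> fL; exists (`|f 0| + `|L|) => C' hC' x.
have := fL x 0; rewrite subr0 => h.
have h1 : `|f x| <= `|f 0| + `|L| * enorm x.
  rewrite -(subrK (f 0) (f x)) addrC (le_trans (ler_normD _ _))// lerD2l.
  by rewrite (le_trans h)// ler_wpM2r ?enorm_ge0 ?ler_norm.
apply: (le_trans h1); apply: (@le_trans _ _ ((`|f 0| + `|L|) * wgt x)); last first.
  by rewrite ler_wpM2r ?wgt_ge0.
by rewrite mulrDl lerD// ?ler_wpM2l ?enorm_le_wgt// ler_peMr ?wgt_ge1.
Qed.

Lemma inf_range_le (f : 'cV[R]_d -> R) x : 0 < inf (range f) -> inf (range f) <= f x.
Proof.
move=> i0; apply: ge_inf; last by exists x.
apply: contrapT => nlb; suff : inf (range f) = 0 by move=> e; rewrite e ltxx in i0.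
by apply: inf_out; case.
Qed.

Lemma regular_dataP (D : switching_data R d q) :
  switching_assumptions D -> exists C c0, regular_data C c0 D.
Proof.
move=> DA.
have [C1 h1] : exists C, forall C', C <= C' -> forall i x y,
    enorm (drift D i x - drift D i y) <= C' * enorm (x - y).
  apply: fin_uniform => [i C C' CC' h x y|i].
    by rewrite (le_trans (h _ _))// ler_wpM2r ?enorm_ge0.
  have [L /lipschitzP hL] := drift_lipschitz DA i; exists (d%:R * `|L|) => x y.
  by rewrite (le_trans (enorm_le_norm _))// -mulrA ler_wpM2l.
have [C2 h2] : exists C, forall C', C <= C' -> forall i x y v,
    enorm ((vol D i x - vol D i y) *m v) <= C' * enorm (x - y) * enorm v.
  apply: fin_uniform => [i C C' CC' h x y v|i].
    by rewrite (le_trans (h _ _ _))// ler_wpM2r ?enorm_ge0// ler_wpM2r ?enorm_ge0.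
  have [L /lipschitzP hL] := vol_lipschitz DA i; exists (d%:R ^+ 2 * `|L|) => x y v.
  rewrite (le_trans (enorm_mulmx_le _ _))// ler_wpM2r ?enorm_ge0//.
  by rewrite -[leRHS]mulrA ler_wpM2l ?exprn_ge0.
have elip_mono (f : 'cV[R]_d -> R) C C' : C <= C' -> elip C f -> elip C' f.
  by move=> CC' h x y; rewrite (le_trans (h _ _))// ler_wpM2r ?enorm_ge0.
have [C3 h3] : exists C, forall C', C <= C' -> forall i, elip C' (running D i).
  apply: fin_uniform => [i C C'|i]; first exact: elip_mono.
  by have [L /lipschitzP hL] := running_lipschitz DA i; exists `|L|.
have [C4 h4] : exists C, forall C', C <= C' -> forall i, elip C' (terminal D i).
  apply: fin_uniform => [i C C'|i]; first exact: elip_mono.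
  by have [L /lipschitzP hL] := terminal_lipschitz DA i; exists `|L|.
have [C5 h5] : exists C, forall C', C <= C' ->
    forall ij : 'I_q * 'I_q, elip C' (cost D ij.1 ij.2).
  apply: fin_uniform => [i C C'|i]; first exact: elip_mono.
  by have [L /lipschitzP hL] := cost_lipschitz DA i.1 i.2; exists `|L|.
have wmono (f : 'cV[R]_d -> R) C C' : C <= C' ->
    (forall x, f x <= C * wgt x) -> forall x, f x <= C' * wgt x.
  by move=> CC' h x; rewrite (le_trans (h _))// ler_wpM2r ?wgt_ge0.
have [C6 h6] : exists C, forall C', C <= C' -> forall i x,
    enorm (drift D i x) <= C' * wgt x.
  apply: fin_uniform => [i C C'|i]; first exact: wmono.
  have hl : elip C1 (fun x => enorm (drift D i x)).
    by move=> x y; rewrite (le_trans (enorm_dist _ _))// h1.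
  have [C hC] := elip_growth hl; exists C => x; have := hC _ (lexx C) x.
  by rewrite ger0_norm ?enorm_ge0.
have [C7 h7] : exists C, forall C', C <= C' -> forall i x v,
    enorm (vol D i x *m v) <= C' * wgt x * enorm v.
  apply: fin_uniform => [i C C' CC' h x v|i].
    by rewrite (le_trans (h _ _))// ler_wpM2r ?enorm_ge0// ler_wpM2r ?wgt_ge0.
  have [L /lipschitzP hL] := vol_lipschitz DA i.
  have hl : elip `|L| (fun x => `|vol D i x|).
    by move=> x y; rewrite (le_trans (ler_dist_dist _ _)).
  have [C hC] := elip_growth hl; exists (d%:R ^+ 2 * C) => x v.
  have := hC _ (lexx C) x; rewrite normr_id => {}hC.
  rewrite (le_trans (enorm_mulmx_le _ _))// ler_wpM2r ?enorm_ge0//.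
  by rewrite -mulrA ler_wpM2l ?exprn_ge0.
have [C8 h8] : exists C, forall C', C <= C' -> forall i x,
    `|running D i x| <= C' * wgt x.
  apply: fin_uniform => [i C C'|i]; first exact: wmono.
  by have [C hC] := elip_growth (h3 _ (lexx _) i); exists C; exact: hC.
have [C9 h9] : exists C, forall C', C <= C' -> forall i x,
    `|terminal D i x| <= C' * wgt x.
  apply: fin_uniform => [i C C'|i]; first exact: wmono.
  by have [C hC] := elip_growth (h4 _ (lexx _) i); exists C; exact: hC.
(* The lower bound of the costs is put as an upper bound on its inverse, which makes it monotone in
   the direction that [fin_uniform] requires. *)
have [c hc] : exists c, forall c', c <= c' -> forall ij : 'I_q * 'I_q,
    0 < c' /\ forall x, ij.2 != ij.1 -> c'^-1 <= cost D ij.1 ij.2 x.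
  apply: fin_uniform => [ij C C' CC' [C0 h]|[i j] /=].
    split=> [|x ji]; first exact: lt_le_trans CC'.
    by rewrite (le_trans _ (h x ji))// lef_pV2 ?posrE// (lt_le_trans C0).
  have [->|ji] := eqVneq j i; first by exists 1.
  exists (inf (range (cost D i j)))^-1; rewrite invr_gt0; split=> [|x _].
    exact: (cost_pos DA ji).
  by rewrite invrK inf_range_le ?(cost_pos DA ji).
pose C := 1 + `|C1| + `|C2| + `|C3| + `|C4| + `|C5| + `|C6| + `|C7| + `|C8| + `|C9|.
have n1 := ler_norm C1; have n2 := ler_norm C2; have n3 := ler_norm C3.
have n4 := ler_norm C4; have n5 := ler_norm C5; have n6 := ler_norm C6.
have n7 := ler_norm C7; have n8 := ler_norm C8; have n9 := ler_norm C9.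
have p1 := normr_ge0 C1; have p2 := normr_ge0 C2; have p3 := normr_ge0 C3.
have p4 := normr_ge0 C4; have p5 := normr_ge0 C5; have p6 := normr_ge0 C6.
have p7 := normr_ge0 C7; have p8 := normr_ge0 C8; have p9 := normr_ge0 C9.
pose c1 := `|c| + 1; have c1_gt0 : 0 < c1 by rewrite ltr_wpDl.
have cc1 : c <= c1 by rewrite (le_trans (ler_norm c))// lerDl.
exists C, c1^-1; split; rewrite /C ?invr_gt0//.
- by lra.
- by apply: h1; lra.
- by apply: h2; lra.
- by apply: h3; lra.
- by apply: h4; lra.
- by move=> i j; apply: (h5 _ _ (i, j)); lra.
- by apply: h6; lra.
- by apply: h7; lra.
- by apply: h8; lra.
- by apply: h9; lra.
- exact: cost_diag.
- by move=> i j x; exact: (hc _ cc1 (i, j)).2.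
- move=> i j k x; have [->|ji] := eqVneq j i; first by rewrite cost_diag// add0r.
  have [->|jk] := eqVneq j k; first by rewrite cost_diag// addr0.
  have h := cost_triangular DA ji jk.
  have := inf_range_le x h; lra.
- exact: terminal_obstacle.
Qed.

Lemma reg_cost_ge0 (C c0 : R) (D : switching_data R d q) :
  regular_data C c0 D -> forall i j x, 0 <= cost D i j x.
Proof.
move=> H i j x; have [->|ji] := eqVneq j i; first by rewrite (reg_cost_diag H).
exact: (le_trans (ltW (reg_gt0 H)) (reg_cost_lb H _ ji)).
Qed.

End data_bounds.

(** * Random vectors *)

Definition mvec {R : realType} {d : nat} disp (T : measurableType disp)
    (X : T -> 'cV[R]_d) :=
  forall j, measurable_fun setT (fun w => X w j 0).

Section vector_measurability.
Context {R : realType} {d : nat}.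

Lemma mvecE disp (T : measurableType disp) (X : T -> 'cV[R]_d) :
  mvec X <-> measurable_wrt measurable X.
Proof.
split=> h j; first by move=> B mB; have := h j measurableT B mB; rewrite setTI.
by move=> _ B mB; rewrite setTI; exact: h.
Qed.

Lemma measurable_enorm disp (T : measurableType disp) (X : T -> 'cV[R]_d) :
  mvec X -> measurable_fun setT (fun w => enorm (X w)).
Proof.
move=> mX; rewrite /enorm.
apply: (measurableT_comp (f := (Num.sqrt : R -> R))
  (g := fun w => \sum_(i < d) X w i 0 ^+ 2)).
  by apply: continuous_measurable_fun; exact: sqrt_continuous.
by apply: measurable_sum => i; exact: measurable_funX.
Qed.

Lemma mvecD disp (T : measurableType disp) (X Y : T -> 'cV[R]_d) :
  mvec X -> mvec Y -> mvec (fun w => X w + Y w).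
Proof.
move=> mX mY j; rewrite (_ : (fun _ => _) = (fun w => X w j 0 + Y w j 0)).
  exact: measurable_funD.
by apply/funext => w; rewrite mxE.
Qed.

Lemma mvecZ disp (T : measurableType disp) (X : T -> 'cV[R]_d) (f : T -> R) :
  measurable_fun setT f -> mvec X -> mvec (fun w => f w *: X w).
Proof.
move=> mf mX j; rewrite (_ : (fun _ => _) = (fun w => f w * X w j 0)).
  exact: measurable_funM.
by apply/funext => w; rewrite mxE.
Qed.

Lemma mvec_cst disp (T : measurableType disp) (x : 'cV[R]_d) : mvec (fun _ : T => x).
Proof. by move=> j; exact: measurable_cst. Qed.

Lemma mvecN disp (T : measurableType disp) (X : T -> 'cV[R]_d) :
  mvec X -> mvec (fun w => - X w).
Proof.
move=> mX; rewrite (_ : (fun _ => _) = (fun w => cst (-1) w *: X w)).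
  exact: mvecZ.
by apply/funext => w; rewrite /= scaleN1r.
Qed.

Lemma mvecB disp (T : measurableType disp) (X Y : T -> 'cV[R]_d) :
  mvec X -> mvec Y -> mvec (fun w => X w - Y w).
Proof. by move=> mX mY; apply: mvecD => //; exact: mvecN. Qed.

Lemma mvec_mulmx disp (T : measurableType disp) (X : T -> 'cV[R]_d)
    (A : T -> 'M[R]_d) :
  (forall i j, measurable_fun setT (fun w => A w i j)) ->
  mvec X -> mvec (fun w => A w *m X w).
Proof.
move=> mA mX j.
rewrite (_ : (fun _ => _) = (fun w => \sum_k A w j k * X w k 0)).
  by apply: measurable_sum => k; exact: measurable_funM.
by apply/funext => w; rewrite mxE.
Qed.

Lemma rat_approx (x : 'cV[R]_d) (e : R) : 0 < e ->
  exists p : 'cV[rat]_d, enorm (x - \col_j ratr (p j 0)) < e.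
Proof.
move=> e0; pose e' := e / (d%:R + 1).
have e'0 : 0 < e' by rewrite divr_gt0// ltr_wpDl.
have /choice[f hf] : forall j : 'I_d, exists p : rat, `|x j 0 - ratr p| < e'.
  move=> j; have [|p] := @rat_in_itvoo _ (x j 0 - e') (x j 0 + e').
    by rewrite ltrD2l gtrN.
  rewrite in_itv/= => /andP[h1 h2]; exists p; rewrite ltr_norml; lra.
exists (\col_j f j); apply: (le_lt_trans (enorm_le_sum _)).
apply: (@le_lt_trans _ _ (\sum_(j < d) e')).
  by apply: ler_sum => j _; rewrite !mxE ltW.
rewrite sumr_const card_ord -mulr_natl /e' mulrCA gtr_pMr//.
by rewrite ltr_pdivrMr ?ltr_wpDl// mul1r ltrDl.
Qed.

(** A Lipschitz function is the supremum, over rational points p, of the cones phi(p) - |L| |x - p|;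
    a superlevel set of [phi (X w)] is therefore a countable union of events that involve only
    [enorm]. *)
Lemma measurable_elip disp (T : measurableType disp) (X : T -> 'cV[R]_d) L phi :
  mvec X -> elip L phi -> measurable_fun setT (fun w => phi (X w)).
Proof.
move=> mX phiL; apply: (measurability _ (RGenOInfty.measurableE R)).
move=> _ [_ [a ->]] <-; rewrite setTI.
pose pt (p : 'cV[rat]_d) : 'cV[R]_d := \col_j ratr (p j 0).
rewrite (_ : _ @^-1` _ = \bigcup_(p : 'cV[rat]_d)
  [set w | a < phi (pt p) - `|L| * enorm (X w - pt p)]).
  apply: countable_bigcupT_measurable.
    exact: (@countableP ('cV[rat]_d : countType)).
  move=> p; rewrite -[X in measurable X]setTI.
  rewrite (_ : [set _ | _] = (fun w => phi (pt p) - `|L| * enorm (X w - pt p)) @^-1` `]a, +oo[); last first.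
    by apply/seteqP; split => w /=; rewrite in_itv/= andbT.
  suff mf : measurable_fun setT (fun w => phi (pt p) - `|L| * enorm (X w - pt p)).
    by apply: mf => //; exact: measurable_itv.
  apply: measurable_funB => //; apply: measurable_funM => //.
  by apply: measurable_enorm; apply: mvecB => //; exact: mvec_cst.
apply/seteqP; split=> [w/=|w [p _/=]]; rewrite in_itv/= andbT.
  (* Passing to a point at distance less than [e] costs |L| e twice, once for [phi] and once for the
     cone; the added 1 keeps the denominator positive. *)
  move=> aw; pose e := (phi (X w) - a) / (2 * `|L| + 1).
  have L0 := normr_ge0 L.
  have e0 : 0 < e by rewrite divr_gt0 ?subr_gt0//; lra.
  have [p hp] := rat_approx (X w) e0; exists p => //=.
  have := phiL (X w) (pt p); rewrite ler_norml => /andP[_ h].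
  have hL : L * enorm (X w - pt p) <= `|L| * enorm (X w - pt p).
    by rewrite ler_wpM2r ?enorm_ge0 ?ler_norm.
  have : e * (2 * `|L| + 1) = phi (X w) - a.
    by rewrite /e divfK//; lra.
  have := enorm_ge0 (X w - pt p); rewrite -/(pt p) in hp *.
  set r := enorm _ in h hp hL *; nra.
move=> h; apply: lt_le_trans h _.
have := phiL (pt p) (X w); rewrite enormB ler_norml => /andP[_ h].
have hL : L * enorm (X w - pt p) <= `|L| * enorm (X w - pt p).
  by rewrite ler_wpM2r ?enorm_ge0 ?ler_norm.
lra.
Qed.

End vector_measurability.

(** * The product sigma-algebra on vectors and equality of Gaussian laws *)

Section rectangles.
Context {R : realType} {d : nat}.

Definition rects : set (set 'cV[R]_d) :=
  [set A | exists B : 'I_d -> set R,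
     (forall j, measurable (B j)) /\ A = [set x : 'cV[R]_d | forall j, B j (x j 0)]].

(** Vectors with the sigma-algebra generated by rectangles: image measures, product measures and
    Tonelli become available, and [mvec] amounts to measurability into this type. *)
Definition mcV := g_sigma_algebraType rects.

Lemma rectsI : setI_closed rects.
Proof.
move=> _ _ [B [mB ->]] [B' [mB' ->]]; exists (fun j => B j `&` B' j); split.
  by move=> j; exact: measurableI.
by apply/seteqP; split=> x /=; [case=> h h' j; split|move=> h; split=> j; have [] := h j].
Qed.

Lemma rectsT : rects setT.
Proof.
exists (fun=> setT); split=> [_|]; first exact: measurableT.
by apply/seteqP; split=> x /=.
Qed.

Lemma mvec_id : mvec (idfun : mcV -> 'cV[R]_d).
Proof.
move=> j _ B mB; rewrite setTI; apply: sub_sigma_algebra.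
exists (fun i => if i == j then B else setT); split=> [i|].
  by case: ifP => // _; exact: measurableT.
apply/seteqP; split=> x /=; first by move=> h i; case: eqP => // ->.
by move=> /(_ j); rewrite eqxx.
Qed.

Lemma measurable_mcV disp (T : measurableType disp) (X : T -> 'cV[R]_d) :
  mvec X -> measurable_fun setT (X : T -> mcV).
Proof.
move=> mX; apply: (@measurability _ _ T mcV setT X rects) => // _ [_ [B [mB ->]] <-]; rewrite setTI.
rewrite (_ : _ @^-1` _ = \bigcap_(j in [set: 'I_d]) [set w | B j (X w j 0)]).
  apply: fin_bigcap_measurable => // j _.
  by have /mvecE := mX; exact.
by apply/seteqP; split=> w /=; [move=> h j _; exact: h|move=> h j; exact: h].
Qed.

Context disp (Omega : measurableType disp) (P : probability Omega R).

(** Uniqueness on a pi-system: rectangles are stable under intersection, and the whole space is one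
    of them, so the constant sequence serves as exhaustion. *)
Lemma mcV_measure_unique (m1 m2 : {measure set mcV -> \bar R}) :
  (m1 setT < +oo)%E -> (forall A, rects A -> m1 A = m2 A) ->
  forall A, measurable A -> m1 A = m2 A.
Proof.
move=> m1fin m12 A mA.
apply: (@g_sigma_algebra_measure_unique _ R mcV rects _ (fun _ : nat => setT) _ _ m1 m2) => //.
- exact: sub_sigma_algebra.
- by move=> _; exact: rectsT.
- by rewrite bigcup_const//; exists 0%N.
- exact: rectsI.
Qed.

Lemma gaussian_vector_mvec s (X : Omega -> 'cV[R]_d) :
  gaussian_vector P s X -> mvec X.
Proof. by case=> mX _; apply/mvecE. Qed.

Lemma gaussian_vector_law s (X Y : Omega -> 'cV[R]_d) :
  gaussian_vector P s X -> gaussian_vector P s Y ->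
  forall A : set mcV, measurable A -> P (X @^-1` A) = P (Y @^-1` A).
Proof.
move=> gX gY; have mX := measurable_mcV (gaussian_vector_mvec gX).
have mY := measurable_mcV (gaussian_vector_mvec gY).
move=> A mA.
pose m1 := [the {measure set mcV -> \bar R} of pushforward P (X : Omega -> mcV)].
pose m2 := [the {measure set mcV -> \bar R} of pushforward P (Y : Omega -> mcV)].
suff : m1 mX A = m2 mY A by [].
apply: (@mcV_measure_unique (m1 mX) (m2 mY)) => //.
  by rewrite /m1 /= /pushforward preimage_setT probability_setT ltry.
move=> _ [B [mB ->]]; rewrite /m1 /m2 /= /pushforward.
by have [_ ->//] := gX; have [_ ->//] := gY.
Qed.

Lemma gaussian_vector_ge0_integral s (X Y : Omega -> 'cV[R]_d) (f : 'cV[R]_d -> \bar R) :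
  gaussian_vector P s X -> gaussian_vector P s Y ->
  measurable_fun setT (f : mcV -> \bar R) -> (forall x, 0 <= f x)%E ->
  (\int[P]_w f (X w) = \int[P]_w f (Y w))%E.
Proof.
move=> gX gY mf f0; have mX := measurable_mcV (gaussian_vector_mvec gX).
have mY := measurable_mcV (gaussian_vector_mvec gY).
have /= <- := @ge0_integral_pushforward _ _ _ _ _ _ mX P setT f measurableT mf (fun x _ => f0 x).
have /= <- := @ge0_integral_pushforward _ _ _ _ _ _ mY P setT f measurableT mf (fun x _ => f0 x).
apply: eq_measure_integral => A mA _.
exact: gaussian_vector_law gX gY _ mA.
Qed.

(** This is what lets a Brownian increment be exchanged for [theta]; positive and negative parts are
    transferred separately. *)
Lemma gaussian_vector_integral s (X Y : Omega -> 'cV[R]_d) (f : 'cV[R]_d -> \bar R) :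
  gaussian_vector P s X -> gaussian_vector P s Y ->
  measurable_fun setT (f : mcV -> \bar R) ->
  (\int[P]_w f (X w) = \int[P]_w f (Y w))%E.
Proof.
move=> gX gY mf; rewrite integralE [RHS]integralE; congr (_ - _)%E.
  have h := @gaussian_vector_ge0_integral s X Y (f^\+)%E gX gY (measurable_funepos mf) (funepos_ge0 f).
  transitivity (\int[P]_w f^\+ (X w))%E.
    by apply: eq_integral => w _; rewrite !funeposE.
  by rewrite h; apply: eq_integral => w _; rewrite !funeposE.
have h := @gaussian_vector_ge0_integral s X Y (f^\-)%E gX gY (measurable_funeneg mf) (funeneg_ge0 f).
transitivity (\int[P]_w f^\- (X w))%E.
  by apply: eq_integral => w _; rewrite !funenegE.
by rewrite h; apply: eq_integral => w _; rewrite !funenegE.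
Qed.

End rectangles.

(** * The normal law *)

Section gaussian.
Context {R : realType}.
Local Notation leb := (@lebesgue_measure R).

(** The left-hand side is, up to the factor c, the image of Lebesgue measure under y |-> c y, and it
    gives half-open intervals their length. *)
Lemma lebesgue_measureZ (c : R) (A : set R) : 0 < c -> measurable A ->
  (c%:E * leb ((fun y : R => (c * y)%R : measurableTypeR R) @^-1` A) = leb A)%E.
Proof.
move=> c0 mA.
have mc : measurable_fun setT ((fun y => c * y) : R -> measurableTypeR R).
  by apply: measurable_funM.
pose m := [the {measure set (measurableTypeR R) -> \bar R} of pushforward leb ((fun y => c * y) : R -> measurableTypeR R)].
pose c' : {nonneg R} := NngNum (ltW c0).
apply/esym.
apply: (@lebesgue_measure_unique R (mscale c' (m mc))) => // _ [[a b]] _ <-.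
transitivity (c%:E * leb ((fun y : R => (c * y)%R : measurableTypeR R) @^-1` `]a, b]))%E; last by [].
rewrite (_ : _ @^-1` _ = `]a / c, b / c]%classic).
  rewrite !lebesgue_measure_itv/= !lte_fin ltr_pM2r ?invr_gt0//.
  case: ifP => _; last by rewrite mule0.
  by rewrite -!EFinD -EFinM mulrBr !(mulrC c) !divfK ?gt_eqF.
apply/seteqP; split=> x /=; rewrite !in_itv/= ltr_pdivrMr// ler_pdivlMr// !(mulrC x) => /andP[-> ->]//.
Qed.

(** Change of variables y = s x, under which s times the density of N(0, s^2) becomes the standard
    density. It makes normalized Brownian increments standard. *)
Lemma normal_prob_scale (s : R) (B : set R) : 0 < s -> measurable B ->
  normal_prob 0 s [set y | B (s^-1 * y)] = normal_prob 0 1 B.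
Proof.
move=> s0 mB; rewrite /normal_prob.
have mc : measurable_fun setT ((fun y => s^-1 * y) : R -> measurableTypeR R).
  by apply: measurable_funM.
have mf : measurable_fun setT (fun x : R => (normal_pdf 0 s (s * x))%:E).
  apply/measurable_EFinP; apply: measurableT_comp; first exact: measurable_normal_pdf.
  exact: measurable_funM.
transitivity (\int[pushforward leb ((fun y => (s^-1 * y)%R) : R -> measurableTypeR R)]_(x in B) (normal_pdf 0 s (s * x))%:E)%E.
  rewrite ge0_integral_pushforward//.
  - by apply: eq_integral => x _ /=; rewrite mulrA divff ?gt_eqF// mul1r.
  - exact: measurable_funTS.
  - by move=> x _; rewrite lee_fin normal_pdf_ge0.
have s0' : 0 <= s by exact: ltW.
transitivity (\int[mscale (NngNum s0') leb]_(x in B) (normal_pdf 0 s (s * x))%:E)%E.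
  apply: eq_measure_integral => A mA _.
  transitivity (s%:E * leb A)%E; last by [].
  rewrite -(lebesgue_measureZ (c := s^-1) _ mA) ?invr_gt0// muleA.
  by rewrite -EFinM divff ?gt_eqF// mul1e.
rewrite ge0_integral_mscale//=; last 2 first.
- exact: measurable_funTS.
- by move=> x _; rewrite lee_fin normal_pdf_ge0.
rewrite -ge0_integralZl//; last 2 first.
- exact: measurable_funTS.
- by move=> x _; rewrite lee_fin normal_pdf_ge0.
apply: eq_integral => x _; rewrite -EFinM; congr EFin.
rewrite !normal_pdfE ?gt_eqF// mulrA; congr (_ * _).
  rewrite /normal_peak expr1n mul1r -mulrnAr sqrtrM ?sqr_ge0// sqrtr_sqr ger0_norm ?ltW//.
  by rewrite invfM mulrA divff ?gt_eqF// mul1r.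
rewrite /normal_fun !subr0 expr1n; congr expR.
field; rewrite gt_eqF//.
Qed.

Lemma normal_prob_opp (B : set R) : measurable B ->
  normal_prob 0 1 [set y | B (- y)] = normal_prob 0 1 B :> \bar R.
Proof.
move=> mB; rewrite /normal_prob.
have mc : measurable_fun setT (-%R : R -> measurableTypeR R) by exact: oppr_measurable.
transitivity (\int[pushforward leb (-%R : R -> measurableTypeR R)]_(x in B) (normal_pdf 0 1 x)%:E)%E.
  rewrite ge0_integral_pushforward//.
  - apply: eq_integral => x _ /=; rewrite !normal_pdfE ?oner_eq0// /normal_fun.
    by rewrite !subr0 sqrrN.
  - apply: measurable_funTS; apply/measurable_EFinP; exact: measurable_normal_pdf.
  - by move=> x _; rewrite lee_fin normal_pdf_ge0.
by apply: eq_measure_integral => A mA _; exact: lebesgue_measureN.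
Qed.

(** The Radon-Nikodym derivative of [normal_prob] has the same integral as the density on every
    measurable set, hence equals it almost everywhere. *)
Lemma ge0_integral_normal_prob (f : R -> \bar R) : measurable_fun setT f ->
  (forall x, 0 <= f x)%E ->
  (\int[normal_prob 0 1]_x f x = \int[leb]_x (f x * (normal_pdf 0 1 x)%:E))%E.
Proof.
move=> mf f0; have dom := normal_prob_dominates 0 (1 : R).
have mpdf : measurable_fun setT (fun x : R => (normal_pdf 0 1 x)%:E).
  by apply/measurable_EFinP; exact: measurable_normal_pdf.
have iRN := Radon_Nikodym_SigmaFinite.f_integrable dom.
rewrite -(Radon_Nikodym_SigmaFinite.change_of_variables dom)//.
apply: ae_eq_integral => //.
- by apply: emeasurable_funM => //; exact: measurable_int iRN.
- exact: emeasurable_funM.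
apply: ae_eqe_mul2l; apply: integral_ae_eq => // A _ mA.
by rewrite -Radon_Nikodym_SigmaFinite.f_integral.
Qed.

(** Domination by the density of N(0, 2^2): as (x^2/8)^2 <= exp(x^2/4), one has x^4 exp(-x^2/2) <=
    64 exp(-x^2/4) <= 64 exp(-x^2/8). Only finiteness matters; the value stays abstract as
    [kappa4]. *)
Lemma normal_fourth_moment :
  (\int[normal_prob 0 1]_x (x ^+ 4)%:E < +oo :> \bar R)%E.
Proof.
have m4 : measurable_fun setT (fun x : R => (x ^+ 4)%:E).
  by apply/measurable_EFinP; exact: measurable_funX.
have ge4 (x : R) : 0 <= x ^+ 4 by rewrite exprn_even_ge0.
rewrite ge0_integral_normal_prob//.
pose K : R := 64 * normal_peak 1 / normal_peak 2.
have p2 : (0 : R) < normal_peak 2 by rewrite normal_peak_gt0// pnatr_eq0.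
have K0 : 0 <= K by rewrite /K !mulr_ge0 ?normal_peak_ge0// invr_ge0 normal_peak_ge0.
apply: (@le_lt_trans _ _ (\int[leb]_x (K%:E * (normal_pdf 0 2 x)%:E))%E).
  apply: ge0_le_integral => //.
  - by move=> x _; rewrite -EFinM lee_fin mulr_ge0// normal_pdf_ge0.
  - apply: emeasurable_funM => //; apply/measurable_EFinP; exact: measurable_normal_pdf.
  - apply: emeasurable_funM => //; apply/measurable_EFinP; exact: measurable_normal_pdf.
  - move=> x _; rewrite -!EFinM lee_fin !normal_pdfE ?oner_eq0 ?pnatr_eq0//.
    rewrite (_ : K * (normal_peak 2 * normal_fun 0 2 x) = normal_peak 1 * (64 * normal_fun 0 2 x)); last first.
      by rewrite /K; field; rewrite gt_eqF.
    rewrite mulrCA ler_wpM2l ?normal_peak_ge0//.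
    rewrite /normal_fun !subr0 expr1n.
    have e1 : x ^+ 2 / 8 <= expR (x ^+ 2 / 8).
      by rewrite (le_trans _ (expR_ge1Dx _))// lerDr.
    have x0 : 0 <= x ^+ 2 / 8 by rewrite divr_ge0 ?sqr_ge0.
    have e2 : (x ^+ 2 / 8) ^+ 2 <= expR (x ^+ 2 / 4).
      have -> : x ^+ 2 / 4 = x ^+ 2 / 8 + x ^+ 2 / 8 by field.
      by rewrite expRD expr2 ler_pM.
    have e3 : expR (- x ^+ 2 / 4) <= expR (- x ^+ 2 / (2 ^+ 2 *+ 2)).
      rewrite ler_expR -(mulr_natr (2 ^+ 2)); have := sqr_ge0 x; lra.
    apply: (le_trans _ (ler_wpM2l _ e3)) => //.
    have -> : - x ^+ 2 / 4 = x ^+ 2 / 4 + (- x ^+ 2 / 2) by field.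
    rewrite expRD mulrA; have -> : 1 *+ 2 = 2 :> R by [].
    rewrite ler_wpM2r ?expR_ge0//.
    apply: le_trans (ler_wpM2l _ e2) => //.
    by rewrite le_eqVlt; apply/orP; left; apply/eqP; field.
rewrite ge0_integralZl//; last 2 first.
- by apply/measurable_EFinP; exact: measurable_normal_pdf.
- by move=> x _; rewrite lee_fin normal_pdf_ge0.
by rewrite integral_normal_pdf mule1 ltry.
Qed.

End gaussian.

(** * Expectations and Gaussian moments *)

Section expectation.
Context disp (Omega : measurableType disp) (R : realType) (P : probability Omega R).
Implicit Types f g : Omega -> R.

Definition L1 f := P.-integrable setT (EFin \o f).
Definition Ex f : R := Rintegral P setT f.

Lemma L1_measurable f : L1 f -> measurable_fun setT f.
Proof. by move=> /integrableP[/measurable_EFinP]. Qed.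

Lemma L1_dom f g : measurable_fun setT f -> (forall w, `|f w| <= g w) -> L1 g -> L1 f.
Proof.
move=> mf fg hg; apply: (le_integrable measurableT _ _ hg); first exact/measurable_EFinP.
by move=> w _ /=; rewrite lee_fin (le_trans (fg w))// ler_norm.
Qed.

Lemma L1_cst a : L1 (fun=> a).
Proof. exact: finite_measure_integrable_cst. Qed.

Lemma L1D f g : L1 f -> L1 g -> L1 (fun w => f w + g w).
Proof. by move=> hf hg; apply: (integrableD _ hf hg). Qed.

Lemma L1B f g : L1 f -> L1 g -> L1 (fun w => f w - g w).
Proof. by move=> hf hg; apply: (integrableB _ hf hg). Qed.

Lemma L1Z a f : L1 f -> L1 (fun w => a * f w).
Proof. by move=> hf; apply: (integrableZl _ a hf). Qed.

Lemma L1_sum (I : Type) (s : seq I) (f : I -> Omega -> R) :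
  (forall i, L1 (f i)) -> L1 (fun w => \sum_(i <- s) f i w).
Proof.
move=> hf; elim: s => [|i s ih].
  by under eq_fun do rewrite big_nil; exact: L1_cst.
by under eq_fun do rewrite big_cons; apply: L1D.
Qed.

Lemma Ex_EFin f : L1 f -> (\int[P]_w (f w)%:E)%E = (Ex f)%:E.
Proof. by move=> hf; rewrite fineK// integrable_fin_num. Qed.

Lemma Ex_cst a : Ex (fun=> a) = a.
Proof. by rewrite /Ex /Rintegral integral_cst//= probability_setT mule1. Qed.

Lemma ExD f g : L1 f -> L1 g -> Ex (fun w => f w + g w) = Ex f + Ex g.
Proof. by move=> hf hg; rewrite /Ex RintegralD. Qed.

Lemma ExB f g : L1 f -> L1 g -> Ex (fun w => f w - g w) = Ex f - Ex g.
Proof. by move=> hf hg; rewrite /Ex RintegralB. Qed.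

Lemma ExZ a f : L1 f -> Ex (fun w => a * f w) = a * Ex f.
Proof. by move=> hf; rewrite /Ex RintegralZl. Qed.

Lemma Ex_le f g : L1 f -> L1 g -> (forall w, f w <= g w) -> Ex f <= Ex g.
Proof. by move=> hf hg fg; rewrite /Ex le_Rintegral. Qed.

Lemma Ex_ge0 f : (forall w, 0 <= f w) -> 0 <= Ex f.
Proof. by move=> h; apply: Rintegral_ge0 => w _; exact: h. Qed.

Lemma eq_Ex f g : f =1 g -> Ex f = Ex g.
Proof. by move=> fg; congr Ex; exact/funext. Qed.

Lemma Ex_sum (I : Type) (s : seq I) (f : I -> Omega -> R) :
  (forall i, L1 (f i)) -> Ex (fun w => \sum_(i <- s) f i w) = \sum_(i <- s) Ex (f i).
Proof.
move=> hf; elim: s => [|i s ih].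
  by under eq_Ex do rewrite big_nil; rewrite Ex_cst big_nil.
under eq_Ex do rewrite big_cons.
by rewrite ExD// ?ih ?big_cons//; exact: L1_sum.
Qed.

Lemma Ex_abs f : L1 f -> `|Ex f| <= Ex (fun w => `|f w|).
Proof. by move=> hf; exact: le_normr_Rintegral. Qed.

Lemma L1_norm f : L1 f -> L1 (fun w => `|f w|).
Proof. by move=> hf; exact: integrable_norm. Qed.

End expectation.

(** * Integrability by polynomial growth *)

Section polynomial_growth.
Context disp (Omega : measurableType disp) (R : realType) (P : probability Omega R).
Variable N : Omega -> R.
Hypotheses (mN : measurable_fun setT N) (N1 : forall w, 1 <= N w).
Hypothesis N4 : L1 P (fun w => N w ^+ 4).

(** Degree bookkeeping: products add degrees and sums take their maximum, so that the integrability
    of every polynomial expression below reduces to a degree at most 4 in one majorant [N]. *)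
Definition pgrow (p : nat) (f : Omega -> R) :=
  measurable_fun setT f /\ exists C, 0 <= C /\ forall w, `|f w| <= C * N w ^+ p.

Let N0 w : 0 <= N w. Proof. exact: le_trans (N1 w). Qed.

Lemma pgrow_L1 p f : (p <= 4)%N -> pgrow p f -> L1 P f.
Proof.
move=> p4 [mf [C [C0 hC]]]; apply: (L1_dom mf _ (L1Z C N4)) => w.
by rewrite (le_trans (hC w))// ler_wpM2l// ler_weXn2l.
Qed.

Lemma pgrow_cst a : pgrow 0 (fun=> a).
Proof. by split=> //; exists `|a|; split=> // w; rewrite expr0 mulr1. Qed.

Lemma pgrowW p p' f : (p <= p')%N -> pgrow p f -> pgrow p' f.
Proof.
move=> pp' [mf [C [C0 hC]]]; split=> //; exists C; split=> // w.
by rewrite (le_trans (hC w))// ler_wpM2l// ler_weXn2l.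
Qed.

Lemma pgrowD p p' f g : pgrow p f -> pgrow p' g -> pgrow (maxn p p') (fun w => f w + g w).
Proof.
move=> /(pgrowW (leq_maxl p p'))[mf [C [C0 hC]]] /(pgrowW (leq_maxr p p'))[mg [C' [C'0 hC']]].
split; first exact: measurable_funD.
exists (C + C'); split=> [|w]; first exact: addr_ge0.
by rewrite mulrDl (le_trans (ler_normD _ _))// lerD.
Qed.

Lemma pgrowM p p' f g : pgrow p f -> pgrow p' g -> pgrow (p + p') (fun w => f w * g w).
Proof.
move=> [mf [C [C0 hC]]] [mg [C' [C'0 hC']]]; split; first exact: measurable_funM.
exists (C * C'); split=> [|w]; first exact: mulr_ge0.
by rewrite normrM exprD mulrACA ler_pM.
Qed.

Lemma pgrowN p f : pgrow p f -> pgrow p (fun w => - f w).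
Proof.
move=> [mf [C [C0 hC]]]; split; last by exists C; split=> // w; rewrite normrN.
exact: measurableT_comp.
Qed.

Lemma pgrowB p p' f g : pgrow p f -> pgrow p' g -> pgrow (maxn p p') (fun w => f w - g w).
Proof. by move=> hf hg; apply: pgrowD => //; exact: pgrowN. Qed.

Lemma pgrowX p f n : pgrow p f -> pgrow (n * p) (fun w => f w ^+ n).
Proof.
move=> [mf [C [C0 hC]]]; split; first exact: measurable_funX.
exists (C ^+ n); split=> [|w]; first exact: exprn_ge0.
by rewrite normrX mulnC exprM -exprMn lerXn2r// nnegrE ?mulr_ge0 ?exprn_ge0.
Qed.

Lemma pgrow_sum (I : Type) (s : seq I) p (f : I -> Omega -> R) :
  (forall i, pgrow p (f i)) -> pgrow p (fun w => \sum_(i <- s) f i w).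
Proof.
move=> hf; elim: s => [|i s ih].
  under eq_fun do rewrite big_nil; exact: (pgrowW (leq0n p) (pgrow_cst 0)).
by under eq_fun do rewrite big_cons; rewrite -(maxnn p); apply: pgrowD.
Qed.

End polynomial_growth.

Ltac L1_tac := solve [repeat first
  [ assumption | exact: L1_cst | apply: L1B | apply: L1D | apply: L1Z ]].

Section gaussian_moments.
Context {R : realType} {d : nat}.
Context disp (Omega : measurableType disp) (P : probability Omega R).
Implicit Types X : Omega -> 'cV[R]_d.

Lemma gaussian_coord s X j : gaussian_vector P s X -> forall B, measurable B ->
  P [set w | B (X w j 0)] = normal_prob 0 s B.
Proof.
move=> [mX hX] B mB.
have := hX (fun i => if i == j then B else setT) _.
rewrite (bigD1 j)//= eqxx big1 ?mule1 => [|i /negbTE ->]; last exact: probability_setT.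
rewrite (_ : in_rect _ _ = [set w | B (X w j 0)]) => [-> //|].
  by move=> i; case: ifP => // _; exact: measurableT.
apply/seteqP; split=> w /=; first by move/(_ j); rewrite eqxx.
by move=> h i; case: eqP => // ->.
Qed.

Lemma gaussian_coord_ge0_integral s X j (f : R -> \bar R) :
  gaussian_vector P s X -> measurable_fun setT f -> (forall x, 0 <= f x)%E ->
  (\int[P]_w f (X w j 0%R) = \int[normal_prob 0 s]_x f x)%E.
Proof.
move=> gX mf f0.
have mXj : measurable_fun setT ((fun w => X w j 0) : Omega -> measurableTypeR R).
  exact: gaussian_vector_mvec gX j.
have /= <- := @ge0_integral_pushforward _ _ _ _ _ _ mXj P setT f measurableT mf (fun x _ => f0 x).
by apply: eq_measure_integral => A mA _; exact: (gaussian_coord _ gX).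
Qed.

Definition kappa4 : R := fine (\int[@normal_prob R 0 1]_x (x ^+ 4)%:E).

Lemma gaussian_coord4 X j : gaussian_vector P 1 X ->
  (\int[P]_w (X w j 0 ^+ 4)%:E = kappa4%:E)%E.
Proof.
move=> gX; rewrite (gaussian_coord_ge0_integral (f := fun x => (x ^+ 4)%:E) j gX).
- rewrite fineK// ge0_fin_numE ?normal_fourth_moment// integral_ge0// => x _.
  by rewrite lee_fin exprn_even_ge0.
- by apply/measurable_EFinP; exact: measurable_funX.
- by move=> x; rewrite lee_fin exprn_even_ge0.
Qed.

Lemma gaussian_coord4_L1 X j : gaussian_vector P 1 X -> L1 P (fun w => X w j 0 ^+ 4).
Proof.
move=> gX; have mXj := gaussian_vector_mvec gX j.
apply/integrableP; split; first by apply/measurable_EFinP; exact: measurable_funX.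
under eq_integral do rewrite /= ger0_norm ?exprn_even_ge0//.
by rewrite gaussian_coord4// ltry.
Qed.

(** Expand the square of the sum and use x_i^2 x_j^2 <= (x_i^4 + x_j^4) / 2. *)
Lemma sum4_le (x : 'cV[R]_d) : enorm x ^+ 4 <= d%:R * \sum_j x j 0 ^+ 4.
Proof.
have -> : enorm x ^+ 4 = (\sum_j x j 0 ^+ 2) ^+ 2.
  by rewrite (exprM _ 2 2) enorm_sqr /dotv; congr (_ ^+ 2); apply: eq_bigr => j _; rewrite expr2.
rewrite expr2 mulr_suml.
have : \sum_i (x i 0 ^+ 2 * \sum_j x j 0 ^+ 2) <=
    \sum_i \sum_(j < d) (x i 0 ^+ 4 / 2 + x j 0 ^+ 4 / 2).
  apply: ler_sum => i _; rewrite mulr_sumr; apply: ler_sum => j _.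
  have := sqr_ge0 (x i 0 ^+ 2 - x j 0 ^+ 2); rewrite !(exprM _ 2 2); lra.
move=> /le_trans; apply.
under eq_bigr do rewrite big_split/= sumr_const card_ord.
rewrite big_split/= sumr_const card_ord sumrMnl -mulrnDl -[leLHS]mulr_natl ler_wpM2l//.
rewrite -big_split/=; apply: ler_sum => i _; lra.
Qed.

Lemma enorm4_L1 X : gaussian_vector P 1 X -> L1 P (fun w => enorm (X w) ^+ 4).
Proof.
move=> gX; have mX := gaussian_vector_mvec gX.
apply: (L1_dom _ _ (L1Z d%:R (L1_sum (index_enum 'I_d) (fun j => gaussian_coord4_L1 j gX)))).
  by apply: measurable_funX; exact: measurable_enorm.
by move=> w; rewrite ger0_norm ?exprn_ge0 ?enorm_ge0// sum4_le.
Qed.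

Definition gmom4 : R := d%:R ^+ 2 * kappa4.

Lemma enorm4_le X : gaussian_vector P 1 X -> Ex P (fun w => enorm (X w) ^+ 4) <= gmom4.
Proof.
move=> gX; have h j := gaussian_coord4_L1 j gX.
apply: (@le_trans _ _ (Ex P (fun w => d%:R * \sum_j X w j 0 ^+ 4))).
  apply: Ex_le => [||w]; [exact: enorm4_L1| |exact: sum4_le].
  by apply: L1Z; apply: L1_sum.
rewrite ExZ ?Ex_sum//; last exact: L1_sum.
rewrite (eq_bigr (fun=> kappa4)) => [|j _].
  by rewrite sumr_const card_ord -(mulr_natl kappa4) mulrA -expr2.
by apply: (@EFin_inj R); rewrite -(gaussian_coord4 j gX) -Ex_EFin.
Qed.

(** By symmetry of the law, a coordinate and its opposite have the same integral; integrability
    comes from |t| <= 1 + t^4. *)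
Lemma gaussian_coord_mean X j : gaussian_vector P 1 X -> Ex P (fun w => X w j 0) = 0.
Proof.
move=> gX; have mXj := gaussian_vector_mvec gX j.
have hX : L1 P (fun w => X w j 0).
  apply: (L1_dom mXj _ (L1D (L1_cst P 1) (gaussian_coord4_L1 j gX))) => w.
  have [h|h] := leP `|X w j 0| 1; first by rewrite (le_trans h)// lerDl exprn_even_ge0.
  rewrite (_ : X w j 0 ^+ 4 = `|X w j 0| ^+ 4); last first.
    by rewrite !(exprM _ 2 2) real_normK ?num_real.
  apply: ler_wpDl => //; rewrite -{1}(expr1 `|_|) ler_weXn2l//; exact: ltW.
have E1 (f : R -> \bar R) : measurable_fun setT f -> (forall x, 0 <= f x)%E ->
    (\int[P]_w f (X w j 0%R) = \int[P]_w f (- X w j 0)%R)%E.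
  move=> mf f0; rewrite (gaussian_coord_ge0_integral j gX)//.
  rewrite (gaussian_coord_ge0_integral (f := fun x => f (- x)%R) j gX)//; last first.
    by apply: measurableT_comp => //; exact: oppr_measurable.
  have mo : measurable_fun setT (-%R : measurableTypeR R -> measurableTypeR R) by exact: oppr_measurable.
  have /= <- := @ge0_integral_pushforward _ _ _ _ _ _ mo [the {measure set (measurableTypeR R) -> \bar R} of @normal_prob R 0 1] setT f measurableT mf (fun x _ => f0 x).
  by apply: eq_measure_integral => A mA _; apply/esym; exact: normal_prob_opp.
have mE : measurable_fun setT (@EFin R) by exact: EFin_measurable.
have : (\int[P]_w (X w j 0)%:E = \int[P]_w (- X w j 0)%:E)%E.
  rewrite integralE [RHS]integralE; congr (_ - _)%E.
    have h := E1 (EFin^\+)%E (measurable_funepos mE) (funepos_ge0 _).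
    transitivity (\int[P]_w (EFin^\+ (X w j 0%R)))%E.
      by apply: eq_integral => w _; rewrite !funeposE.
    by rewrite h; apply: eq_integral => w _; rewrite !funeposE.
  have h := E1 (EFin^\-)%E (measurable_funeneg mE) (funeneg_ge0 _).
  transitivity (\int[P]_w (EFin^\- (X w j 0%R)))%E.
    by apply: eq_integral => w _; rewrite !funenegE.
  by rewrite h; apply: eq_integral => w _; rewrite !funenegE.
rewrite Ex_EFin//; under eq_integral do rewrite -mulN1r.
rewrite Ex_EFin; last exact: L1Z.
rewrite ExZ// => -[]; lra.
Qed.

Lemma gaussian_vector_scale s X : 0 < s -> gaussian_vector P s X ->
  gaussian_vector P 1 (fun w => s^-1 *: X w).
Proof.
move=> s0 [mX hX]; split.
  by apply/mvecE/mvecZ => //; exact/mvecE.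
move=> B mB; rewrite (_ : in_rect _ _ = in_rect X (fun j => [set y | B j (s^-1 * y)])).
  rewrite hX => [|j]; first by apply: eq_bigr => j _; exact: normal_prob_scale.
  rewrite -[X in measurable X]setTI.
  have mf : measurable_fun setT (fun y : R => s^-1 * y) by exact: measurable_funM.
  exact: mf.
by apply/seteqP; split=> w /= h j; have := h j; rewrite !mxE.
Qed.

End gaussian_moments.

(** * Moments of one Euler step *)

Section affine_step.
Context {R : realType} {d : nat}.

(** An Euler step with coefficients as free parameters. Increments and differences of two steps
    driven by the same noise are again of this form, so that one moment estimate, [Ex_astep_sqr],
    serves growth, increments and distances. *)
Definition astep (h : R) (a b : 'cV[R]_d) (A : 'M[R]_d) (v : 'cV[R]_d) : 'cV[R]_d :=
  a + h *: b + Num.sqrt h *: (A *m v).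

Lemma astepB h a a' b b' A A' v :
  astep h a b A v - astep h a' b' A' v = astep h (a - a') (b - b') (A - A') v.
Proof.
rewrite /astep mulmxBl !scalerBr; apply/colP => i; rewrite !mxE; lra.
Qed.

Lemma astep_sub h a b A v : astep h a b A v - a = astep h 0 b A v.
Proof. by apply/colP => i; rewrite /astep !mxE; lra. Qed.

Lemma enorm_astep_sqr h a b A v : 0 <= h ->
  enorm (astep h a b A v) ^+ 2 =
  enorm (a + h *: b) ^+ 2 + 2 * Num.sqrt h * dotv (a + h *: b) (A *m v)
    + h * enorm (A *m v) ^+ 2.
Proof.
move=> h0; rewrite !enorm_sqr /astep; move: (a + _) (A *m v) => u z.
rewrite !(dotvDl, dotvDr, dotvZl, dotvZr) (dotvC z u).
move: (Num.sqrt h) (sqr_sqrtr h0) => s <-; ring.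
Qed.

Lemma enorm_drift_sqr (h B : R) (a b : 'cV[R]_d) : 0 <= h -> h <= 1 -> enorm b <= B ->
  enorm (a + h *: b) ^+ 2 <= enorm a ^+ 2 + h * (2 * enorm a * B + B ^+ 2).
Proof.
move=> h0 h1 bB; have b0 := enorm_ge0 b; have a0 := enorm_ge0 a.
rewrite !enorm_sqr !(dotvDl, dotvDr, dotvZl, dotvZr) (dotvC b a) -!enorm_sqr.
have hab : dotv a b <= enorm a * B by rewrite (le_trans (dotv_le _ _))// ler_wpM2l.
have hb : enorm b ^+ 2 <= B ^+ 2 by rewrite lerXn2r// nnegrE (le_trans b0).
have : h * dotv a b <= h * (enorm a * B) by rewrite ler_wpM2l.
have : h * (h * enorm b ^+ 2) <= h * (1 * B ^+ 2).
  by rewrite ler_wpM2l// ler_pM// sqr_ge0.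
lra.
Qed.

Lemma dotv_sum (u : 'cV[R]_d) (A : 'M[R]_d) (v : 'cV[R]_d) :
  dotv u (A *m v) = \sum_k (\sum_i u i 0 * A i k) * v k 0.
Proof.
rewrite /dotv; under eq_bigr do rewrite mxE mulr_sumr.
rewrite exchange_big; apply: eq_bigr => k _; rewrite mulr_suml.
by apply: eq_bigr => i _; rewrite mulrA.
Qed.

End affine_step.

Lemma bigmax_attained (R : realType) (q : nat) (F : 'I_q -> R) (i : 'I_q) :
  exists j, \big[Num.max/F i]_(j < q) F j = F j.
Proof.
apply: (big_ind (fun x => exists j, x = F j)); [by exists i| |by move=> j _; exists j].
move=> _ _ [j ->] [k ->]; rewrite /Num.max; case: ifP => _; [by exists k|by exists j].
Qed.

(** All that the one-step estimates retain of the Gaussian law; the law itself returns when Brownian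
    increments are exchanged for [theta]. *)
Record noise (R : realType) (d : nat) disp (Omega : measurableType disp)
    (P : probability Omega R) (M : R) (theta : Omega -> 'cV[R]_d) : Prop := Noise {
  noise_mvec : mvec theta;
  noise_L1 : L1 P (fun w => enorm (theta w) ^+ 4);
  noise_le : Ex P (fun w => enorm (theta w) ^+ 4) <= M;
  noise_mean : forall j, Ex P (fun w => theta w j 0) = 0 }.

Section noise_theory.
Context {R : realType} {d : nat} disp (Omega : measurableType disp).
Context (P : probability Omega R) (M : R) (theta : Omega -> 'cV[R]_d).
Hypothesis Hth : noise P M theta.

Definition nse (w : Omega) : R := 1 + enorm (theta w).

Lemma nse_ge1 w : 1 <= nse w. Proof. by rewrite lerDl enorm_ge0. Qed.

Lemma measurable_nse : measurable_fun setT nse.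
Proof. by apply: measurable_funD => //; exact/measurable_enorm/(noise_mvec Hth). Qed.

Lemma pow4D_le (a : R) : 0 <= a -> (1 + a) ^+ 4 <= 8 + 8 * a ^+ 4.
Proof.
move=> a0.
have h1 : (1 + a) ^+ 2 <= 2 + 2 * a ^+ 2 by have := sqr_ge0 (1 - a); lra.
have h2 : ((1 + a) ^+ 2) ^+ 2 <= (2 + 2 * a ^+ 2) ^+ 2.
  rewrite lerXn2r ?nnegrE ?sqr_ge0//; have := sqr_ge0 a; lra.
rewrite -exprM in h2; have := sqr_ge0 (1 - a ^+ 2); rewrite (_ : 4%N = (2 * 2)%N)// !exprM in h2 *; nra.
Qed.

Lemma nse4_L1 : L1 P (fun w => nse w ^+ 4).
Proof.
apply: (L1_dom _ _ (L1D (L1_cst P 8) (L1Z 8 (noise_L1 Hth)))).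
  by apply: measurable_funX; exact: measurable_nse.
move=> w; rewrite ger0_norm ?exprn_ge0 ?(le_trans _ (nse_ge1 w))//.
by rewrite pow4D_le ?enorm_ge0.
Qed.

Local Notation pol := (pgrow nse).

Lemma pol_L1 p f : (p <= 4)%N -> pol p f -> L1 P f.
Proof. exact: (pgrow_L1 nse_ge1 nse4_L1). Qed.

Lemma pol_sqr f : pol 1 f -> L1 P (fun w => f w ^+ 2).
Proof. by move=> hf; apply: (pol_L1 (p := 2)) => //; exact: (pgrowX nse_ge1 2 hf). Qed.

Lemma pol_mul f g : pol 1 f -> pol 1 g -> L1 P (fun w => f w * g w).
Proof. by move=> hf hg; apply: (pol_L1 (p := 2)) => //; exact: (pgrowM hf hg). Qed.

Lemma pol_lin f : pol 1 f -> L1 P f.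
Proof. exact: pol_L1. Qed.

Lemma pol_theta : pol 1 (fun w => enorm (theta w)).
Proof.
split; first exact/measurable_enorm/(noise_mvec Hth).
by exists 1; split=> // w; rewrite ger0_norm ?enorm_ge0// mul1r expr1 /nse lerDr.
Qed.

Lemma mvec_astep h a b A : mvec (fun w => astep h a b A (theta w)).
Proof.
apply: mvecD; first exact: mvec_cst.
by apply: mvecZ => //; apply: mvec_mulmx => //; exact: (noise_mvec Hth).
Qed.

Lemma pol_astep h a b A : pol 1 (fun w => enorm (astep h a b A (theta w))).
Proof.
split; first exact/measurable_enorm/mvec_astep.
exists (enorm (a + h *: b) + Num.sqrt h * (d%:R ^+ 2 * `|A|)).
have A0 : 0 <= Num.sqrt h * (d%:R ^+ 2 * `|A|) by rewrite !mulr_ge0 ?sqrtr_ge0.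
split; first by rewrite addr_ge0 ?enorm_ge0.
move=> w; rewrite ger0_norm ?enorm_ge0// expr1 (le_trans (enormD _ _))// mulrDl lerD//.
  by rewrite ler_peMr ?enorm_ge0 ?nse_ge1.
rewrite enormZ ger0_norm ?sqrtr_ge0// -mulrA ler_wpM2l ?sqrtr_ge0//.
by rewrite (le_trans (enorm_mulmx_le _ _))// ler_wpM2l ?mulr_ge0// /nse lerDr.
Qed.

Lemma pol_elip L phi h a b A : elip L phi -> pol 1 (fun w => phi (astep h a b A (theta w))).
Proof.
move=> phiL; split; first exact: (measurable_elip (mvec_astep h a b A) phiL).
have [_ [C [C0 hC]]] := pol_astep h a b A.
exists (`|phi 0| + `|L| * C); split=> [|w]; first by rewrite addr_ge0// mulr_ge0.
have := phiL (astep h a b A (theta w)) 0; rewrite subr0 => h1.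
have h2 := hC w; rewrite ger0_norm ?enorm_ge0// in h2.
have h3 := nse_ge1 w.
rewrite -(subrK (phi 0) (phi _)) (le_trans (ler_normD _ _))// addrC mulrDl lerD//.
  by rewrite expr1 ler_peMr.
rewrite (le_trans h1)// -mulrA (le_trans (ler_wpM2r (enorm_ge0 _) (ler_norm L)))//.
by rewrite ler_wpM2l.
Qed.

Lemma noise2_le : Ex P (fun w => enorm (theta w) ^+ 2) <= 1 + M.
Proof.
apply: (@le_trans _ _ (Ex P (fun w => 1 + enorm (theta w) ^+ 4))).
  apply: Ex_le => [||w].
  - exact: pol_sqr pol_theta.
  - by apply: L1D; [exact: L1_cst|exact: (noise_L1 Hth)].
  - rewrite (exprM _ 2 2); have := sqr_ge0 (enorm (theta w) ^+ 2 - 1).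
    have := sqr_ge0 (enorm (theta w)); nra.
rewrite ExD ?Ex_cst ?lerD2l ?(noise_le Hth)//; [exact: L1_cst|exact: (noise_L1 Hth)].
Qed.

Lemma noiseM_ge0 : 0 <= M.
Proof. by apply: le_trans (noise_le Hth); apply: Ex_ge0 => w; rewrite exprn_ge0 ?enorm_ge0. Qed.

Lemma pol_coord k : pol 1 (fun w => theta w k 0).
Proof.
split; first exact: (noise_mvec Hth).
exists 1; split=> // w; rewrite mul1r expr1 (le_trans (coord_le_enorm _ _))// /nse lerDr//.
Qed.

Lemma Ex_dotv_mulmx u (A : 'M[R]_d) : Ex P (fun w => dotv u (A *m theta w)) = 0.
Proof.
under eq_Ex do rewrite dotv_sum.
rewrite Ex_sum => [|k]; last by apply: L1Z; exact: (pol_L1 _ (pol_coord k)).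
apply: big1 => k _; rewrite ExZ ?(noise_mean Hth) ?mulr0//.
exact: (pol_L1 _ (pol_coord k)).
Qed.

Lemma pol_mulmx (A : 'M[R]_d) : pol 1 (fun w => enorm (A *m theta w)).
Proof.
split; first by apply: measurable_enorm; apply: mvec_mulmx => //; exact: (noise_mvec Hth).
exists (d%:R ^+ 2 * `|A|); split=> [|w]; first by rewrite mulr_ge0.
rewrite ger0_norm ?enorm_ge0// expr1 (le_trans (enorm_mulmx_le _ _))//.
by rewrite ler_wpM2l ?mulr_ge0// /nse lerDr.
Qed.

Lemma pol_dotv u (A : 'M[R]_d) : pol 1 (fun w => dotv u (A *m theta w)).
Proof.
under eq_fun do rewrite dotv_sum.
by apply: (pgrow_sum nse_ge1) => k; have := pgrowM (pgrow_cst nse _) (pol_coord k).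
Qed.

(** The cross term between a + h b and the noise, of order sqrt h, has zero mean, so that the second
    moment changes only at order h. *)
Lemma Ex_astep_sqr (h B : R) a b A : 0 <= h -> h <= 1 ->
  enorm b <= B -> (forall v, enorm (A *m v) <= B * enorm v) ->
  Ex P (fun w => enorm (astep h a b A (theta w)) ^+ 2) <=
  enorm a ^+ 2 + h * (2 * enorm a * B + B ^+ 2 * (2 + M)).
Proof.
move=> h0 h1 bB AB; have B0 : 0 <= B := le_trans (enorm_ge0 b) bB.
under eq_Ex do rewrite enorm_astep_sqr//.
have i1 := pol_lin (pol_dotv (a + h *: b) A).
have i2 : L1 P (fun w => enorm (A *m theta w) ^+ 2).
  exact: pol_sqr (pol_mulmx A).
rewrite !ExD; try L1_tac.
rewrite !ExZ; try L1_tac.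
rewrite ?Ex_cst ?Ex_dotv_mulmx ?mulr0 ?addr0.
have h2 := enorm_drift_sqr a h0 h1 bB.
have h3 : Ex P (fun w => enorm (A *m theta w) ^+ 2) <= B ^+ 2 * (1 + M).
  apply: (@le_trans _ _ (Ex P (fun w => B ^+ 2 * enorm (theta w) ^+ 2))).
    apply: Ex_le => // [|w].
      by apply: L1Z; exact: pol_sqr pol_theta.
    by rewrite -exprMn lerXn2r ?nnegrE ?mulr_ge0 ?enorm_ge0.
  rewrite ExZ; first by rewrite ler_wpM2l ?sqr_ge0// noise2_le.
  exact: pol_sqr pol_theta.
have : h * Ex P (fun w => enorm (A *m theta w) ^+ 2) <= h * (B ^+ 2 * (1 + M)).
  by rewrite ler_wpM2l.
lra.
Qed.

End noise_theory.

(** * Regularity of the value function *)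

Section dynamic_programming.
Context {R : realType} {d q : nat} disp (Omega : measurableType disp).
Context (P : probability Omega R) (M : R) (theta : Omega -> 'cV[R]_d).
Context (D : switching_data R d q) (C c0 : R).
Hypothesis Hth : noise P M theta.
Hypothesis HD : regular_data C c0 D.

Local Notation E := (Ex P).
Local Notation pol := (pgrow (nse theta)).

Section step.
Variable h : R.
Hypotheses (h0 : 0 <= h) (h1 : h <= 1).

Local Notation F j x w := (euler_step D h j x (theta w)).

(** Common rate of the second moments: 2C from the scalar product with the drift; in C^2 (2 + M),
    one unit for the squared drift, with h^2 <= h, and 1 + M for the second moment of the noise. *)
Definition kstep : R := 2 * C + C ^+ 2 * (2 + M).

Let C1 : 1 <= C := reg_ge1 HD.
Let C0 : 0 <= C := le_trans ler01 C1.
Let M0 : 0 <= M := noiseM_ge0 Hth.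

Lemma kstep_ge0 : 0 <= kstep.
Proof. by rewrite /kstep addr_ge0 ?mulr_ge0 ?sqr_ge0 ?addr_ge0. Qed.

Let K0 := kstep_ge0.

Lemma stepE j x w : F j x w = astep h x (drift D j x) (vol D j x) (theta w).
Proof. by []. Qed.

Lemma pol_step L phi j x : elip L phi -> pol 1 (fun w => phi (F j x w)).
Proof. move=> hp; exact: (pol_elip Hth _ _ _ _ hp). Qed.

Lemma L1_step L phi j x : elip L phi -> L1 P (fun w => phi (F j x w)).
Proof. by move=> hp; exact: (pol_lin Hth (pol_step j x hp)). Qed.

Lemma elip_wgt : elip 1 (@wgt R d).
Proof. by move=> x y; rewrite mul1r wgt_dist. Qed.

Lemma pol_dist j x y : pol 1 (fun w => enorm (F j x w - F j y w)).
Proof. by under eq_fun do rewrite !stepE astepB; exact: (pol_astep Hth). Qed.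

Lemma Ex_dist_sqr j x y :
  E (fun w => enorm (F j x w - F j y w) ^+ 2) <= (1 + kstep * h) * enorm (x - y) ^+ 2.
Proof.
under eq_Ex do rewrite !stepE astepB.
apply: (le_trans (Ex_astep_sqr Hth (x - y) h0 h1 (reg_drift_lip HD j x y) _)).
  by move=> v; exact: (reg_vol_lip HD).
rewrite /kstep; lra.
Qed.

(** Deduced from the second moment by the tangent inequality t <= (t^2 + r^2) / (2r), which loses
    nothing at t = r; [Ex_wgt] and [Ex_chain1] proceed likewise. *)
Lemma Ex_dist j x y :
  E (fun w => enorm (F j x w - F j y w)) <= (1 + kstep * h) * enorm (x - y).
Proof.
have [r0|r0] := eqVneq (enorm (x - y)) 0.
  rewrite r0 mulr0; have -> : x = y by apply/eqP; rewrite -subr_eq0; exact/eqP/enorm_eq0.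
  by under eq_Ex do rewrite subrr enorm0; rewrite Ex_cst.
have {}r0 : 0 < enorm (x - y) by rewrite lt_def r0 enorm_ge0.
set r := enorm (x - y) in r0 *.
have i2 := pol_sqr Hth (pol_dist j x y).
apply: (@le_trans _ _ (E (fun w => (2 * r)^-1 * (enorm (F j x w - F j y w) ^+ 2 + r ^+ 2)))).
  apply: Ex_le => [||w]; [exact: (pol_lin Hth (pol_dist j x y))|L1_tac|].
  rewrite mulrC ler_pdivlMr ?mulr_gt0//.
  by have := sqr_ge0 (enorm (F j x w - F j y w) - r); lra.
rewrite ExZ; last L1_tac.
rewrite ExD ?Ex_cst; try L1_tac.
rewrite mulrC ler_pdivrMr ?mulr_gt0//.
have := Ex_dist_sqr j x y; rewrite -/r.
have : 0 <= kstep * h * r ^+ 2 by rewrite mulr_ge0 ?sqr_ge0// mulr_ge0.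
lra.
Qed.

Lemma pol_incr j x : pol 1 (fun w => enorm (F j x w - x)).
Proof. by under eq_fun do rewrite stepE astep_sub; exact: (pol_astep Hth). Qed.

Lemma Ex_incr_sqr j x :
  E (fun w => enorm (F j x w - x) ^+ 2) <= kstep * h * wgt x ^+ 2.
Proof.
under eq_Ex do rewrite stepE astep_sub.
apply: (le_trans (Ex_astep_sqr Hth 0 h0 h1 (reg_drift_growth HD j x) _)).
  by move=> v; exact: (reg_vol_growth HD).
rewrite enorm0 expr0n/= mulr0 !mul0r !add0r exprMn /kstep.
have : 0 <= 2 * C * h * wgt x ^+ 2.
  by rewrite mulr_ge0 ?sqr_ge0// mulr_ge0// mulr_ge0.
lra.
Qed.

(** The distance changes by at most the norm of the increment of the difference, whose square has
    mean of order h. This smallness makes the covariance of gap and distance affordable. *)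
Lemma Ex_dist_incr_sqr j x y :
  E (fun w => (enorm (F j x w - F j y w) - enorm (x - y)) ^+ 2)
  <= kstep * h * enorm (x - y) ^+ 2.
Proof.
apply: (@le_trans _ _ (E (fun w => enorm (astep h 0 (drift D j x - drift D j y)
    (vol D j x - vol D j y) (theta w)) ^+ 2))).
  apply: Ex_le => [||w].
  - by apply: (pol_sqr Hth); exact: (pgrowB (@nse_ge1 _ _ _ _ theta) (pol_dist j x y)
      (pgrowW (@nse_ge1 _ _ _ _ theta) (leq0n 1) (pgrow_cst _ _))).
  - by apply: (pol_sqr Hth); exact: (pol_astep Hth).
  - rewrite -real_normK ?num_real// lerXn2r ?nnegrE ?enorm_ge0//.
    rewrite (le_trans (enorm_dist _ _))// le_eqVlt; apply/orP; left; apply/eqP.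
    by rewrite !stepE astepB astep_sub.
apply: (le_trans (Ex_astep_sqr Hth 0 h0 h1 (reg_drift_lip HD j x y) _)).
  by move=> v; exact: (reg_vol_lip HD).
rewrite enorm0 expr0n/= mulr0 !mul0r !add0r exprMn /kstep.
have : 0 <= 2 * C * h * enorm (x - y) ^+ 2.
  by rewrite mulr_ge0 ?sqr_ge0// mulr_ge0// mulr_ge0.
lra.
Qed.

Lemma Ex_wgt_sqr j x : E (fun w => wgt (F j x w) ^+ 2) <= (1 + kstep * h) * wgt x ^+ 2.
Proof.
under eq_Ex do rewrite wgt_sqr.
have i2 : L1 P (fun w => enorm (F j x w) ^+ 2) := pol_sqr Hth (pol_astep Hth _ _ _ _).
rewrite ExD ?Ex_cst; try L1_tac.
have h2 := Ex_astep_sqr Hth x h0 h1 (reg_drift_growth HD j x) (reg_vol_growth HD j x).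
rewrite wgt_sqr.
have s0 := wgt_ge0 x; have s2 := wgt_sqr x.
have : 2 * enorm x * (C * wgt x) <= 2 * C * wgt x ^+ 2.
  have : C * wgt x * enorm x <= C * wgt x * wgt x.
    by rewrite ler_wpM2l ?enorm_le_wgt// mulr_ge0// wgt_ge0.
  lra.
move=> /(ler_wpM2l h0) h3; rewrite exprMn in h2.
have -> : (1 + kstep * h) * (1 + enorm x ^+ 2) =
  1 + enorm x ^+ 2 + h * (2 * C * wgt x ^+ 2) + h * (C ^+ 2 * wgt x ^+ 2 * (2 + M)).
  by rewrite s2 /kstep; ring.
lra.
Qed.

Lemma Ex_wgt_incr_sqr j x :
  E (fun w => (wgt (F j x w) - wgt x) ^+ 2) <= kstep * h * wgt x ^+ 2.
Proof.
apply: le_trans (Ex_incr_sqr j x); apply: Ex_le => [||w].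
- apply: (pol_sqr Hth); exact: (pgrowB (@nse_ge1 _ _ _ _ theta) (pol_step j x elip_wgt)
      (pgrowW (@nse_ge1 _ _ _ _ theta) (leq0n 1) (pgrow_cst _ _))).
- by apply: (pol_sqr Hth); exact: pol_incr.
- by rewrite -real_normK ?num_real// lerXn2r ?nnegrE ?enorm_ge0// wgt_dist.
Qed.

Lemma Ex_wgt j x : E (fun w => wgt (F j x w)) <= (1 + kstep * h) * wgt x.
Proof.
have s0 := wgt_gt0 x; set s := wgt x in s0 *.
have i2 := pol_sqr Hth (pol_step j x elip_wgt).
apply: (@le_trans _ _ (E (fun w => (2 * s)^-1 * (wgt (F j x w) ^+ 2 + s ^+ 2)))).
  apply: Ex_le => [||w]; [exact: L1_step elip_wgt|L1_tac|].
  rewrite mulrC ler_pdivlMr ?mulr_gt0//.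
  by have := sqr_ge0 (wgt (F j x w) - s); lra.
rewrite ExZ; last L1_tac.
rewrite ExD ?Ex_cst; try L1_tac.
rewrite mulrC ler_pdivrMr ?mulr_gt0//.
have := Ex_wgt_sqr j x; rewrite -/s.
have : 0 <= kstep * h * s ^+ 2 by rewrite mulr_ge0 ?sqr_ge0// mulr_ge0.
lra.
Qed.

Fixpoint dpv (n : nat) (i : 'I_q) (x : 'cV[R]_d) : R :=
  if n is n'.+1 then
    let U j := E (fun w => dpv n' j (F j x w)) + running D j x * h - cost D i j x in
    \big[Num.max/U i]_(j < q) U j
  else terminal D i x.

Definition dpu n i j x :=
  E (fun w => dpv n j (F j x w)) + running D j x * h - cost D i j x.

Lemma dpvS n i x : dpv n.+1 i x = \big[Num.max/dpu n i i x]_(j < q) dpu n i j x.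
Proof. by []. Qed.

Lemma dpv_ge n i j x : dpu n i j x <= dpv n.+1 i x.
Proof. by rewrite dpvS; exact: (le_bigmax _ (fun j => dpu n i j x)). Qed.

Lemma dpv_opt n i x : exists j, dpv n.+1 i x = dpu n i j x.
Proof. by rewrite dpvS; exact: bigmax_attained. Qed.

(** Naive propagation, which pays [Lc] at each step. For [Lc = C] it grows at least like the number
    of steps and serves only qualitatively, for measurability and integrability; for [Lc = 0] it is
    uniform in h. *)
Fixpoint lipc (Lc : R) (n : nat) : R :=
  if n is n'.+1 then (1 + kstep * h) * lipc Lc n' + C * h + Lc else C.

Lemma lipc_ge0 Lc n : 0 <= Lc -> 0 <= lipc Lc n.
Proof.
move=> Lc0.
by elim: n => [//|n ih] /=; rewrite !addr_ge0 ?mulr_ge0// addr_ge0// mulr_ge0.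
Qed.

(** An optimal decision at [x] is used as a possibly suboptimal one at [y], with the same noise. *)
Lemma dpv_elip Lc : 0 <= Lc -> (forall i j, elip Lc (cost D i j)) ->
  forall n i, elip (lipc Lc n) (dpv n i).
Proof.
move=> Lc0 cL; elim=> [|n ih] i; first exact: (reg_terminal_lip HD).
have key x y : dpv n.+1 i x - dpv n.+1 i y <= lipc Lc n.+1 * enorm (x - y).
  have [j ->] := dpv_opt n i x; have := dpv_ge n i j y; rewrite /dpu.
  have i1 := L1_step j x (ih j); have i2 := L1_step j y (ih j).
  have i3 := pol_lin Hth (pol_dist j x y).
  have : E (fun w => dpv n j (F j x w)) - E (fun w => dpv n j (F j y w)) <=
      lipc Lc n * ((1 + kstep * h) * enorm (x - y)).
    rewrite -ExB//; apply: (@le_trans _ _ (E (fun w => lipc Lc n * enorm (F j x w - F j y w)))).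
      apply: Ex_le => [||w]; [L1_tac|L1_tac|].
      by apply: le_trans (ih j _ _); exact: ler_norm.
    by rewrite ExZ// ler_wpM2l ?lipc_ge0// Ex_dist.
  have := reg_running_lip HD j x y; rewrite ler_norml => /andP[_ /(ler_wpM2r h0)].
  have := cL i j x y; rewrite ler_norml => /andP[+ _].
  rewrite /=; lra.
by move=> x y; rewrite ler_norml key andbT lerNl opprB enormB key.
Qed.

Lemma dpv_elipP n i : exists L, elip L (dpv n i).
Proof.
exists (lipc C n); apply: dpv_elip => //.
exact: (reg_cost_lip HD).
Qed.

Lemma L1_dpv n i j x : L1 P (fun w => dpv n i (F j x w)).
Proof. by have [L hL] := dpv_elipP n i; exact: L1_step hL. Qed.

Lemma pol_dpv n i j x : pol 1 (fun w => dpv n i (F j x w)).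
Proof. by have [L hL] := dpv_elipP n i; exact: pol_step hL. Qed.


Lemma dpv_uniform_elip : (forall i j, elip 0 (cost D i j)) ->
  forall n i, elip ((1 + kstep * h) ^+ n * (C + n%:R * (C * h))) (dpv n i).
Proof.
move=> c0L n i x y; apply: (le_trans (dpv_elip (lexx 0) c0L n i x y)).
rewrite ler_wpM2r ?enorm_ge0//; have r1 : 1 <= 1 + kstep * h by rewrite lerDl mulr_ge0.
have Ch : 0 <= C * h by rewrite mulr_ge0.
elim: n => [|n ih]; first by rewrite /= mul0r addr0 expr0 mul1r.
rewrite [lipc _ _]/= addr0.
have h2 : (1 + kstep * h) * lipc 0 n <=
    (1 + kstep * h) ^+ n.+1 * (C + n%:R * (C * h)).
  by rewrite exprS -mulrA ler_wpM2l// (le_trans _ r1).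
have h3 : C * h <= (1 + kstep * h) ^+ n.+1 * (C * h).
  by rewrite ler_peMl// exprn_ege1.
rewrite (_ : C + n.+1%:R * _ = C + n%:R * (C * h) + C * h); last by rewrite -natr1; ring.
by rewrite mulrDr lerD.
Qed.

(** The unit added to [kstep] absorbs the running reward, at most C wgt(x) h per step. *)
Definition rho0 : R := 1 + (kstep + 1) * h.

Lemma rho0_ge1 : 1 <= rho0.
Proof. by rewrite lerDl mulr_ge0// addr_ge0. Qed.

Let growth_aux n j x : C * rho0 ^+ n * E (fun w => wgt (F j x w)) + C * wgt x * h
  <= C * rho0 ^+ n.+1 * wgt x.
Proof.
have h2 : C * rho0 ^+ n * E (fun w => wgt (F j x w)) <=
    C * rho0 ^+ n * ((1 + kstep * h) * wgt x).
  by rewrite ler_wpM2l ?Ex_wgt// mulr_ge0// exprn_ge0// (le_trans _ rho0_ge1).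
have h3 : C * wgt x * h * 1 <= C * wgt x * h * rho0 ^+ n.
  by rewrite ler_wpM2l ?exprn_ege1 ?rho0_ge1// mulr_ge0// mulr_ge0// wgt_ge0.
rewrite exprS {2}/rho0; lra.
Qed.

Lemma dpv_growth n i x : `|dpv n i x| <= C * rho0 ^+ n * wgt x.
Proof.
elim: n => [|n ih] in i x *; first by rewrite expr0 mulr1; exact: (reg_terminal_growth HD).
have iw j := L1_step j x elip_wgt.
have iv j := L1_dpv n j j x.
have bnd j : `|E (fun w => dpv n j (F j x w))| <= C * rho0 ^+ n * E (fun w => wgt (F j x w)).
  rewrite (le_trans (Ex_abs (iv j)))// -ExZ//.
  by apply: Ex_le => //; [exact: L1_norm|exact: L1Z].
have run j : `|running D j x * h| <= C * wgt x * h.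
  by rewrite normrM (ger0_norm h0) ler_wpM2r// (reg_running_growth HD).
rewrite ler_norml; apply/andP; split.
  have := dpv_ge n i i x; rewrite /dpu (reg_cost_diag HD).
  have := growth_aux n i x; have := run i; have := bnd i.
  rewrite !ler_norml => /andP[+ _] /andP[+ _]; lra.
have [j ->] := dpv_opt n i x; rewrite /dpu.
have := growth_aux n j x; have := run j; have := bnd j.
have := reg_cost_ge0 HD i j x.
rewrite !ler_norml => ? /andP[_ +] /andP[_ +]; lra.
Qed.

Definition gap n i x : R := C * rho0 ^+ n * wgt x - dpv n i x.

Lemma gap_ge0 n i x : 0 <= gap n i x.
Proof. by rewrite /gap subr_ge0 (le_trans (ler_norm _))// dpv_growth. Qed.

Lemma gap_le n i x : gap n i x <= 2 * C * rho0 ^+ n * wgt x.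
Proof. by have := dpv_growth n i x; rewrite /gap ler_norml => /andP[+ _]; lra. Qed.

Lemma pol_gap n i j x : pol 1 (fun w => gap n i (F j x w)).
Proof.
exact: (pgrowB (@nse_ge1 _ _ _ _ theta)
  (pgrowM (pgrow_cst _ (C * rho0 ^+ n)) (pol_step j x elip_wgt)) (pol_dpv n i j x)).
Qed.

(* Along an optimal decision the gap is a supermartingale which loses at least
   the switching cost, so it controls the number of remaining switches. *)
Lemma gap_decrease n i j x : dpv n.+1 i x = dpu n i j x ->
  E (fun w => gap n j (F j x w)) <= gap n.+1 i x - cost D i j x.
Proof.
move=> e; have iw := L1_step j x elip_wgt; have iv := L1_dpv n j j x.
rewrite /gap e ExB ?ExZ//; last exact: L1Z.
have := growth_aux n j x; rewrite /dpu.
have : `|running D j x * h| <= C * wgt x * h.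
  by rewrite normrM (ger0_norm h0) ler_wpM2r// (reg_running_growth HD).
rewrite ler_norml => /andP[_ +]; lra.
Qed.

(** * Local Lipschitz bound when the costs depend on the state *)

Section local_lipschitz.
Variables (nmax : nat) (Lb : R).
Hypotheses (Lb1 : 1 <= Lb) (hLb : forall n, (n <= nmax)%N -> 2 * C * rho0 ^+ n <= Lb).

Let Lb0 : 0 <= Lb := le_trans ler01 Lb1.

Lemma gap_leL n i x : (n <= nmax)%N -> gap n i x <= Lb * wgt x.
Proof.
by move=> /hLb hn; rewrite (le_trans (gap_le _ _ _))// ler_wpM2r// wgt_ge0.
Qed.

(* Along an optimal decision the expected energy loses half of the conditional
   variance of the gap, see [energy_step]. *)
Definition energy n i x : R := wgt x ^+ 2 + 2 * Lb * wgt x * gap n i x - gap n i x ^+ 2.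

Lemma energy_ge n i x : (n <= nmax)%N -> wgt x ^+ 2 <= energy n i x.
Proof.
move=> /(gap_leL i x) hg; have g0 := gap_ge0 n i x; rewrite /energy.
have : gap n i x * gap n i x <= Lb * wgt x * gap n i x by rewrite ler_wpM2r.
have : 0 <= Lb * wgt x * gap n i x by rewrite mulr_ge0// mulr_ge0// wgt_ge0.
lra.
Qed.

Lemma energy_le n i x : energy n i x <= (1 + Lb ^+ 2) * wgt x ^+ 2.
Proof. by rewrite /energy; have := sqr_ge0 (Lb * wgt x - gap n i x); lra. Qed.

Definition gvar n j x : R :=
  E (fun w => (gap n j (F j x w) - E (fun w => gap n j (F j x w))) ^+ 2).

(** The 1 is the growth of the squared weight. Of 4 Lb^2, half comes from the drift of the weight
    against the mean gap, half from the squared increment of the weight. *)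
Definition kenergy : R := kstep * (1 + 4 * Lb ^+ 2).

Lemma kenergy_ge0 : 0 <= kenergy.
Proof. by rewrite mulr_ge0// addr_ge0// mulr_ge0// sqr_ge0. Qed.

Lemma pol_energy n i j x : pol 2 (fun w => energy n i (F j x w)).
Proof.
have N1 := @nse_ge1 _ _ _ _ theta; have pg := pol_gap n i j x.
have pw := pol_step j x elip_wgt.
exact: (pgrowB N1 (pgrowD N1 (pgrowX N1 2 pw)
  (pgrowM (pgrowM (pgrow_cst _ (2 * Lb)) pw) pg)) (pgrowX N1 2 pg)).
Qed.

Lemma L1_energy n i j x : L1 P (fun w => energy n i (F j x w)).
Proof. exact: (pol_L1 Hth _ (pol_energy n i j x)). Qed.

Lemma energy_step n i j x : (n.+1 <= nmax)%N -> dpv n.+1 i x = dpu n i j x ->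
  E (fun w => energy n j (F j x w)) <=
  (1 + kenergy * h) * energy n.+1 i x - 2^-1 * gvar n j x.
Proof.
move=> hn e; have N1 := @nse_ge1 _ _ _ _ theta.
set u := E (fun w => gap n j (F j x w)).
set s := wgt x; set g := gap n.+1 i x.
have s0 : 0 <= s := wgt_ge0 x.
have ug : u <= g.
  by rewrite (le_trans (gap_decrease e))// gerBl; exact: (reg_cost_ge0 HD).
have u0 : 0 <= u by apply: Ex_ge0 => w; exact: gap_ge0.
have gL : g <= Lb * s by exact: gap_leL.
have pw := pol_step j x elip_wgt; have pg := pol_gap n j j x.
have pwi : pol 1 (fun w => wgt (F j x w) - s) := pgrowB N1 pw (pgrow_cst _ _).
have pgi : pol 1 (fun w => gap n j (F j x w) - u) := pgrowB N1 pg (pgrow_cst _ _).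
have i1 := pol_lin Hth pw; have i2 := pol_lin Hth pg; have i3 := pol_lin Hth pwi.
have i4 := pol_sqr Hth pw; have i5 := pol_sqr Hth pwi; have i6 := pol_sqr Hth pgi.
have i7 := L1_energy n j j x.
(* The energy expanded around the weight [s] and the mean gap [u]. The product 2 Lb (w' - s) (g' -
   u) is at most 2 Lb^2 (w' - s)^2 + (g' - u)^2 / 2, so that half of the square in -G^2 survives and
   becomes the variance. *)
pose Q w := wgt (F j x w) ^+ 2 + (2 * Lb * s) * gap n j (F j x w)
    + (2 * Lb * u) * (wgt (F j x w) - s) + (2 * Lb ^+ 2) * (wgt (F j x w) - s) ^+ 2
    - 2^-1 * (gap n j (F j x w) - u) ^+ 2 - (2 * u) * gap n j (F j x w) + u ^+ 2.
have iQ : L1 P Q by rewrite /Q; L1_tac.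
apply: (@le_trans _ _ (E Q)).
  apply: Ex_le => // w; rewrite /energy /Q.
  move: (wgt _) (gap _ _ _) => s' g'.
  have := sqr_ge0 (2 * Lb * (s' - s) - (g' - u)); lra.
have -> : E Q = E (fun w => wgt (F j x w) ^+ 2) + 2 * Lb * s * u
    + 2 * Lb * u * (E (fun w => wgt (F j x w)) - s)
    + 2 * Lb ^+ 2 * E (fun w => (wgt (F j x w) - s) ^+ 2)
    - 2^-1 * gvar n j x - 2 * u * u + u ^+ 2.
  rewrite /Q ExD; try L1_tac.
  rewrite ExB; try L1_tac.
  rewrite ExB; try L1_tac.
  do 3 (rewrite ExD; try L1_tac).
  rewrite !ExZ; try L1_tac.
  by rewrite ExB ?Ex_cst; try L1_tac.
have h2 := Ex_wgt_sqr j x; have h3 := Ex_wgt j x; have h4 := Ex_wgt_incr_sqr j x.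
rewrite -/s in h2 h3 h4.
have hu : u * (E (fun w => wgt (F j x w)) - s) <= Lb * s * (kstep * h * s).
  apply: (@le_trans _ _ (u * (kstep * h * s))); first by rewrite ler_wpM2l//; lra.
  by rewrite ler_wpM2r ?(le_trans ug)// mulr_ge0// mulr_ge0.
have hu' : Lb * (u * (E (fun w => wgt (F j x w)) - s)) <= Lb * (Lb * s * (kstep * h * s)).
  by rewrite ler_wpM2l.
have h4' := ler_wpM2l (sqr_ge0 Lb) h4.
(* The function 2 Lb s t - t^2 of t increases up to t = Lb s, and u <= g <= Lb s: a decrease of the
   mean gap cannot raise the energy. *)
have mono : 2 * Lb * s * u - u ^+ 2 <= 2 * Lb * s * g - g ^+ 2.
  have : 0 <= (g - u) * (2 * Lb * s - g - u) by rewrite mulr_ge0; lra.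
  lra.
have eg : s ^+ 2 <= energy n.+1 i x by exact: energy_ge.
have egE : energy n.+1 i x = s ^+ 2 + 2 * Lb * s * g - g ^+ 2 by [].
have : kenergy * h * s ^+ 2 <= kenergy * h * energy n.+1 i x.
  by rewrite ler_wpM2l// mulr_ge0// kenergy_ge0.
rewrite {1}/kenergy; lra.
Qed.

Variable Mc : R.
Hypotheses (Mc1 : C <= Mc) (Mc2 : C <= Mc * c0).

(** One rate for all terms of [psi]: [kstep] for the distance, 5/4 of it for the squared distance
    together with the share of (r' - r)^2, [kenergy] for the energy, and 1 for the running
    reward. *)
Definition rho1 : R := 1 + (2 * kstep + kenergy + 1) * h.

Lemma rho1_ge1 : 1 <= rho1.
Proof.
by rewrite lerDl mulr_ge0// addr_ge0// addr_ge0 ?kenergy_ge0// mulr_ge0.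
Qed.

(* The gap pays for the Lipschitz constants of the costs of the remaining
   switches, and the energy for the covariance of the gap and the distance;
   at the end [eps = |x - y| / wgt x]. *)
Definition psi (eps : R) n i x y : R :=
  Mc * rho1 ^+ n * ((gap n i x + 1) * enorm (x - y) + 2 * eps * energy n i x
     + eps^-1 * enorm (x - y) ^+ 2).

(** Induction with [eps] fixed. An optimal decision at [x] is imposed on [y]; the product of gap and
    distance then produces a covariance, whose variance part is repaid by the loss of energy in
    [energy_step]. *)
Lemma dpv_le_psi eps n i x y : 0 < eps -> (n <= nmax)%N ->
  dpv n i x - dpv n i y <= psi eps n i x y.
Proof.
move=> e0; have Mc0 : 0 <= Mc := le_trans C0 Mc1.
have ei0 : 0 < eps^-1 by rewrite invr_gt0.
elim: n => [|n ih] in i x y *.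
  move=> n0; rewrite /psi expr0 mulr1 /=.
  have := reg_terminal_lip HD i x y; rewrite ler_norml => /andP[_].
  have r0 := enorm_ge0 (x - y); have g0 := gap_ge0 0 i x.
  have q0 : 0 <= energy 0 i x by rewrite (le_trans _ (energy_ge i x n0))// sqr_ge0.
  have h2 : C * enorm (x - y) <= Mc * enorm (x - y) by rewrite ler_wpM2r.
  have : 0 <= Mc * (gap 0 i x * enorm (x - y) + 2 * eps * energy 0 i x
     + eps^-1 * enorm (x - y) ^+ 2).
    rewrite mulr_ge0// addr_ge0 ?(mulr_ge0 (ltW ei0) (sqr_ge0 _))// addr_ge0 ?mulr_ge0//.
    exact: ltW.
  rewrite /=; lra.
move=> hn; have hn' : (n <= nmax)%N by exact: ltnW.
have N1 := @nse_ge1 _ _ _ _ theta.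
have [j oj] := dpv_opt n i x.
set r := enorm (x - y); have r0 : 0 <= r := enorm_ge0 _.
set u := E (fun w => gap n j (F j x w)).
have u0 : 0 <= u by apply: Ex_ge0 => w; exact: gap_ge0.
have ug : u <= gap n.+1 i x - cost D i j x := gap_decrease oj.
set c := cost D i j x in ug; have cge0 : 0 <= c := reg_cost_ge0 HD i j x.
have pr := pol_dist j x y; have pg := pol_gap n j j x.
have pri : pol 1 (fun w => enorm (F j x w - F j y w) - r) := pgrowB N1 pr (pgrow_cst _ _).
have pgi : pol 1 (fun w => gap n j (F j x w) - u) := pgrowB N1 pg (pgrow_cst _ _).
have i1 := pol_lin Hth pr; have i2 := pol_lin Hth pg.
have i3 := pol_sqr Hth pr; have i4 := pol_sqr Hth pri; have i5 := pol_sqr Hth pgi.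
have i6 := L1_energy n j j x; have i7 := pol_lin Hth pgi.
have iv := L1_dpv n j j x; have iv' := L1_dpv n j j y.
(* From g' r' = u r' + r (g' - u) + (g' - u) (r' - r): the second term is centred, and the last is
   at most eps (g' - u)^2 + (r' - r)^2 / (4 eps). *)
pose Q w := (u + 1) * enorm (F j x w - F j y w) + r * (gap n j (F j x w) - u)
    + eps * (gap n j (F j x w) - u) ^+ 2
    + (eps^-1 / 4) * (enorm (F j x w - F j y w) - r) ^+ 2
    + (2 * eps) * energy n j (F j x w) + eps^-1 * enorm (F j x w - F j y w) ^+ 2.
have iQ : L1 P Q by rewrite /Q; L1_tac.
have EQ : E Q = (u + 1) * E (fun w => enorm (F j x w - F j y w))
    + eps * gvar n j x
    + (eps^-1 / 4) * E (fun w => (enorm (F j x w - F j y w) - r) ^+ 2)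
    + (2 * eps) * E (fun w => energy n j (F j x w))
    + eps^-1 * E (fun w => enorm (F j x w - F j y w) ^+ 2).
  rewrite /Q; do 5 (rewrite ExD; try L1_tac).
  rewrite !ExZ; try L1_tac.
  by rewrite ExB ?Ex_cst ?subrr ?mulr0 ?addr0//; L1_tac.
have h1' : E (fun w => dpv n j (F j x w)) - E (fun w => dpv n j (F j y w)) <=
    Mc * rho1 ^+ n * E Q.
  rewrite -ExB// -ExZ//; apply: Ex_le => [||w]; [L1_tac|L1_tac|].
  apply: (le_trans (ih j _ _ hn')); rewrite /psi ler_wpM2l//.
    by rewrite mulr_ge0// exprn_ge0// (le_trans _ rho1_ge1).
  rewrite /Q; move: (enorm (_ - _)) (gap _ _ _) (energy _ _ _) => r' g' Q'.
  rewrite 2!lerD2r.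
  have : 0 <= eps * ((g' - u) - eps^-1 / 2 * (r' - r)) ^+ 2.
    by rewrite mulr_ge0 ?sqr_ge0// ltW.
  rewrite [X in eps * X](_ : _ = (g' - u) ^+ 2 - (g' - u) * eps^-1 * (r' - r)
      + eps^-1 * eps^-1 / 4 * (r' - r) ^+ 2); last by field; rewrite gt_eqF.
  have ee : eps * eps^-1 = 1 by rewrite divff// gt_eqF.
  rewrite mulrDr mulrBr.
  rewrite (_ : eps * (_ * eps^-1 * _) = (g' - u) * (r' - r) * (eps * eps^-1)); last by ring.
  rewrite (_ : eps * (eps^-1 * eps^-1 / 4 * _) = eps^-1 / 4 * (r' - r) ^+ 2 * (eps * eps^-1)); last by ring.
  rewrite ee; lra.
have h2 := Ex_dist_sqr j x y; have h3 := Ex_dist j x y.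
have h4 := Ex_dist_incr_sqr j x y; rewrite -/r in h2 h3 h4.
have h5 := energy_step hn oj.
set q1 := energy n.+1 i x in h5 *; set g := gap n.+1 i x in ug *.
have q0 : 0 <= q1 by rewrite (le_trans _ (energy_ge i x hn))// sqr_ge0.
have kh0 : 0 <= kstep * h by rewrite mulr_ge0.
have keh0 : 0 <= kenergy * h by rewrite mulr_ge0// kenergy_ge0.
(* The decrease of the gap by [c] frees c r, reserved for the Lipschitz error of the cost; h r is
   reserved for the running reward. The term eps [gvar] cancels against 2 eps times the half
   variance lost by the energy. *)
have bQ : E Q + c * r + h * r <= rho1 * ((g + 1) * r + 2 * eps * q1 + eps^-1 * r ^+ 2).
  rewrite EQ.
  have b1 : (u + 1) * E (fun w => enorm (F j x w - F j y w)) <=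
      (1 + kstep * h) * (g + 1) * r - c * r.
    apply: (@le_trans _ _ ((u + 1) * ((1 + kstep * h) * r))).
      by rewrite ler_wpM2l// addr_ge0.
    have : (u + 1) * ((1 + kstep * h) * r) <= (g - c + 1) * ((1 + kstep * h) * r).
      by rewrite ler_wpM2r ?mulr_ge0 ?addr_ge0// lerD2r.
    have : 0 <= kstep * h * (c * r) by rewrite mulr_ge0// mulr_ge0.
    lra.
  have b2 := ler_wpM2l (ltW ei0) h4; have b3 := ler_wpM2l (ltW ei0) h2.
  have b4 := ler_wpM2l (ltW e0) h5.
  have p1 : 0 <= (kstep * h) * ((g + 1) * r).
    rewrite mulr_ge0// mulr_ge0// addr_ge0//; exact: gap_ge0.
  have p2 : 0 <= (kstep * h) * (eps * q1) by rewrite mulr_ge0// mulr_ge0// ltW.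
  have p3 : 0 <= kenergy * h * ((g + 1) * r).
    rewrite mulr_ge0// mulr_ge0// addr_ge0//; exact: gap_ge0.
  have p4 : 0 <= kenergy * h * (eps^-1 * r ^+ 2).
    by rewrite mulr_ge0// mulr_ge0 ?sqr_ge0// ltW.
  have p5 : 0 <= h * (eps^-1 * r ^+ 2).
    by rewrite mulr_ge0// mulr_ge0 ?sqr_ge0// ltW.
  have p6 : 0 <= h * (eps * q1) by rewrite mulr_ge0// mulr_ge0// ltW.
  have p7 : 0 <= h * (g * r) by rewrite mulr_ge0// mulr_ge0//; exact: gap_ge0.
  have p8 : 0 <= kstep * h * (eps^-1 * r ^+ 2).
    by rewrite mulr_ge0// mulr_ge0 ?sqr_ge0// ltW.
  rewrite /rho1; lra.
have rn1 : 1 <= rho1 ^+ n by rewrite exprn_ege1// rho1_ge1.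
have MM : 0 <= Mc * rho1 ^+ n by rewrite mulr_ge0// (le_trans _ rn1).
have hr : C * (h * r) <= Mc * rho1 ^+ n * (h * r).
  by rewrite ler_wpM2r ?mulr_ge0// (le_trans Mc1)// ler_peMr.
(* A true switch has c >= c0, so that its Lipschitz error C r is at most Mc c0 r <= Mc c r; this is
   the purpose of the bound C <= Mc c0. *)
have hc : cost D i j y - c <= Mc * rho1 ^+ n * (c * r).
  have [ji|ji] := eqVneq j i.
    by rewrite /c ji !(reg_cost_diag HD) subrr mulr_ge0 ?mul0r.
  have c0c : c0 <= c by exact: (reg_cost_lb HD).
  have := reg_cost_lip HD i j x y; rewrite -/c -/r ler_norml => /andP[+ _].
  have : C * r <= Mc * c0 * r by rewrite ler_wpM2r.
  have : Mc * c0 * r <= Mc * c * r by rewrite ler_wpM2r// ler_wpM2l.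
  have : Mc * (c * r) <= Mc * rho1 ^+ n * (c * r).
    by rewrite ler_wpM2r ?mulr_ge0// ler_peMr.
  lra.
have := dpv_ge n i j y; rewrite oj /dpu -/c /psi exprS -/g -/q1 -/r.
have := reg_running_lip HD j x y; rewrite -/r ler_norml => /andP[_ /(ler_wpM2r h0)].
have := ler_wpM2l MM bQ; lra.
Qed.

(** At the final [eps] the three terms of [psi] are at most Lb + 1, 2 (1 + Lb^2) and 1 times wgt(x)
    |x - y|. As [psi] is not symmetric, the two points are exchanged to reach the absolute value. *)
Lemma dpv_local_lip n i x y : (n <= nmax)%N ->
  `|dpv n i x - dpv n i y| <=
  Mc * rho1 ^+ n * (Lb + 2 * (1 + Lb ^+ 2) + 2) * (wgt x + wgt y) * enorm (x - y).
Proof.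
move=> hn; set K := Mc * rho1 ^+ n; set B := _ + _ + 2.
have K0' : 0 <= K.
  apply: mulr_ge0; first exact: le_trans C0 Mc1.
  by rewrite exprn_ge0// (le_trans _ rho1_ge1).
have B0 : 0 <= B by rewrite addr_ge0// addr_ge0// mulr_ge0// addr_ge0// sqr_ge0.
have key z z' : dpv n i z - dpv n i z' <= K * B * wgt z * enorm (z - z').
  have [r0|r0] := eqVneq (enorm (z - z')) 0.
    rewrite r0 mulr0; have -> : z = z' by apply/eqP; rewrite -subr_eq0; exact/eqP/enorm_eq0.
    by rewrite subrr.
  have {}r0 : 0 < enorm (z - z') by rewrite lt_def r0 enorm_ge0.
  have s0 := wgt_gt0 z; have s1 := wgt_ge1 z.
  have e0 : 0 < enorm (z - z') / wgt z by rewrite divr_gt0.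
  apply: (le_trans (dpv_le_psi i z z' e0 hn)); rewrite /psi -/K.
  rewrite (_ : K * B * wgt z * _ = K * (B * wgt z * enorm (z - z'))); last by ring.
  apply: ler_wpM2l => //.
  set r := enorm (z - z') in r0 *; set s := wgt z in s0 s1 *.
  have h2 : (gap n i z + 1) * r <= (Lb * s + s) * r.
    by rewrite ler_wpM2r ?(ltW r0)// lerD// gap_leL.
  have h3 : 2 * (r / s * energy n i z) <= 2 * (1 + Lb ^+ 2) * s * r.
    have : r / s * energy n i z <= r / s * ((1 + Lb ^+ 2) * s ^+ 2).
      by rewrite ler_wpM2l ?energy_le// divr_ge0// ltW.
    rewrite (_ : r / s * ((1 + Lb ^+ 2) * s ^+ 2) = (1 + Lb ^+ 2) * s * r); first by lra.
    by field; rewrite gt_eqF.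
  have h4 : (r / s)^-1 * r ^+ 2 = s * r by field; rewrite !gt_eqF.
  rewrite h4 /B; lra.
have x0 := wgt_ge0 x; have y0 := wgt_ge0 y; have r0 := enorm_ge0 (x - y).
have KB : 0 <= K * B by rewrite mulr_ge0.
have h2 := key x y; have h3 := key y x; rewrite (enormB y) in h3.
have p1 : 0 <= K * B * wgt x * enorm (x - y) by rewrite mulr_ge0// mulr_ge0.
have p2 : 0 <= K * B * wgt y * enorm (x - y) by rewrite mulr_ge0// mulr_ge0.
by rewrite ler_norml; lra.
Qed.

End local_lipschitz.

End step.

End dynamic_programming.

(** * Grid projection and quantized law *)

Section grid_projection.
Context {R : realType} {d : nat}.
Hypothesis d0 : (0 < d)%N.
Variables (delta Rad : R) (projX : 'cV[R]_d -> 'cV[R]_d).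
Hypotheses (delta0 : 0 < delta) (Rad0 : 0 < Rad).
Hypothesis HX : closest_projection (space_grid delta Rad) projX.

(** Truncation instead of rounding to the nearest: shrinking each coordinate keeps the grid point
    inside the ball, at the price of a full mesh delta / d per coordinate. *)
Lemma round_toward_zero (a s : R) : 0 < s ->
  exists z : int, `|s * z%:~R| <= `|a| /\ `|a - s * z%:~R| <= s.
Proof.
move=> s0; wlog a0 : a / 0 <= a.
  move=> H; have [a0|/ltW a0] := leP 0 a; first exact: H.
  have [|z [h1 h2]] := H (- a); first by rewrite oppr_ge0.
  exists (- z); rewrite rmorphN/= mulrN normrN opprK -(normrN a); split=> //.
  by rewrite -normrN opprD.
have a0' : 0 <= a / s by rewrite divr_ge0// ltW.
have h := real_floor_itv (num_real (a / s)).
set z := Num.floor (a / s) in h; have /andP[h1 h2] := h.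
have z0 : 0 <= (z%:~R : R) by rewrite ler0z Num.Theory.floor_ge0.
rewrite ler_pdivlMr// in h1; rewrite ltr_pdivrMr// in h2.
exists z; rewrite (ger0_norm a0) ger0_norm ?mulr_ge0 ?(ltW s0)//; split; first by lra.
rewrite intrD in h2; rewrite ger0_norm; lra.
Qed.

Lemma enorm_mono (x y : 'cV[R]_d) : (forall j, `|x j 0| <= `|y j 0|) -> enorm x <= enorm y.
Proof.
move=> h; apply: ler_wsqrtr; apply: ler_sum => j _.
by rewrite -real_normK ?num_real// -[leRHS]real_normK ?num_real// lerXn2r// nnegrE.
Qed.

Lemma grid_near (y : 'cV[R]_d) : enorm y <= Rad ->
  exists2 z, space_grid delta Rad z & enorm (y - z) <= delta.
Proof.
move=> yR; have d0' : 0 < (d%:R : R) by rewrite ltr0n.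
have s0 : 0 < delta / d%:R by rewrite divr_gt0.
have /choice[z hz] : forall j : 'I_d, exists z : int,
    `|delta / d%:R * z%:~R| <= `|y j 0| /\ `|y j 0 - delta / d%:R * z%:~R| <= delta / d%:R.
  by move=> j; exact: round_toward_zero.
exists (\col_j (delta / d%:R * (z j)%:~R)).
  split; first by exists (\col_j z j); apply/colP => j; rewrite !mxE.
  apply: le_trans yR; apply: enorm_mono => j; rewrite mxE; exact: (hz j).1.
apply: (le_trans (enorm_le_sum _)).
apply: (@le_trans _ _ (\sum_(j < d) delta / d%:R)).
  by apply: ler_sum => j _; rewrite !mxE; exact: (hz j).2.
by rewrite sumr_const card_ord -[leLHS]mulr_natr divfK// gt_eqF.
Qed.

Lemma projX_norm y : enorm (projX y) <= enorm y + delta.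
Proof.
have [[_ pR] close] := HX y.
have [yR|/ltW yR] := leP (enorm y) Rad; last first.
  by rewrite (le_trans pR)// (le_trans yR)// lerDl ltW.
have [z zG hz] := grid_near yR.
have h := le_trans (close z zG) hz.
rewrite -{1}(subrK y (projX y)) addrC (le_trans (enormD _ _))// lerD2l.
by rewrite enormB.
Qed.

(** A point outside the ball is first brought radially to the sphere, over a distance |y| - Rad <=
    |y| <= |y|^2 / Rad: the factor 1 / Rad is bought with one more power of |y|. *)
Lemma projX_dist y : enorm (y - projX y) <= enorm y ^+ 2 / Rad + delta.
Proof.
have [_ close] := HX y; have y0 := enorm_ge0 y.
have [yR|yR] := leP (enorm y) Rad.
  have [z zG hz] := grid_near yR.
  rewrite (le_trans (close z zG))// (le_trans hz)// lerDr divr_ge0 ?sqr_ge0//.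
  exact: ltW.
have yp : 0 < enorm y := lt_trans Rad0 yR.
have e1 : enorm ((Rad / enorm y) *: y) = Rad.
  by rewrite enormZ ger0_norm ?divfK ?gt_eqF// divr_ge0// ltW.
have [|z zG hz] := @grid_near ((Rad / enorm y) *: y); first by rewrite e1.
rewrite (le_trans (close z zG))//.
have -> : y - z = (y - (Rad / enorm y) *: y) + ((Rad / enorm y) *: y - z).
  by rewrite addrA subrK.
rewrite (le_trans (enormD _ _))// lerD//.
rewrite -{1}(scale1r y) -scalerBl enormZ ger0_norm; last first.
  by rewrite subr_ge0 ler_pdivrMr// mul1r ltW.
rewrite mulrBl mul1r divfK ?gt_eqF//.
have : enorm y <= enorm y ^+ 2 / Rad.
  by rewrite ler_pdivlMr// expr2 ler_wpM2l// ltW.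
by move=> h; rewrite (le_trans _ h)// gerBl ltW.
Qed.

End grid_projection.

Section quantized_law.
Context {R : realType} {d N : nat} disp (Omega : measurableType disp).
Context (P : probability Omega R) (M : R) (theta : Omega -> 'cV[R]_d).
Hypothesis Hth : noise P M theta.
Variables (w : 'I_N -> 'cV[R]_d) (projw : 'cV[R]_d -> 'cV[R]_d).
Hypothesis Hq : quantizer theta w projw.
Local Notation pol := (pgrow (nse theta)).
Local Notation hat := (fun o => projw (theta o)).
Local Notation eta := (fun o => projw (theta o) - theta o).

Lemma quant_cell_measurable l : measurable [set o | projw (theta o) = w l].
Proof.
have [_ _ /mvecE mh] := Hq.
rewrite (_ : [set _ | _] = (hat : Omega -> mcV) @^-1` [set w l]).
  have := @measurable_mcV _ _ _ _ _ mh; move/(_ measurableT [set w l]).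
  rewrite setTI; apply; apply: sub_sigma_algebra.
  exists (fun j => [set w l j 0]); split; first by move=> j; exact: measurable_set1.
  apply/seteqP; split=> x /=; first by move=> ->.
  by move=> h; apply/colP => j; exact: h.
by apply/seteqP; split.
Qed.

(** The quantized noise takes finitely many values, so that every function of it is measurable and
    bounded. This matters for the quantized value after projection, which has no Lipschitz bound at
    hand. *)
Lemma quant_simple (phi : 'cV[R]_d -> R) o :
  phi (projw (theta o)) =
  \sum_(l < N) phi (w l) * \1_[set o | projw (theta o) = w l] o.
Proof.
have [wi hw _] := Hq; have [[l _ el] _] := hw (theta o).
rewrite (bigD1 l)//= indicE mem_set ?mulr1//= big1 ?addr0 ?el// => k kl.
rewrite indicE memNset ?mulr0//= => e; move/eqP : kl; apply.
by apply: wi; rewrite -e -el.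
Qed.

Lemma quant_pol (phi : 'cV[R]_d -> R) : pol 0 (fun o => phi (projw (theta o))).
Proof.
under eq_fun do rewrite quant_simple.
apply: (pgrow_sum (@nse_ge1 _ _ _ _ theta)) => l.
split; first by apply: measurable_funM => //; apply: measurable_indic; exact: quant_cell_measurable.
exists `|phi (w l)|; split=> // o; rewrite expr0 mulr1 normrM ler_piMr// indicE.
by case: (_ \in _); rewrite ?normr1 ?normr0.
Qed.

Lemma quant_L1 (phi : 'cV[R]_d -> R) : L1 P (fun o => phi (projw (theta o))).
Proof. exact: (pol_L1 Hth _ (quant_pol phi)). Qed.

Lemma quant_weight_sum (phi : 'cV[R]_d -> R) :
  \sum_(l < N) quant_weight P theta w projw l * phi (w l) =
  Ex P (fun o => phi (projw (theta o))).
Proof.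
under [RHS]eq_Ex do rewrite quant_simple.
have iI l : L1 P (\1_[set o | projw (theta o) = w l]).
  by apply: integrable_indic; exact: quant_cell_measurable.
rewrite Ex_sum => [|l]; last exact: L1Z.
apply: eq_bigr => l _; rewrite ExZ// mulrC; congr (_ * _).
by rewrite /Ex /Rintegral integral_indic ?setIT//; exact: quant_cell_measurable.
Qed.

Lemma mvec_quant_err : mvec eta.
Proof.
have [_ _ /mvecE mh] := Hq; apply: mvecB => //; exact: (noise_mvec Hth).
Qed.

Lemma pol_quant_err : pol 1 (fun o => enorm (projw (theta o) - theta o)).
Proof.
split; first exact/measurable_enorm/mvec_quant_err.
have [_ [K [K0 hK]]] := quant_pol (@enorm R d).
exists (K + 1); split=> [|o]; first exact: addr_ge0.
have := hK o; rewrite expr0 mulr1 !ger0_norm ?enorm_ge0// expr1 => h.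
have n1 := nse_ge1 theta o.
rewrite (le_trans (enormD _ _))// enormN mulrDl mul1r lerD//.
  by rewrite (le_trans h)// ler_peMr.
by rewrite /nse lerDr.
Qed.

End quantized_law.

(** * Moments of the quantized chain and error recursion *)

Lemma bigmax_dist (R : realType) (q : nat) (a b : 'I_q -> R) (i : 'I_q) (e : R) :
  (forall j, `|a j - b j| <= e) ->
  `|\big[Num.max/a i]_(j < q) a j - \big[Num.max/b i]_(j < q) b j| <= e.
Proof.
move=> h; have [j ej] := bigmax_attained a i; have [k ek] := bigmax_attained b i.
have hk := le_bigmax (a i) a k; have hj := le_bigmax (b i) b j.
rewrite ej in hk *; rewrite ek in hj *.
have := h j; have := h k; rewrite !ler_norml => /andP[? ?] /andP[? ?]; lra.
Qed.

(** The inequality 2 s t c <= s^2 a^2 + t^2 b^2 is taken at s = b, t = a and divided by 2 a b, which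
    is legitimate because c > 0 forces a and b to be nonzero. *)
Lemma Ex_CauchySchwarz (R : realType) disp (Omega : measurableType disp)
    (P : probability Omega R) (f g : Omega -> R) :
  L1 P (fun o => f o ^+ 2) -> L1 P (fun o => g o ^+ 2) -> L1 P (fun o => f o * g o) ->
  Ex P (fun o => f o * g o) <=
  Num.sqrt (Ex P (fun o => f o ^+ 2)) * Num.sqrt (Ex P (fun o => g o ^+ 2)).
Proof.
move=> f2 g2 fg; set a := Num.sqrt _; set b := Num.sqrt _; set c := Ex P _.
have a0 : 0 <= a := sqrtr_ge0 _; have b0 : 0 <= b := sqrtr_ge0 _.
have ea : a ^+ 2 = Ex P (fun o => f o ^+ 2).
  by rewrite sqr_sqrtr// Ex_ge0// => o; rewrite sqr_ge0.
have eb : b ^+ 2 = Ex P (fun o => g o ^+ 2).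
  by rewrite sqr_sqrtr// Ex_ge0// => o; rewrite sqr_ge0.
have key (s t : R) : 2 * s * t * c <= s ^+ 2 * a ^+ 2 + t ^+ 2 * b ^+ 2.
  rewrite ea eb -!ExZ// -ExD; [|exact: L1Z|exact: L1Z].
  apply: Ex_le => [||o]; [exact: L1Z|by apply: L1D; exact: L1Z|].
  have := sqr_ge0 (s * f o - t * g o); lra.
have [c0|c0] := leP c 0; first by rewrite (le_trans c0)// mulr_ge0.
(* If u = 0, the inequality at s = (v^2 + 1) / c and t = 1 reads 2 (v^2 + 1) <= v^2. *)
have zero (u v : R) : 0 <= v -> (forall s t, 2 * s * t * c <= s ^+ 2 * u ^+ 2 + t ^+ 2 * v ^+ 2) -> u != 0.
  move=> v0 H; apply/eqP => u0; have := H ((v ^+ 2 + 1) / c) 1.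
  rewrite u0 expr0n/= mulr0 add0r expr1n mul1r mulr1 -mulrA divfK ?gt_eqF//.
  by have := sqr_ge0 v; lra.
have a1 : 0 < a by rewrite lt_def a0 (zero a b b0).
have b1 : 0 < b.
  rewrite lt_def b0 (zero b a a0)// => s t; have := key t s; lra.
rewrite -(@ler_pM2l _ (2 * a * b)); last by rewrite !mulr_gt0.
by have := key b a; lra.
Qed.

Section quantization_error.
Context {R : realType} {d q N : nat} disp (Omega : measurableType disp).
Context (P : probability Omega R) (M : R) (theta : Omega -> 'cV[R]_d).
Context (D : switching_data R d q) (C c0 : R).
Hypothesis Hth : noise P M theta.
Hypothesis HD : regular_data C c0 D.
Variables (w : 'I_N -> 'cV[R]_d) (projw : 'cV[R]_d -> 'cV[R]_d).
Hypothesis Hq : quantizer theta w projw.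
Variables (delta Rad : R) (projX : 'cV[R]_d -> 'cV[R]_d).
Hypotheses (d0 : (0 < d)%N) (delta0 : 0 < delta) (Rad0 : 0 < Rad).
Hypothesis HX : closest_projection (space_grid delta Rad) projX.
Variable h : R.
Hypotheses (h0 : 0 < h) (h1 : h <= 1).

Local Notation E := (Ex P).
Local Notation pol := (pgrow (nse theta)).
Local Notation eta o := (projw (theta o) - theta o).
Local Notation Fh j x o := (euler_step D h j x (projw (theta o))).
Local Notation F j x o := (euler_step D h j x (theta o)).
Local Notation N1 := (@nse_ge1 _ _ _ _ theta).

Definition qerr2 := E (fun o => enorm (eta o) ^+ 2).
Definition qerr4 := E (fun o => enorm (eta o) ^+ 4).

Let C1 : 1 <= C := reg_ge1 HD.
Let C0 : 0 <= C := le_trans ler01 C1.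
Let M0 : 0 <= M := noiseM_ge0 Hth.
Let hge0 : 0 <= h := ltW h0.
Let pe : pol 1 (fun o => enorm (eta o)) := pol_quant_err Hth Hq.
Let pt : pol 1 (fun o => enorm (theta o)) := pol_theta Hth.
Let ie2 : L1 P (fun o => enorm (eta o) ^+ 2) := pol_sqr Hth pe.
Let it2 : L1 P (fun o => enorm (theta o) ^+ 2) := pol_sqr Hth pt.
Let ie4 : L1 P (fun o => enorm (eta o) ^+ 4).
Proof. exact: (pol_L1 Hth _ (pgrowX N1 4 pe)). Qed.
Let it4 : L1 P (fun o => enorm (theta o) ^+ 4).
Proof. exact: (pol_L1 Hth _ (pgrowX N1 4 pt)). Qed.

Lemma qerr2_ge0 : 0 <= qerr2. Proof. by apply: Ex_ge0 => o; rewrite sqr_ge0. Qed.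

Lemma qerr4_ge0 : 0 <= qerr4.
Proof. by apply: Ex_ge0 => o; rewrite exprn_even_ge0. Qed.

(** From t^2 <= h + t^4 / h; it lets the rate h + E4 / h govern the lower moments as well as the
    fourth. *)
Lemma qerr2_le4 : qerr2 <= h + qerr4 / h.
Proof.
apply: (@le_trans _ _ (E (fun o => h + h^-1 * enorm (eta o) ^+ 4))).
  apply: Ex_le => [||o]; [L1_tac|L1_tac|].
  rewrite -(ler_pM2l h0) mulrDr (mulrA h h^-1) divff ?gt_eqF// mul1r.
  rewrite (exprM _ 2 2); have := sqr_ge0 (h - enorm (eta o) ^+ 2).
  have := mulr_ge0 hge0 (sqr_ge0 (enorm (eta o))); nra.
by rewrite ExD ?ExZ ?Ex_cst 1?[_ / h]mulrC//; L1_tac.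
Qed.

(** Including delta / h gives delta <= h qwt(x): a displacement by [delta] at each step becomes a
    relative change of order h, which remains bounded over Th / h steps. *)
Definition qwt (x : 'cV[R]_d) : R := Num.sqrt (1 + (delta / h) ^+ 2 + enorm x ^+ 2).

Let D0 : 0 <= delta / h. Proof. by rewrite divr_ge0// ltW. Qed.

Ltac slra := have ? := h0; have ? := h1; have ? := C1; have ? := M0; have ? := D0; lra.

Lemma qwt_sqr x : qwt x ^+ 2 = 1 + (delta / h) ^+ 2 + enorm x ^+ 2.
Proof. by rewrite sqr_sqrtr// addr_ge0 ?addr_ge0 ?sqr_ge0. Qed.

Lemma qwt_ge0 x : 0 <= qwt x. Proof. exact: sqrtr_ge0. Qed.

Lemma qwt_ge (a : R) x : 0 <= a -> a ^+ 2 <= qwt x ^+ 2 -> a <= qwt x.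
Proof. by move=> a0; rewrite ler_pXn2r ?nnegrE ?qwt_ge0. Qed.

Lemma qwt_ge1 x : 1 <= qwt x.
Proof.
apply: qwt_ge => //; rewrite qwt_sqr.
have := sqr_ge0 (delta / h); have := sqr_ge0 (enorm x); lra.
Qed.

Lemma qwt_enorm x : enorm x <= qwt x.
Proof.
apply: qwt_ge; first exact: enorm_ge0.
by rewrite qwt_sqr; have := sqr_ge0 (delta / h); lra.
Qed.

Lemma qwt_wgt x : wgt x <= qwt x.
Proof.
apply: qwt_ge; first exact: wgt_ge0.
by rewrite qwt_sqr wgt_sqr; have := sqr_ge0 (delta / h); lra.
Qed.

Lemma qwt_delta x : delta <= h * qwt x.
Proof.
rewrite mulrC -ler_pdivrMr//; apply: qwt_ge => //.
by rewrite qwt_sqr; have := sqr_ge0 (enorm x); lra.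
Qed.

Lemma qwt_le x : qwt x <= 1 + enorm x + delta / h.
Proof.
have e0 := enorm_ge0 x.
rewrite -(@ler_pXn2r _ 2) ?nnegrE ?qwt_ge0 ?addr_ge0// qwt_sqr.
have D0' := D0; have := mulr_ge0 e0 D0; lra.
Qed.

Lemma qwt_gt0 x : 0 < qwt x. Proof. exact: lt_le_trans (qwt_ge1 x). Qed.

Lemma qwt_proj y : qwt (projX y) ^+ 2 <= (1 + 2 * h) * qwt y ^+ 2.
Proof.
rewrite !qwt_sqr; have y0 := enorm_ge0 y.
have hp : enorm (projX y) ^+ 2 <= (enorm y + delta) ^+ 2.
  by rewrite lerXn2r ?nnegrE ?enorm_ge0 ?addr_ge0 ?(ltW delta0)// (projX_norm d0 delta0 HX).
have e : delta = h * (delta / h) by rewrite mulrC divfK// gt_eqF.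
set e' := delta / h in e *; rewrite [in X in _ <= X]e in hp.
have p1 : h * (2 * enorm y * e') <= h * (enorm y ^+ 2 + e' ^+ 2).
  by rewrite ler_wpM2l//; have := sqr_ge0 (enorm y - e'); lra.
have p2 : h * (h * e' ^+ 2) <= h * (1 * e' ^+ 2).
  by rewrite ler_wpM2l// ler_wpM2r ?sqr_ge0.
have p3 := mulr_ge0 hge0 (sqr_ge0 (enorm y)).
have p4 := mulr_ge0 hge0 (sqr_ge0 e').
have := hge0; lra.
Qed.

(** * Growth of the moments of the quantized chain in one step *)

Section one_step.
Variables (j : 'I_q) (x : 'cV[R]_d).

Let a := x + h *: drift D j x.
Let A := vol D j x.
Let s := qwt x.
Let s0 : 0 <= s := qwt_ge0 x.
Let s1 : 1 <= s := qwt_ge1 x.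
Let Cs0 : 0 <= C * s. Proof. exact: mulr_ge0. Qed.

Let drift_s : enorm (drift D j x) <= C * s.
Proof. by rewrite (le_trans (reg_drift_growth HD j x))// ler_wpM2l// qwt_wgt. Qed.

Let vol_s v : enorm (A *m v) <= C * s * enorm v.
Proof.
rewrite (le_trans (reg_vol_growth HD j x v))// ler_wpM2r ?enorm_ge0//.
by rewrite ler_wpM2l// qwt_wgt.
Qed.

Let a_s : enorm a <= (1 + C) * s.
Proof.
rewrite (le_trans (enormD _ _))// mulrDl mul1r lerD ?qwt_enorm// enormZ ger0_norm//.
by rewrite (le_trans _ drift_s)// ler_piMl// enorm_ge0.
Qed.

Let a_sqr : enorm a ^+ 2 <= enorm x ^+ 2 + h * ((2 * C + C ^+ 2) * s ^+ 2).
Proof.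
apply: (le_trans (enorm_drift_sqr x hge0 h1 drift_s)); rewrite lerD2l ler_wpM2l//.
have : enorm x * (C * s) <= s * (C * s) by rewrite ler_wpM2r// qwt_enorm.
slra.
Qed.

Definition k3 := 2 * C + C ^+ 2.

Definition zeta o := 2 * Num.sqrt h * dotv a (A *m projw (theta o)) + h * enorm (A *m projw (theta o)) ^+ 2.

Lemma quant_step_sqr o : qwt (Fh j x o) ^+ 2 <= (1 + k3 * h) * s ^+ 2 + zeta o.
Proof.
rewrite qwt_sqr enorm_astep_sqr// -/a -/A /zeta.
have := a_sqr; rewrite /k3 [in X in _ -> _ <= X]mulrDl mul1r {2}/s qwt_sqr; slra.
Qed.

Let hatE o : projw (theta o) = theta o + eta o.
Proof. by rewrite addrC subrK. Qed.

Let hat2 o : enorm (projw (theta o)) ^+ 2 <= 2 * enorm (theta o) ^+ 2 + 2 * enorm (eta o) ^+ 2.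
Proof.
have h2 : enorm (projw (theta o)) <= enorm (theta o) + enorm (eta o).
  by rewrite {1}hatE enormD.
have t0 := enorm_ge0 (theta o); have e0 := enorm_ge0 (eta o).
apply: (@le_trans _ _ ((enorm (theta o) + enorm (eta o)) ^+ 2)).
  by rewrite lerXn2r ?nnegrE ?addr_ge0 ?enorm_ge0.
by have := sqr_ge0 (enorm (theta o) - enorm (eta o)); slra.
Qed.

Definition kz := (1 + C) * C + 2 * C ^+ 2 * (1 + M) + 2 * C ^+ 2.

(** The scalar product with [theta] is kept exact because its mean vanishes; only the one with the
    quantization error is estimated, by 2 sqrt h |eta| <= h + |eta|^2, and there [qerr2] enters
    without a factor h. *)
Definition zup o := 2 * Num.sqrt h * dotv a (A *m theta o)
  + (1 + C) * C * s ^+ 2 * (h + enorm (eta o) ^+ 2)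
  + 2 * h * C ^+ 2 * s ^+ 2 * (enorm (theta o) ^+ 2 + enorm (eta o) ^+ 2).

Let Ahat2 o : enorm (A *m projw (theta o)) ^+ 2 <=
  2 * C ^+ 2 * s ^+ 2 * (enorm (theta o) ^+ 2 + enorm (eta o) ^+ 2).
Proof.
apply: (@le_trans _ _ ((C * s * enorm (projw (theta o))) ^+ 2)).
  by rewrite lerXn2r ?nnegrE ?enorm_ge0 ?mulr_ge0 ?enorm_ge0.
rewrite 2!exprMn.
have := ler_wpM2l (mulr_ge0 (sqr_ge0 C) (sqr_ge0 s)) (hat2 o); slra.
Qed.


Lemma zeta_le o : zeta o <= zup o.
Proof.
have e0 := enorm_ge0 (eta o).
have hd : 2 * Num.sqrt h * dotv a (A *m eta o) <=
    (1 + C) * C * s ^+ 2 * (h + enorm (eta o) ^+ 2).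
  have b1 : dotv a (A *m eta o) <= (1 + C) * C * s ^+ 2 * enorm (eta o).
    rewrite (le_trans (dotv_le _ _))//.
    have -> : (1 + C) * C * s ^+ 2 * enorm (eta o) = ((1 + C) * s) * (C * s * enorm (eta o)) by ring.
    by rewrite ler_pM ?enorm_ge0.
  have b2 : 2 * Num.sqrt h * enorm (eta o) <= h + enorm (eta o) ^+ 2.
    by have := sqr_ge0 (Num.sqrt h - enorm (eta o)); have := sqr_sqrtr hge0; slra.
  have b3 : 0 <= 2 * Num.sqrt h by rewrite mulr_ge0// sqrtr_ge0.
  have b4 : 0 <= (1 + C) * C * s ^+ 2.
    by rewrite mulr_ge0 ?sqr_ge0// mulr_ge0// addr_ge0.
  have := ler_wpM2l b3 b1; have := ler_wpM2l b4 b2; slra.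
have ed : dotv a (A *m projw (theta o)) = dotv a (A *m theta o) + dotv a (A *m eta o).
  by rewrite -dotvDr -mulmxDr -hatE.
have := ler_wpM2l hge0 (Ahat2 o); rewrite /zeta ed /zup; slra.
Qed.

Let idot : L1 P (fun o => dotv a (A *m theta o)) := pol_lin Hth (pol_dotv Hth a A).

Let L1_zup : L1 P zup. Proof. by rewrite /zup; L1_tac. Qed.

Lemma Ex_zup : E zup <= kz * s ^+ 2 * (h + qerr2).
Proof.
have e0 := qerr2_ge0.
rewrite /zup !ExD; try L1_tac.
rewrite !ExZ; try L1_tac.
rewrite !ExD ?Ex_cst ?(Ex_dotv_mulmx Hth)//; try L1_tac.
rewrite mulr0 add0r -/qerr2.
have S0 : 0 <= 2 * C ^+ 2 * s ^+ 2 by rewrite mulr_ge0 ?sqr_ge0// mulr_ge0 ?sqr_ge0.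
have b1 : h * E (fun o => enorm (theta o) ^+ 2) <= (1 + M) * h.
  by rewrite mulrC ler_wpM2r// (noise2_le Hth).
have b2 : h * qerr2 <= qerr2 by rewrite ler_piMl.
have b3 := ler_wpM2l S0 b1; have b4 := ler_wpM2l S0 b2.
have p1 := mulr_ge0 S0 e0; have p2 := mulr_ge0 (mulr_ge0 S0 M0) e0.
have p3 := mulr_ge0 S0 hge0.
rewrite /kz; slra.
Qed.

Lemma Ex_quant_step_sqr :
  E (fun o => qwt (Fh j x o) ^+ 2) <= (1 + (k3 + kz) * (h + qerr2)) * s ^+ 2.
Proof.
apply: (@le_trans _ _ (E (fun o => (1 + k3 * h) * s ^+ 2 + zup o))).
  apply: Ex_le => [||o]; last by rewrite (le_trans (quant_step_sqr o))// lerD2l zeta_le.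
    exact: (quant_L1 Hth Hq (fun v => qwt (euler_step D h j x v) ^+ 2)).
  by apply: L1D; [exact: L1_cst|exact: L1_zup].
rewrite ExD ?Ex_cst//; last exact: L1_cst.
have k30 : 0 <= k3 by rewrite /k3 addr_ge0 ?mulr_ge0 ?sqr_ge0.
have := Ex_zup; have := mulr_ge0 (mulr_ge0 k30 qerr2_ge0) (sqr_ge0 s); slra.
Qed.

Definition k5 := 32 * ((1 + C) ^+ 2 * C ^+ 2) * (1 + M) + 16 * C ^+ 4 * (1 + M).

Let hat4 o : enorm (theta o) ^+ 2 + enorm (eta o) ^+ 2 >= 0.
Proof. by rewrite addr_ge0 ?sqr_ge0. Qed.

Lemma zeta_sqr_le o : zeta o ^+ 2 <=
  (16 * ((1 + C) ^+ 2 * C ^+ 2) * s ^+ 4 * h) * (enorm (theta o) ^+ 2 + enorm (eta o) ^+ 2)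
  + (16 * C ^+ 4 * s ^+ 4 * h) * (enorm (theta o) ^+ 4 + enorm (eta o) ^+ 4).
Proof.
set T := enorm (theta o) ^+ 2 + enorm (eta o) ^+ 2.
have T0 : 0 <= T by exact: hat4.
have b1 : dotv a (A *m projw (theta o)) ^+ 2 <= ((1 + C) * s) ^+ 2 * (2 * C ^+ 2 * s ^+ 2 * T).
  rewrite -real_normK ?num_real//.
  apply: (@le_trans _ _ ((enorm a * enorm (A *m projw (theta o))) ^+ 2)).
    by rewrite lerXn2r ?nnegrE ?mulr_ge0 ?enorm_ge0// normr_dotv_le.
  rewrite exprMn ler_pM ?sqr_ge0//.
  by rewrite lerXn2r ?nnegrE ?enorm_ge0 ?mulr_ge0 ?addr_ge0.
have b2 : (enorm (A *m projw (theta o)) ^+ 2) ^+ 2 <= (2 * C ^+ 2 * s ^+ 2 * T) ^+ 2.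
  rewrite lerXn2r ?nnegrE ?sqr_ge0//.
  by rewrite mulr_ge0// mulr_ge0 ?sqr_ge0// mulr_ge0 ?sqr_ge0.
have b3 : T ^+ 2 <= 2 * (enorm (theta o) ^+ 4 + enorm (eta o) ^+ 4).
  by rewrite /T !(exprM _ 2 2); have := sqr_ge0 (enorm (theta o) ^+ 2 - enorm (eta o) ^+ 2); slra.
set T4 := _ + enorm (eta o) ^+ 4 in b3 *.
have T40 : 0 <= T4 by rewrite addr_ge0 ?exprn_even_ge0.
rewrite /zeta; set z := dotv _ _ in b1 *; set y := enorm _ ^+ 2 in b2 *.
have sh := sqr_sqrtr hge0; set sq := Num.sqrt h in sh *.
have b4 : (2 * sq * z + h * y) ^+ 2 <= 8 * h * z ^+ 2 + 2 * (h * h * y ^+ 2).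
  rewrite -[in X in _ <= 8 * X * _ + _]sh.
  by have := sqr_ge0 (2 * sq * z - h * y); slra.
apply: (le_trans b4).
have b5 : h * h * y ^+ 2 <= h * (4 * C ^+ 4 * s ^+ 4 * (2 * T4)).
  apply: (@le_trans _ _ (h * y ^+ 2)).
    by rewrite ler_wpM2r ?sqr_ge0// ler_piMl.
  rewrite ler_wpM2l// (le_trans b2)//.
  have -> : (2 * C ^+ 2 * s ^+ 2 * T) ^+ 2 = 4 * C ^+ 4 * s ^+ 4 * T ^+ 2 by ring.
  by rewrite ler_wpM2l// mulr_ge0 ?exprn_even_ge0// mulr_ge0 ?exprn_even_ge0.
have b6 := ler_wpM2l hge0 b1.
slra.
Qed.

Definition zup4 (Z : Omega -> R) o := (1 + k3 * h) ^+ 2 * s ^+ 4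
  + (2 * (1 + k3 * h) * s ^+ 2) * Z o
  + (16 * ((1 + C) ^+ 2 * C ^+ 2) * s ^+ 4 * h) * (enorm (theta o) ^+ 2 + enorm (eta o) ^+ 2)
  + (16 * C ^+ 4 * s ^+ 4 * h) * (enorm (theta o) ^+ 4 + enorm (eta o) ^+ 4).

Definition k6 := 2 * k3 + k3 ^+ 2 + 4 * (1 + k3) * kz + k5.

(** In the square of (1 + k3 h) s^2 + [zeta], the cross term involves only the mean of a majorant of
    [zeta], of order h + E2, while [zeta]^2 is of order h times at most fourth powers of the noise
    and of its error. *)
Lemma Ex_quant_step_pow4 :
  E (fun o => qwt (Fh j x o) ^+ 4) <= (1 + k6 * (h + qerr4 / h)) * s ^+ 4.
Proof.
have k30 : 0 <= k3 by rewrite /k3 addr_ge0 ?mulr_ge0 ?sqr_ge0.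
have kz0 : 0 <= kz.
  by rewrite /kz addr_ge0 ?addr_ge0 ?mulr_ge0 ?addr_ge0 ?sqr_ge0.
have k3h0 : 0 <= k3 * h by exact: mulr_ge0.
have e4h : 0 <= qerr4 / h by rewrite divr_ge0 ?qerr4_ge0.
have s40 : 0 <= s ^+ 4 by rewrite exprn_even_ge0.
(* An opaque majorant [Z] keeps E Z in one piece when the expectation of [zup4] is split by
   linearity. *)
have [Z [iZ zZ EZ]] : exists Z, [/\ L1 P Z, forall o, zeta o <= Z o &
    E Z <= kz * s ^+ 2 * (h + qerr2)].
  by exists zup; split; [exact: L1_zup|exact: zeta_le|exact: Ex_zup].
apply: (@le_trans _ _ (E (zup4 Z))).
  apply: Ex_le => [||o].
  - exact: (quant_L1 Hth Hq (fun v => qwt (euler_step D h j x v) ^+ 4)).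
  - by rewrite /zup4; L1_tac.
  - have b1 : (qwt (Fh j x o) ^+ 2) ^+ 2 <= ((1 + k3 * h) * s ^+ 2 + zeta o) ^+ 2.
      rewrite lerXn2r ?nnegrE ?sqr_ge0//; last exact: quant_step_sqr.
      by rewrite (le_trans _ (quant_step_sqr o))// sqr_ge0.
    rewrite -exprM in b1; apply: (le_trans b1).
    have b2 := zeta_sqr_le o.
    have p : 0 <= 2 * (1 + k3 * h) * s ^+ 2.
      by rewrite mulr_ge0 ?sqr_ge0// mulr_ge0// addr_ge0.
    have := ler_wpM2l p (zZ o); rewrite /zup4; slra.
rewrite /zup4 !ExD; try L1_tac.
rewrite Ex_cst !ExZ; try L1_tac.
rewrite !ExD; try L1_tac.
rewrite -/qerr2 -/qerr4.
have H2 := qerr2_le4; set H4 := h + qerr4 / h in H2 *.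
have hH : h <= H4 by rewrite lerDl.
have H40 : 0 <= H4 := le_trans hge0 hH.
have b1 : (1 + k3 * h) ^+ 2 <= 1 + (2 * k3 + k3 ^+ 2) * H4.
  have : (2 * k3 + k3 ^+ 2) * h <= (2 * k3 + k3 ^+ 2) * H4.
    by rewrite ler_wpM2l// addr_ge0 ?mulr_ge0 ?sqr_ge0.
  have : k3 ^+ 2 * (h * h) <= k3 ^+ 2 * h by rewrite ler_wpM2l ?sqr_ge0// ler_piMl.
  slra.
have b2 : E Z <= 2 * kz * s ^+ 2 * H4.
  rewrite (le_trans EZ)//.
  have : kz * s ^+ 2 * (h + qerr2) <= kz * s ^+ 2 * (H4 + H4).
    by rewrite ler_wpM2l ?mulr_ge0 ?sqr_ge0// lerD.
  slra.
have b3 : 2 * (1 + k3 * h) * s ^+ 2 * E Z <= 4 * (1 + k3) * kz * s ^+ 4 * H4.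
  apply: (@le_trans _ _ (2 * (1 + k3 * h) * s ^+ 2 * (2 * kz * s ^+ 2 * H4))).
    by rewrite ler_wpM2l// mulr_ge0 ?sqr_ge0// mulr_ge0// addr_ge0.
  have : k3 * h <= k3 by rewrite ler_piMr.
  have p : 0 <= 4 * kz * s ^+ 4 * H4.
    by rewrite mulr_ge0// mulr_ge0// mulr_ge0.
  move=> /(ler_wpM2l p); slra.
have b4 : h * (E (fun o => enorm (theta o) ^+ 2) + qerr2) <= 2 * (1 + M) * H4.
  have t2 := ler_wpM2l hge0 (noise2_le Hth).
  have : h * qerr2 <= qerr2 by rewrite ler_piMl// qerr2_ge0.
  have : (1 + M) * h <= (1 + M) * H4 by rewrite ler_wpM2l// addr_ge0.
  have := mulr_ge0 M0 (le_trans hge0 hH); slra.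
have b5 : h * (E (fun o => enorm (theta o) ^+ 4) + qerr4) <= (1 + M) * H4.
  have t4 := ler_wpM2l hge0 (noise_le Hth).
  have : h * qerr4 <= qerr4 / h.
    rewrite ler_pdivlMr// -mulrA mulrCA ler_piMr ?qerr4_ge0//.
    by rewrite mulr_ile1.
  have : M * h <= M * H4 by rewrite ler_wpM2l.
  rewrite /H4; slra.
have q1 : 0 <= 16 * ((1 + C) ^+ 2 * C ^+ 2) * s ^+ 4.
  by rewrite mulr_ge0// mulr_ge0// mulr_ge0 ?sqr_ge0.
have q2 : 0 <= 16 * C ^+ 4 * s ^+ 4 by rewrite mulr_ge0// mulr_ge0// exprn_even_ge0.
have := ler_wpM2l q1 b4; have := ler_wpM2l q2 b5.
have := ler_wpM2r s40 b1.
rewrite /k6 /k5; slra.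
Qed.

(** The projection multiplies the bound for the step by 1 + 2h: this contributes 2 and, as h <= 1,
    turns k3 + kz into 3 (k3 + kz). *)
Definition k7 := 2 + 3 * (k3 + kz).

Let k3z0 : 0 <= k3 + kz.
Proof.
by rewrite /k3 /kz addr_ge0 ?addr_ge0 ?mulr_ge0 ?addr_ge0 ?sqr_ge0.
Qed.

Local Notation Y o := (projX (Fh j x o)).

Let L1Y (phi : 'cV[R]_d -> R) : L1 P (fun o => phi (Y o)).
Proof. exact: (quant_L1 Hth Hq (fun v => phi (projX (euler_step D h j x v)))). Qed.

Lemma Ex_chain2 : E (fun o => qwt (Y o) ^+ 2) <= (1 + k7 * (h + qerr2)) * s ^+ 2.
Proof.
have e0 := qerr2_ge0.
have iF : L1 P (fun o => qwt (Fh j x o) ^+ 2).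
  exact: (quant_L1 Hth Hq (fun v => qwt (euler_step D h j x v) ^+ 2)).
apply: (@le_trans _ _ (E (fun o => (1 + 2 * h) * qwt (Fh j x o) ^+ 2))).
  apply: Ex_le => [||o]; [exact: (L1Y (fun y => qwt y ^+ 2))|exact: L1Z|exact: qwt_proj].
rewrite ExZ//; apply: (@le_trans _ _ ((1 + 2 * h) * ((1 + (k3 + kz) * (h + qerr2)) * s ^+ 2))).
  by rewrite ler_wpM2l ?Ex_quant_step_sqr// addr_ge0// mulr_ge0.
rewrite mulrA ler_wpM2r ?sqr_ge0//.
have : h * ((k3 + kz) * (h + qerr2)) <= (k3 + kz) * (h + qerr2).
  by rewrite ler_piMl// mulr_ge0// addr_ge0.
rewrite /k7; slra.
Qed.

(** Here (1 + 2h)^2 <= 1 + 8h gives 8 and 9 k6; the term 2 k7 makes the same rate cover second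
    moments, through E2 <= h + E4 / h. *)
Definition k8 := 8 + 9 * k6 + 2 * k7.

Lemma k8_ge0 : 0 <= k8.
Proof.
rewrite /k8 /k7 /k6 /k5 /k3 /kz.
by rewrite !addr_ge0 ?mulr_ge0 ?addr_ge0 ?mulr_ge0 ?addr_ge0 ?sqr_ge0 ?mulr_ge0 ?sqr_ge0
  ?addr_ge0 ?mulr_ge0 ?sqr_ge0 ?exprn_even_ge0.
Qed.

Lemma Ex_chain4 : E (fun o => qwt (Y o) ^+ 4) <= (1 + k8 * (h + qerr4 / h)) * s ^+ 4.
Proof.
have e4h : 0 <= qerr4 / h by rewrite divr_ge0 ?qerr4_ge0.
have k60 : 0 <= k6.
  rewrite /k6 /k5 /k3 /kz.
  by rewrite !addr_ge0 ?mulr_ge0 ?addr_ge0 ?mulr_ge0 ?addr_ge0 ?sqr_ge0 ?mulr_ge0 ?sqr_ge0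
    ?addr_ge0 ?mulr_ge0 ?sqr_ge0 ?exprn_even_ge0.
have iF : L1 P (fun o => qwt (Fh j x o) ^+ 4).
  exact: (quant_L1 Hth Hq (fun v => qwt (euler_step D h j x v) ^+ 4)).
apply: (@le_trans _ _ (E (fun o => (1 + 8 * h) * qwt (Fh j x o) ^+ 4))).
  apply: Ex_le => [||o]; [exact: (L1Y (fun y => qwt y ^+ 4))|exact: L1Z|].
  have hh : h * h <= h by rewrite ler_piMl.
  apply: (@le_trans _ _ (((1 + 2 * h) * qwt (Fh j x o) ^+ 2) ^+ 2)).
    rewrite (exprM _ 2 2) lerXn2r ?nnegrE ?sqr_ge0 ?qwt_proj//.
    by rewrite mulr_ge0 ?sqr_ge0// addr_ge0// mulr_ge0.
  rewrite exprMn -exprM ler_wpM2r ?exprn_even_ge0//; slra.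
rewrite ExZ//; apply: (@le_trans _ _ ((1 + 8 * h) * ((1 + k6 * (h + qerr4 / h)) * s ^+ 4))).
  by rewrite ler_wpM2l ?Ex_quant_step_pow4// addr_ge0// mulr_ge0.
rewrite mulrA ler_wpM2r ?exprn_even_ge0//.
have H40 : 0 <= h + qerr4 / h by rewrite addr_ge0.
have : h * (k6 * (h + qerr4 / h)) <= k6 * (h + qerr4 / h).
  by rewrite ler_piMl// mulr_ge0.
have : 0 <= 2 * k7 * (h + qerr4 / h) by rewrite mulr_ge0// mulr_ge0// addr_ge0// mulr_ge0.
rewrite /k8; slra.
Qed.

Lemma Ex_chain2' : E (fun o => qwt (Y o) ^+ 2) <= (1 + k8 * (h + qerr4 / h)) * s ^+ 2.
Proof.
have e4h : 0 <= qerr4 / h by rewrite divr_ge0 ?qerr4_ge0.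
have k60 : 0 <= k6.
  rewrite /k6 /k5 /k3 /kz.
  by rewrite !addr_ge0 ?mulr_ge0 ?addr_ge0 ?mulr_ge0 ?addr_ge0 ?sqr_ge0 ?mulr_ge0 ?sqr_ge0
    ?addr_ge0 ?mulr_ge0 ?sqr_ge0 ?exprn_even_ge0.
have k70 : 0 <= k7 by rewrite /k7 addr_ge0// mulr_ge0.
apply: (le_trans Ex_chain2); rewrite ler_wpM2r ?sqr_ge0// lerD2l.
have H40 : 0 <= h + qerr4 / h by rewrite addr_ge0.
apply: (@le_trans _ _ (k7 * (2 * (h + qerr4 / h)))).
  by rewrite ler_wpM2l//; have := qerr2_le4; slra.
have := mulr_ge0 k60 H40; rewrite /k8; slra.
Qed.

Lemma Ex_chain1 : E (fun o => qwt (Y o)) <= (1 + k7 * (h + qerr2)) * s.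
Proof.
have sp : 0 < s := qwt_gt0 x.
have i2 := L1Y (fun y => qwt y ^+ 2).
apply: (@le_trans _ _ (E (fun o => (2 * s)^-1 * (qwt (Y o) ^+ 2 + s ^+ 2)))).
  apply: Ex_le => [||o]; [exact: L1Y|L1_tac|].
  rewrite mulrC ler_pdivlMr ?mulr_gt0//.
  by have := sqr_ge0 (qwt (Y o) - s); slra.
rewrite ExZ; last L1_tac.
rewrite ExD ?Ex_cst; try L1_tac.
rewrite mulrC ler_pdivrMr ?mulr_gt0//.
have : 0 <= k7 * (h + qerr2) * s ^+ 2.
  by rewrite mulr_ge0 ?sqr_ge0// mulr_ge0 ?(addr_ge0 hge0 qerr2_ge0)// addr_ge0// mulr_ge0.
have := Ex_chain2; slra.
Qed.

(** Interpolation 4 s t^3 <= 3 t^4 + s^4 from the fourth moment, with equality at t = s; the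
    difference is (t - s)^2 ((t + s)^2 + 2 t^2). *)
Lemma Ex_chain3 : E (fun o => qwt (Y o) ^+ 3) <= (1 + k8 * (h + qerr4 / h)) * s ^+ 3.
Proof.
have sp : 0 < s := qwt_gt0 x.
have e4h : 0 <= qerr4 / h by rewrite divr_ge0 ?qerr4_ge0.
have i4 := L1Y (fun y => qwt y ^+ 4).
apply: (@le_trans _ _ (E (fun o => (4 * s)^-1 * (3 * qwt (Y o) ^+ 4 + s ^+ 4)))).
  apply: Ex_le => [||o]; [exact: (L1Y (fun y => qwt y ^+ 3))|L1_tac|].
  rewrite mulrC ler_pdivlMr ?mulr_gt0//.
  set t := qwt (Y o); have : 0 <= (t - s) ^+ 2 * ((t + s) ^+ 2 + 2 * t ^+ 2).
    by rewrite mulr_ge0 ?sqr_ge0// addr_ge0 ?sqr_ge0// mulr_ge0 ?sqr_ge0.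
  slra.
rewrite ExZ; last L1_tac.
rewrite ExD ?Ex_cst ?ExZ; try L1_tac.
rewrite mulrC ler_pdivrMr ?mulr_gt0//.
have : 0 <= k8 * (h + qerr4 / h) * s ^+ 4.
  by rewrite mulr_ge0 ?exprn_even_ge0// mulr_ge0 ?k8_ge0 ?(addr_ge0 hge0 e4h).
have := Ex_chain4; slra.
Qed.

End one_step.

(** * Local errors and their accumulation along the chain *)

Local Notation Y j x o := (projX (Fh j x o)).
Local Notation V := (dpv P theta D h).
Local Notation qw := qwt.
Local Notation vhat := (quant_value D h projX w (quant_weight P theta w projw)).

Lemma quant_valueS n i x : vhat n.+1 i x =
  let U j := E (fun o => vhat n j (Y j x o)) + running D j x * h - cost D i j x in
  \big[Num.max/U i]_(j < q) U j.
Proof.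
rewrite /=.
have e j : \sum_(l < N) quant_weight P theta w projw l * vhat n j (projX (euler_step D h j x (w l)))
    = E (fun o => vhat n j (Y j x o)).
  exact: (quant_weight_sum P Hq (fun v => vhat n j (projX (euler_step D h j x v)))).
by rewrite e; apply: eq_bigr => j _; rewrite e.
Qed.

Let L1Y (phi : 'cV[R]_d -> R) j x : L1 P (fun o => phi (Y j x o)).
Proof. exact: (quant_L1 Hth Hq (fun v => phi (projX (euler_step D h j x v)))). Qed.

(** [V] is inserted at the point reached by the quantized chain: the local error then involves the
    regularity of [V] alone, and the difference of the two values is carried by the chain. *)
Lemma quant_recursion (nmax : nat) (B : nat -> 'cV[R]_d -> R) :
  (forall x, 0 <= B 0%N x) ->
  (forall n j x, (n < nmax)%N ->
    E (fun o => `|V n j (F j x o) - V n j (Y j x o)|) + E (fun o => B n (Y j x o))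
    <= B n.+1 x) ->
  forall n i x, (n <= nmax)%N -> `|V n i x - vhat n i x| <= B n x.
Proof.
move=> B0 BS; elim=> [|n ih] i x hn; first by rewrite subrr normr0.
rewrite quant_valueS; apply: bigmax_dist => j.
rewrite (_ : _ - _ = E (fun o => V n j (F j x o)) - E (fun o => vhat n j (Y j x o))); last by ring.
have i1 := L1_dpv Hth HD hge0 h1 n j j x; have i2 := L1Y (V n j) j x.
have i3 := L1Y (vhat n j) j x.
rewrite -ExB//; apply: (le_trans (Ex_abs (L1B i1 i3))); apply: le_trans (BS n j x hn).
have i4 := L1_norm (L1B i1 i2); have i5 := L1Y (B n) j x.
rewrite -ExD//; apply: Ex_le => [||o]; [exact: L1_norm (L1B i1 i3)|L1_tac|].
have := ih j (Y j x o) (ltnW hn).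
have := ler_normD (V n j (F j x o) - V n j (Y j x o)) (V n j (Y j x o) - vhat n j (Y j x o)).
by rewrite addrA subrK; lra.
Qed.

(** A random factor common to the exact and the quantized step, both of norm at most (1 + C) qwt(x)
    [amp]. *)
Definition amp o := 1 + enorm (theta o) + Num.sqrt h * enorm (eta o).

Let sh0 : 0 <= Num.sqrt h := sqrtr_ge0 h.
Let sh1 : Num.sqrt h <= 1. Proof. by rewrite -sqrtr1 ler_wsqrtr. Qed.

Lemma amp_ge1 o : 1 <= amp o.
Proof. by rewrite /amp -addrA lerDl addr_ge0 ?mulr_ge0 ?enorm_ge0. Qed.

Let amp_ge0 o : 0 <= amp o. Proof. exact: le_trans (amp_ge1 o). Qed.

Lemma pol_amp : pol 1 amp.
Proof.
exact: (pgrowD N1 (pgrowD N1 (pgrow_cst _ 1) pt) (pgrowM (pgrow_cst _ (Num.sqrt h)) pe)).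
Qed.

Section one_step.
Variables (j : 'I_q) (x : 'cV[R]_d).
Let s := qw x.
Let s0 : 0 <= s := qwt_ge0 x.
Let s1 : 1 <= s := qwt_ge1 x.
Let Cs0 : 0 <= C * s. Proof. exact: mulr_ge0. Qed.

Let drift_s : enorm (x + h *: drift D j x) <= (1 + C) * s.
Proof.
rewrite (le_trans (enormD _ _))// mulrDl mul1r lerD ?qwt_enorm// enormZ ger0_norm//.
have : enorm (drift D j x) <= C * s.
  by rewrite (le_trans (reg_drift_growth HD j x))// ler_wpM2l// qwt_wgt.
by move=> hd; rewrite (le_trans _ hd)// ler_piMl// enorm_ge0.
Qed.

Let vol_s v : enorm (vol D j x *m v) <= C * s * enorm v.
Proof.
rewrite (le_trans (reg_vol_growth HD j x v))// ler_wpM2r ?enorm_ge0//.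
by rewrite ler_wpM2l// qwt_wgt.
Qed.

Lemma enorm_step_le v : enorm (euler_step D h j x v) <=
  (1 + C) * s + Num.sqrt h * (C * s * enorm v).
Proof.
rewrite (le_trans (enormD _ _))// lerD ?drift_s// enormZ ger0_norm//.
by rewrite ler_wpM2l.
Qed.

Lemma enorm_F_le o : enorm (F j x o) <= (1 + C) * s * amp o.
Proof.
rewrite (le_trans (enorm_step_le _))// /amp.
have t0 := enorm_ge0 (theta o); have e0 := enorm_ge0 (eta o).
have a1 : Num.sqrt h * (C * s * enorm (theta o)) <= C * s * enorm (theta o).
  by rewrite ler_piMl// mulr_ge0.
have a2 : 0 <= s * enorm (theta o) by rewrite mulr_ge0.
have a3 : 0 <= (1 + C) * s * (Num.sqrt h * enorm (eta o)).
  by rewrite mulr_ge0 ?mulr_ge0// addr_ge0.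
lra.
Qed.

Lemma enorm_Fh_le o : enorm (Fh j x o) <= (1 + C) * s * amp o.
Proof.
rewrite (le_trans (enorm_step_le _))// /amp.
have t0 := enorm_ge0 (theta o); have e0 := enorm_ge0 (eta o).
have a1 : Num.sqrt h * (C * s * enorm (theta o)) <= C * s * enorm (theta o).
  by rewrite ler_piMl// mulr_ge0.
have a2 : 0 <= s * enorm (theta o) by rewrite mulr_ge0.
have a3 : 0 <= s * (Num.sqrt h * enorm (eta o)) by rewrite !mulr_ge0.
have a4 : enorm (projw (theta o)) <= enorm (theta o) + enorm (eta o).
  by rewrite -{1}(subrK (theta o) (projw (theta o))) addrC enormD.
have := ler_wpM2l (mulr_ge0 sh0 Cs0) a4; lra.
Qed.

(** Three sources of error: the quantization of the noise, the mesh of the grid and the truncation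
    of space. *)
Lemma dist_FY o : enorm (F j x o - Y j x o) <=
  Num.sqrt h * (C * s) * enorm (eta o) + delta + (1 + C) ^+ 2 * s ^+ 2 / Rad * amp o ^+ 2.
Proof.
have -> : F j x o - Y j x o = (F j x o - Fh j x o) + (Fh j x o - Y j x o).
  by rewrite addrA subrK.
rewrite (le_trans (enormD _ _))//.
have a1 : enorm (F j x o - Fh j x o) <= Num.sqrt h * (C * s) * enorm (eta o).
  rewrite (_ : _ - _ = - (Num.sqrt h *: (vol D j x *m eta o))); last first.
    by rewrite mulmxBr scalerBr /euler_step; apply/colP => i; rewrite !mxE; lra.
  by rewrite enormN enormZ ger0_norm// -mulrA ler_wpM2l.
have a2 := projX_dist d0 delta0 Rad0 HX (Fh j x o).
have a3 : enorm (Fh j x o) ^+ 2 / Rad <= (1 + C) ^+ 2 * s ^+ 2 / Rad * amp o ^+ 2.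
  rewrite [leRHS]mulrAC ler_wpM2r ?invr_ge0 ?(ltW Rad0)// -!exprMn.
  by rewrite lerXn2r ?nnegrE ?enorm_ge0 ?enorm_Fh_le// !mulr_ge0// addr_ge0.
lra.
Qed.

Lemma wgt_FY o : wgt (F j x o) + wgt (Y j x o) <= (5 + 2 * C) * s * amp o.
Proof.
have a1 := wgt_le (F j x o); have a2 := wgt_le (Y j x o).
have a3 := projX_norm d0 delta0 HX (Fh j x o).
have a4 := enorm_F_le o; have a5 := enorm_Fh_le o.
have a6 : delta <= s.
  by rewrite (le_trans (qwt_delta x))// ler_piMl.
have a7 : s <= s * amp o by rewrite ler_peMr ?amp_ge1.
have := s1; lra.
Qed.

End one_step.

Local Notation E2 := qerr2.
Local Notation E4 := qerr4.
Local Notation e2 := (Num.sqrt E2).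

Let E20 : 0 <= E2 := qerr2_ge0.
Let E40 : 0 <= E4 := qerr4_ge0.

(** Exponentials as convenient majorants of 1 + E2 here and of 1 + E4 in [zfac]: in the end they
    merge with those produced by the powers of [rq2] and [rq4]. *)
Definition xfac := expR (E2 / h).
Definition zfac := expR (E4 / h ^+ 2).
(** 64 = 8 * 8 arises from two uses of (a + b)^4 <= 8 a^4 + 8 b^4; 73 is generous enough for all the
    moments of [amp] at once. *)
Definition camp := 73 + 64 * M.

Lemma xfac_ge : 1 + E2 / h <= xfac. Proof. exact: expR_ge1Dx. Qed.

Lemma xfac_ge2 : 1 + E2 <= xfac.
Proof.
apply: le_trans xfac_ge; rewrite lerD2l ler_pdivlMr//.
by rewrite ler_piMr.
Qed.

Lemma xfac_ge1 : 1 <= xfac. Proof. by apply: le_trans xfac_ge2; rewrite lerDl. Qed.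

Lemma zfac_ge : 1 + E4 <= zfac.
Proof.
apply: le_trans (expR_ge1Dx _); rewrite lerD2l ler_pdivlMr ?exprn_gt0//.
by rewrite ler_piMr// exprn_ile1.
Qed.

Lemma zfac_ge1 : 1 <= zfac. Proof. by apply: le_trans zfac_ge; rewrite lerDl. Qed.

Let ie1 : L1 P (fun o => enorm (eta o)) := pol_lin Hth pe.
Let it1 : L1 P (fun o => enorm (theta o)) := pol_lin Hth pt.
Let ite : L1 P (fun o => enorm (theta o) * enorm (eta o)) := pol_mul Hth pt pe.
Let ia1 : L1 P amp := pol_lin Hth pol_amp.
Let ia3 : L1 P (fun o => amp o ^+ 3).
Proof. exact: (pol_L1 Hth _ (pgrowX N1 3 pol_amp)). Qed.
Let ia2 : L1 P (fun o => amp o ^+ 2) := pol_sqr Hth pol_amp.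
Let iae : L1 P (fun o => amp o * enorm (eta o)) := pol_mul Hth pol_amp pe.

Lemma Ex_eta : E (fun o => enorm (eta o)) <= e2.
Proof.
have i1 : L1 P (fun o : Omega => (1 : R) ^+ 2) by exact: L1_cst.
have i2 : L1 P (fun o : Omega => 1 * enorm (eta o)) by exact: L1Z.
have := Ex_CauchySchwarz i1 ie2 i2; rewrite ExZ// mul1r Ex_cst expr1n sqrtr1 mul1r.
by [].
Qed.

Lemma sqrtE2 : e2 ^+ 2 = E2. Proof. by rewrite sqr_sqrtr. Qed.

Lemma Ex_amp_eta : E (fun o => amp o * enorm (eta o)) <= camp * (e2 * xfac).
Proof.
have e20 : 0 <= e2 := sqrtr_ge0 _.
have b1 : E (fun o => enorm (theta o) * enorm (eta o)) <= (2 + M) * e2.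
  apply: (le_trans (Ex_CauchySchwarz it2 ie2 ite)); rewrite ler_wpM2r//.
  have t := noise2_le Hth; have m : 0 <= 2 + M by slra.
  rewrite -(@ler_pXn2r _ 2) ?nnegrE ?sqrtr_ge0// sqr_sqrtr; last first.
    by apply: Ex_ge0 => o; rewrite sqr_ge0.
  apply: (le_trans t); have := sqr_ge0 M; slra.
under eq_Ex do rewrite /amp !mulrDl mul1r -mulrA -expr2.
have iz : L1 P (fun o => Num.sqrt h * enorm (eta o) ^+ 2) by exact: L1Z.
rewrite !ExD ?ExZ//; try L1_tac.
rewrite -/qerr2 -[X in Num.sqrt h * X]sqrtE2.
have b2 := Ex_eta.
have b3 : Num.sqrt h * e2 <= xfac.
  apply: le_trans xfac_ge2; apply: (@le_trans _ _ e2); first by rewrite ler_piMl.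
  by have := sqr_ge0 (e2 - 1); rewrite -{3}sqrtE2; have := sqr_ge0 e2; lra.
have b4 := ler_wpM2r e20 b3.
have b5 : e2 <= e2 * xfac by rewrite ler_peMr// xfac_ge1.
have b6 : M * e2 <= M * (e2 * xfac) by rewrite ler_wpM2l.
have b7 : 0 <= M * (e2 * xfac) by rewrite (le_trans _ b6)// mulr_ge0.
rewrite /camp; lra.
Qed.

Lemma Ex_amp : E amp <= camp * xfac.
Proof.
rewrite /amp !ExD ?ExZ ?Ex_cst//; try L1_tac.
have b1 : E (fun o => enorm (theta o)) <= 2 + M.
  apply: (@le_trans _ _ (E (fun o => 1 + enorm (theta o) ^+ 2))).
    apply: Ex_le => [||o]; [exact: it1|L1_tac|].
    by have := sqr_ge0 (enorm (theta o) - 1); have := sqr_ge0 (enorm (theta o)); lra.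
  by rewrite ExD ?Ex_cst; [have := noise2_le Hth; lra|L1_tac|exact: it2].
have b2 : E (fun o => enorm (eta o)) <= 1 + E2.
  apply: (@le_trans _ _ (E (fun o => 1 + enorm (eta o) ^+ 2))).
    apply: Ex_le => [||o]; [exact: ie1|L1_tac|].
    by have := sqr_ge0 (enorm (eta o) - 1); have := sqr_ge0 (enorm (eta o)); lra.
  by rewrite ExD ?Ex_cst//; L1_tac.
have b3 : Num.sqrt h * E (fun o => enorm (eta o)) <= 1 + E2.
  rewrite (le_trans _ b2)// ler_piMl//.
  by apply: Ex_ge0 => o; rewrite enorm_ge0.
have x1 := xfac_ge1; have x2 := xfac_ge2.
have b4 : M <= M * xfac by rewrite ler_peMr.
have := E20; rewrite /camp; slra.
Qed.

Lemma Ex_amp3 : E (fun o => amp o ^+ 3) <= camp * zfac.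
Proof.
apply: (@le_trans _ _ (E (fun o => 8 + 64 * enorm (theta o) ^+ 4 + 64 * enorm (eta o) ^+ 4))).
  apply: Ex_le => [||o]; [exact: ia3|L1_tac|].
  have t0 := enorm_ge0 (theta o); have e0 := enorm_ge0 (eta o).
  have se0 : 0 <= Num.sqrt h * enorm (eta o) by rewrite mulr_ge0.
  apply: (@le_trans _ _ (amp o ^+ 4)); first by rewrite ler_weXn2l// amp_ge1.
  rewrite /amp -addrA (le_trans (pow4D_le (addr_ge0 t0 se0)))//.
  have b1 : (enorm (theta o) + Num.sqrt h * enorm (eta o)) ^+ 4 <=
      8 * enorm (theta o) ^+ 4 + 8 * (Num.sqrt h * enorm (eta o)) ^+ 4.
    set a := enorm (theta o); set b := Num.sqrt h * _.
    have c1 : (a + b) ^+ 2 <= 2 * a ^+ 2 + 2 * b ^+ 2 by have := sqr_ge0 (a - b); lra.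
    have c2 : ((a + b) ^+ 2) ^+ 2 <= (2 * a ^+ 2 + 2 * b ^+ 2) ^+ 2.
      by rewrite lerXn2r ?nnegrE ?sqr_ge0// addr_ge0// mulr_ge0 ?sqr_ge0.
    have := sqr_ge0 (a ^+ 2 - b ^+ 2); rewrite !(exprM _ 2 2); lra.
  have b2 : (Num.sqrt h * enorm (eta o)) ^+ 4 <= enorm (eta o) ^+ 4.
    by rewrite lerXn2r ?nnegrE// ler_piMl.
  lra.
rewrite !ExD ?ExZ ?Ex_cst//; try L1_tac.
rewrite -/qerr4.
have b1 := noise_le Hth; have z1 := zfac_ge1; have z2 := zfac_ge.
have b4 : M <= M * zfac by rewrite ler_peMr.
rewrite /camp; slra.
Qed.

Lemma Ex_amp2 : E (fun o => amp o ^+ 2) <= camp * zfac.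
Proof.
apply: le_trans Ex_amp3; apply: Ex_le => // o.
by rewrite ler_weXn2l// amp_ge1.
Qed.

Definition k9 := (5 + 2 * C) * (1 + C) ^+ 2 * camp.

Let camp0 : 1 <= camp. Proof. by rewrite /camp; slra. Qed.

Lemma k9_ge0 : 0 <= k9.
Proof.
rewrite /k9; apply: mulr_ge0; last exact: le_trans ler01 camp0.
by rewrite mulr_ge0 ?sqr_ge0//; slra.
Qed.

(** The local Lipschitz weight adds a factor qwt(x) [amp] to [dist_FY]: the powers 1, 0, 2 of qwt(x)
    become 2, 1, 3, and the third moment of [amp] is called for. *)
Lemma local_error1 (KL : R) n j x : 0 <= KL ->
  (forall y z, `|V n j y - V n j z| <= KL * (wgt y + wgt z) * enorm (y - z)) ->
  E (fun o => `|V n j (F j x o) - V n j (Y j x o)|) <=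
  KL * k9 * (Num.sqrt h * e2 * xfac * qw x ^+ 2 + delta * xfac * qw x + zfac / Rad * qw x ^+ 3).
Proof.
move=> KL0 hV; set s := qw x.
have s0 : 0 <= s := qwt_ge0 x.
have i1 := L1_norm (L1B (L1_dpv Hth HD hge0 h1 n j j x) (L1Y (V n j) j x)).
apply: (@le_trans _ _ (E (fun o => (KL * (5 + 2 * C) * Num.sqrt h * C * s ^+ 2) * (amp o * enorm (eta o))
   + (KL * (5 + 2 * C) * s * delta) * amp o
   + (KL * (5 + 2 * C) * (1 + C) ^+ 2 * s ^+ 3 / Rad) * amp o ^+ 3))).
  apply: Ex_le => // [|o]; first by L1_tac.
  apply: (le_trans (hV _ _)).
  have b1 := wgt_FY j x o; have b2 := dist_FY j x o; rewrite -/s in b1 b2.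
  have b3 : (wgt (F j x o) + wgt (Y j x o)) * enorm (F j x o - Y j x o) <=
    ((5 + 2 * C) * s * amp o) * (Num.sqrt h * (C * s) * enorm (eta o) + delta + (1 + C) ^+ 2 * s ^+ 2 / Rad * amp o ^+ 2).
    by rewrite ler_pM ?enorm_ge0// addr_ge0 ?wgt_ge0.
  rewrite -mulrA; apply: (le_trans (ler_wpM2l KL0 b3)).
  by rewrite le_eqVlt; apply/orP; left; apply/eqP; ring.
rewrite !ExD; try L1_tac.
rewrite !ExZ//.
have KC : 0 <= KL * (5 + 2 * C) by rewrite mulr_ge0//; slra.
have CC : C <= (1 + C) ^+ 2 by have := sqr_ge0 C; slra.
have CC1 : 1 <= (1 + C) ^+ 2 by have := sqr_ge0 C; slra.
have e20 : 0 <= e2 := sqrtr_ge0 _.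
have x0 : 0 <= xfac by exact: expR_ge0.
have z0 : 0 <= zfac by exact: expR_ge0.
have c0' : 0 <= camp := le_trans ler01 camp0.
rewrite [leRHS](_ : _ =
   KL * (5 + 2 * C) * (Num.sqrt h * s ^+ 2) * (1 + C) ^+ 2 * (camp * (e2 * xfac))
   + KL * (5 + 2 * C) * (s * delta) * (1 + C) ^+ 2 * (camp * xfac)
   + KL * (5 + 2 * C) * (1 + C) ^+ 2 * s ^+ 3 / Rad * (camp * zfac)); last by rewrite /k9; ring.
have p1 : 0 <= KL * (5 + 2 * C) * (Num.sqrt h * s ^+ 2).
  by rewrite mulr_ge0// mulr_ge0// sqr_ge0.
have p2 : 0 <= KL * (5 + 2 * C) * (s * delta) by rewrite mulr_ge0// mulr_ge0// ltW.
have p3 : 0 <= KL * (5 + 2 * C) * (1 + C) ^+ 2 * s ^+ 3 / Rad.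
  by rewrite mulr_ge0 ?invr_ge0 ?(ltW Rad0)// mulr_ge0 ?exprn_ge0// mulr_ge0 ?sqr_ge0.
apply: lerD; first apply: lerD.
- rewrite (_ : KL * (5 + 2 * C) * Num.sqrt h * C * s ^+ 2 = KL * (5 + 2 * C) * (Num.sqrt h * s ^+ 2) * C); last by ring.
  apply: ler_pM; [exact: mulr_ge0| |by rewrite ler_wpM2l|exact: Ex_amp_eta].
  by apply: Ex_ge0 => o; rewrite mulr_ge0// enorm_ge0.
- rewrite (_ : KL * (5 + 2 * C) * s * delta = KL * (5 + 2 * C) * (s * delta) * 1); last by ring.
  apply: ler_pM; [by rewrite mulr_ge0|exact: Ex_ge0|by rewrite ler_wpM2l|exact: Ex_amp].
- by rewrite ler_wpM2l// Ex_amp3.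
Qed.

Lemma local_error2 (KL : R) n j x : 0 <= KL ->
  (forall y z, `|V n j y - V n j z| <= KL * enorm (y - z)) ->
  E (fun o => `|V n j (F j x o) - V n j (Y j x o)|) <=
  KL * k9 * (Num.sqrt h * e2 * qw x + delta + zfac / Rad * qw x ^+ 2).
Proof.
move=> KL0 hV; set s := qw x.
have s0 : 0 <= s := qwt_ge0 x.
have i1 := L1_norm (L1B (L1_dpv Hth HD hge0 h1 n j j x) (L1Y (V n j) j x)).
apply: (@le_trans _ _ (E (fun o => (KL * Num.sqrt h * C * s) * enorm (eta o)
   + KL * delta + (KL * (1 + C) ^+ 2 * s ^+ 2 / Rad) * amp o ^+ 2))).
  apply: Ex_le => // [|o]; first by L1_tac.
  apply: (le_trans (hV _ _)).
  have b2 := dist_FY j x o; rewrite -/s in b2.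
  apply: (le_trans (ler_wpM2l KL0 b2)).
  by rewrite le_eqVlt; apply/orP; left; apply/eqP; ring.
rewrite !ExD; try L1_tac.
rewrite Ex_cst !ExZ//.
have CC : C <= (1 + C) ^+ 2 by have := sqr_ge0 C; slra.
have CC1 : 1 <= (1 + C) ^+ 2 by have := sqr_ge0 C; slra.
have CC2 : 1 <= 5 + 2 * C by slra.
have e20 : 0 <= e2 := sqrtr_ge0 _.
have z0 : 0 <= zfac by exact: expR_ge0.
have c0' : 0 <= camp := le_trans ler01 camp0.
have kk : (1 + C) ^+ 2 * camp <= k9.
  rewrite /k9 -mulrA ler_peMl// mulr_ge0//; exact: sqr_ge0.
have kk0 : 0 <= k9 by rewrite (le_trans _ kk)// mulr_ge0// sqr_ge0.
have k1 : 1 <= k9 by apply: le_trans kk; apply: (le_trans CC1); rewrite ler_peMr// sqr_ge0.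
have kC : C <= k9 by apply: le_trans kk; apply: (le_trans CC); rewrite ler_peMr// sqr_ge0.
rewrite [leRHS](_ : _ =
   (KL * (Num.sqrt h * s)) * k9 * e2 + (KL * delta) * k9
   + (KL * s ^+ 2 / Rad) * (k9 * zfac)); last by ring.
have p1 : 0 <= KL * (Num.sqrt h * s) by rewrite !mulr_ge0.
have p2 : 0 <= KL * delta by rewrite mulr_ge0// ltW.
have p3 : 0 <= KL * s ^+ 2 / Rad.
  by rewrite mulr_ge0 ?invr_ge0 ?(ltW Rad0)// mulr_ge0 ?sqr_ge0.
apply: lerD; first apply: lerD.
- rewrite (_ : KL * Num.sqrt h * C * s = KL * (Num.sqrt h * s) * C); last by ring.
  apply: ler_pM; [exact: mulr_ge0| |by rewrite ler_wpM2l|exact: Ex_eta].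
  by apply: Ex_ge0 => o; rewrite enorm_ge0.
- by rewrite ler_peMr.
- rewrite (_ : KL * (1 + C) ^+ 2 * s ^+ 2 / Rad * E (fun o => amp o ^+ 2) =
    KL * s ^+ 2 / Rad * ((1 + C) ^+ 2 * E (fun o => amp o ^+ 2))); last by ring.
  rewrite ler_wpM2l//.
  apply: (@le_trans _ _ ((1 + C) ^+ 2 * (camp * zfac))).
    by rewrite ler_wpM2l ?sqr_ge0// Ex_amp2.
  by rewrite mulrA ler_wpM2r.
Qed.

Definition rq2 := 1 + k7 * (h + E2).
Definition rq4 := 1 + k8 * (h + E4 / h).

Lemma rq2_ge1 : 1 <= rq2.
Proof.
rewrite lerDl mulr_ge0 ?(addr_ge0 hge0 E20)//.
rewrite /k7 /k3 /kz.
by rewrite !addr_ge0 ?mulr_ge0 ?addr_ge0 ?mulr_ge0 ?addr_ge0 ?sqr_ge0 ?mulr_ge0 ?sqr_ge0 ?addr_ge0.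
Qed.

Lemma rq4_ge1 : 1 <= rq4.
Proof.
have e4h : 0 <= E4 / h by rewrite divr_ge0.
by rewrite lerDl mulr_ge0 ?(addr_ge0 hge0 e4h)// k8_ge0.
Qed.

(** Discrete Gronwall: each step injects an error a [phi] and amplifies the earlier ones by [r];
    bounding all contributions by the largest gives n a r^n [phi], hence the factor n in the global
    bounds. *)
Let recursion_term (n : nat) (a r : R) (phi : 'cV[R]_d -> R) j x : 0 <= a -> 1 <= r ->
  (forall y, 0 <= phi y) -> E (fun o => phi (Y j x o)) <= r * phi x ->
  a * phi x + n%:R * (a * r ^+ n * E (fun o => phi (Y j x o)))
  <= n.+1%:R * (a * r ^+ n.+1 * phi x).
Proof.
move=> a0 r1 p0 hE; have rn : 1 <= r ^+ n.+1 by rewrite exprn_ege1.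
have ap : 0 <= a * phi x by rewrite mulr_ge0.
have b1 : a * phi x * 1 <= a * phi x * r ^+ n.+1 by rewrite ler_wpM2l.
have rn0 : 0 <= a * r ^+ n by rewrite mulr_ge0// exprn_ge0// (le_trans _ r1).
have b2 : n%:R * (a * r ^+ n * E (fun o => phi (Y j x o))) <= n%:R * (a * r ^+ n * (r * phi x)).
  by rewrite ler_wpM2l// ler_wpM2l.
rewrite -natr1 exprS in b1 *; lra.
Qed.

Lemma quant_error1 (nmax : nat) (KL : R) : 0 <= KL ->
  (forall n i y z, (n <= nmax)%N ->
    `|V n i y - V n i z| <= KL * (wgt y + wgt z) * enorm (y - z)) ->
  forall n i x, (n <= nmax)%N -> `|V n i x - vhat n i x| <=
  KL * k9 * (n%:R * (Num.sqrt h * e2 * xfac * rq2 ^+ n * qw x ^+ 2)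
    + n%:R * (delta * xfac * rq2 ^+ n * qw x) + n%:R * (zfac / Rad * rq4 ^+ n * qw x ^+ 3)).
Proof.
move=> KL0 hV; apply: quant_recursion => [x|n j x hn].
  by rewrite !mul0r !addr0 mulr0.
have Kk : 0 <= KL * k9 := mulr_ge0 KL0 k9_ge0.
have i1 := L1Y (fun y => qw y) j x; have i2 := L1Y (fun y => qw y ^+ 2) j x.
have i3 := L1Y (fun y => qw y ^+ 3) j x.
have -> : E (fun o => KL * k9 * (n%:R * (Num.sqrt h * e2 * xfac * rq2 ^+ n * qw (Y j x o) ^+ 2)
    + n%:R * (delta * xfac * rq2 ^+ n * qw (Y j x o)) + n%:R * (zfac / Rad * rq4 ^+ n * qw (Y j x o) ^+ 3)))
  = KL * k9 * (n%:R * (Num.sqrt h * e2 * xfac * rq2 ^+ n * E (fun o => qw (Y j x o) ^+ 2))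
    + n%:R * (delta * xfac * rq2 ^+ n * E (fun o => qw (Y j x o)))
    + n%:R * (zfac / Rad * rq4 ^+ n * E (fun o => qw (Y j x o) ^+ 3))).
  rewrite ExZ; last L1_tac.
  rewrite !ExD; try L1_tac.
  by rewrite !ExZ//; L1_tac.
have e20 : 0 <= e2 := sqrtr_ge0 _.
have x0 : 0 <= xfac by exact: expR_ge0.
have z0 : 0 <= zfac by exact: expR_ge0.
have q0 y : 0 <= qw y := qwt_ge0 y.
have t1 := @recursion_term n (Num.sqrt h * e2 * xfac) rq2 (fun y => qw y ^+ 2) j x
  (mulr_ge0 (mulr_ge0 sh0 e20) x0) rq2_ge1 (fun y => sqr_ge0 _)
  (Ex_chain2 j x).
have t2 := @recursion_term n (delta * xfac) rq2 (fun y => qw y) j x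
  (mulr_ge0 (ltW delta0) x0) rq2_ge1 q0 (Ex_chain1 j x).
have t3 := @recursion_term n (zfac / Rad) rq4 (fun y => qw y ^+ 3) j x
  (divr_ge0 z0 (ltW Rad0)) rq4_ge1 (fun y => exprn_ge0 _ (q0 y))
  (Ex_chain3 j x).
have t0 := local_error1 x KL0 (fun y z => hV n j y z (ltnW hn)).
apply: (le_trans (lerD t0 (lexx _))); rewrite -mulrDr ler_wpM2l//.
move: t1 t2 t3 => /=; lra.
Qed.

(** The mesh error does not depend on the state here, so it accumulates without amplification; this
    is why delta / h carries no exponential for constant costs. *)
Lemma quant_error2 (nmax : nat) (KL : R) : 0 <= KL ->
  (forall n i y z, (n <= nmax)%N -> `|V n i y - V n i z| <= KL * enorm (y - z)) ->
  forall n i x, (n <= nmax)%N -> `|V n i x - vhat n i x| <=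
  KL * k9 * (n%:R * (Num.sqrt h * e2 * rq2 ^+ n * qw x)
    + n%:R * delta + n%:R * (zfac / Rad * rq4 ^+ n * qw x ^+ 2)).
Proof.
move=> KL0 hV; apply: quant_recursion => [x|n j x hn].
  by rewrite !mul0r !addr0 mulr0.
have Kk : 0 <= KL * k9 := mulr_ge0 KL0 k9_ge0.
have i1 := L1Y (fun y => qw y) j x; have i2 := L1Y (fun y => qw y ^+ 2) j x.
have -> : E (fun o => KL * k9 * (n%:R * (Num.sqrt h * e2 * rq2 ^+ n * qw (Y j x o))
    + n%:R * delta + n%:R * (zfac / Rad * rq4 ^+ n * qw (Y j x o) ^+ 2)))
  = KL * k9 * (n%:R * (Num.sqrt h * e2 * rq2 ^+ n * E (fun o => qw (Y j x o)))
    + n%:R * delta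
    + n%:R * (zfac / Rad * rq4 ^+ n * E (fun o => qw (Y j x o) ^+ 2))).
  rewrite ExZ; last L1_tac.
  rewrite !ExD; try L1_tac.
  by rewrite Ex_cst !ExZ//; L1_tac.
have e20 : 0 <= e2 := sqrtr_ge0 _.
have z0 : 0 <= zfac by exact: expR_ge0.
have q0 y : 0 <= qw y := qwt_ge0 y.
have t1 := @recursion_term n (Num.sqrt h * e2) rq2 (fun y => qw y) j x
  (mulr_ge0 sh0 e20) rq2_ge1 q0 (Ex_chain1 j x).
have t3 := @recursion_term n (zfac / Rad) rq4 (fun y => qw y ^+ 2) j x
  (divr_ge0 z0 (ltW Rad0)) rq4_ge1 (fun y => sqr_ge0 _)
  (Ex_chain2' j x).
have t0 := local_error2 x KL0 (fun y z => hV n j y z (ltnW hn)).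
apply: (le_trans (lerD t0 (lexx _))); rewrite -mulrDr ler_wpM2l//.
have t2 : n.+1%:R * delta = n%:R * delta + delta by rewrite -natr1; ring.
move: t1 t3 => /=; lra.
Qed.

End quantization_error.

(** * Independence of the noise from the past *)

Section independence.
Context {R : realType} {d : nat} disp (Omega : measurableType disp).
Context (P : probability Omega R) (G : set (set Omega)) (Z : Omega -> 'cV[R]_d).
Hypotheses (HG : sigma_algebra setT G) (Gm : G `<=` measurable).
Hypotheses (mZ : mvec Z) (indZ : independent_of P G Z).

Local Notation TG := (g_sigma_algebraType G).
Local Notation mcV := (@mcV R d).

Lemma measurable_sub (A : set TG) : measurable A = G A.
Proof. by rewrite -[X in _ = X A](sigma_algebra_id HG). Qed.

Lemma measurable_fun_sub disp' (T : measurableType disp') (f : TG -> T) :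
  measurable_fun setT f -> measurable_fun setT (f : Omega -> T).
Proof.
move=> mf _ B mB; have := mf measurableT B mB.
by rewrite measurable_sub; exact: Gm.
Qed.

Lemma measurable_fun_subid : measurable_fun setT (idfun : Omega -> TG).
Proof. by apply: measurable_fun_sub; exact: measurable_id. Qed.

(** For fixed [A], the image under [Z] of P restricted to [A], and P(A) times the law of [Z], are
    finite measures that agree on rectangles. *)
Lemma independent_extend (A : set Omega) (B : set mcV) : G A -> measurable B ->
  P (A `&` Z @^-1` B) = (P A * P (Z @^-1` B))%E.
Proof.
move=> GA mB; have mA := Gm GA; have mZ' := measurable_mcV mZ.
pose m1 := [the {measure set mcV -> \bar R} of pushforward (mrestr P mA) (Z : Omega -> mcV)].
pose m2 := [the {measure set mcV -> \bar R} of pushforward P (Z : Omega -> mcV)].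
pose c : {nonneg R} := NngNum (fine_ge0 (measure_ge0 P A)).
have cE : (c%:num%:E = P A)%E.
  by rewrite /= fineK// fin_num_measure.
have e : m1 mZ' B = mscale c (m2 mZ') B.
  apply: mcV_measure_unique => //.
    rewrite /m1 /= /pushforward preimage_setT /mrestr setTI.
    by rewrite (le_lt_trans (probability_le1 _ _)) ?ltry.
  move=> _ [B' [mB' ->]].
  transitivity (P (in_rect Z B' `&` A)); first by [].
  transitivity (c%:num%:E * P (in_rect Z B'))%E; last by [].
  by rewrite setIC indZ// cE.
transitivity (m1 mZ' B); first by rewrite setIC.
rewrite e; transitivity (c%:num%:E * P (Z @^-1` B))%E; first by [].
by rewrite cE.
Qed.

(** Freezing. The identity, viewed as a map into Omega with the sigma-algebra [G], carries all the
    information of the past; its joint law with [Z] is a product, and Tonelli applies. *)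
Lemma freeze_ge0 (f : Omega -> 'cV[R]_d -> \bar R) :
  measurable_fun setT (fun p : (TG * mcV)%type => f p.1 p.2) ->
  (forall o z, 0 <= f o z)%E ->
  (\int[P]_o f o (Z o) = \int[P]_o \int[P]_o' f o (Z o'))%E.
Proof.
move=> mf f0; have mZ' := measurable_mcV mZ.
pose X1 : {mfun Omega >-> TG} := HB.pack (idfun : Omega -> TG)
  (isMeasurableFun.Build _ _ _ _ _ measurable_fun_subid).
pose X2 : {mfun Omega >-> mcV} := HB.pack (Z : Omega -> mcV)
  (isMeasurableFun.Build _ _ _ _ _ mZ').
have mpair : measurable_fun setT (fun o => (o, Z o) : (TG * mcV)%type).
  by apply/measurable_fun_pair => //; exact: measurable_fun_subid.
pose m1 := [the probability _ _ of distribution P X1].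
pose m2 := [the probability _ _ of distribution P X2].
pose m' := [the {measure set (TG * mcV) -> \bar R} of pushforward P (fun o => (o, Z o) : (TG * mcV)%type)].
have uniq X : measurable X -> (m1 \x m2)%E X = m' mpair X.
  apply: product_measure_unique => A B mA mB.
  have GA : G A by rewrite -measurable_sub.
  transitivity (P (A `&` Z @^-1` B)); first by [].
  by rewrite independent_extend.
transitivity (\int[m' mpair]_p f p.1 p.2)%E.
  by rewrite ge0_integral_pushforward.
transitivity (\int[(m1 \x m2)%E]_p f p.1 p.2)%E.
  by apply: eq_measure_integral => A mA _; rewrite -uniq.
rewrite fubini_tonelli1 => [|//|p]; last exact: f0.
rewrite /fubini_F /= /m1.
transitivity (\int[distribution P X1]_x \int[P]_o' f x (Z o'))%E.
  apply: eq_integral => x _; rewrite /m2 ge0_integral_distribution//.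
  exact: (measurableT_comp mf (measurable_pair1 x)).
rewrite ge0_integral_distribution//; last first.
  by move=> y; apply: integral_ge0 => o _.
have e : fubini_F m2 (fun p : (TG * mcV)%type => f p.1 p.2) =
    (fun x : TG => \int[P]_o' f x (Z o'))%E.
  apply/funext => x; rewrite /fubini_F /m2 ge0_integral_distribution//.
  exact: (measurableT_comp mf (measurable_pair1 x)).
rewrite -e; exact: (measurable_fun_fubini_tonelli_F (m2 := m2) _ mf (fun p => f0 p.1 p.2)).
Qed.

End independence.

Section finite_choice.
Context {R : realType} {q : nat} disp (T : measurableType disp).
Variable (I : T -> 'I_q).
Hypothesis mI : forall j, measurable [set t | I t = j].

Lemma measurable_choice (f : 'I_q -> T -> R) :
  (forall j, measurable_fun setT (f j)) -> measurable_fun setT (fun t => f (I t) t).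
Proof.
move=> mf.
rewrite (_ : (fun _ => _) = (fun t => \sum_(j < q) \1_[set t | I t = j] t * f j t)).
  by apply: measurable_sum => j; apply: measurable_funM => //; exact: measurable_indic.
apply/funext => t; rewrite (bigD1 (I t))//= indicE mem_set// mul1r big1 ?addr0// => j jI.
by rewrite indicE memNset ?mul0r//= => e; rewrite e eqxx in jI.
Qed.

Lemma mvec_choice d (Y : 'I_q -> T -> 'cV[R]_d) :
  (forall j, mvec (Y j)) -> mvec (fun t => Y (I t) t).
Proof. by move=> mY c; apply: (measurable_choice (f := fun j t => Y j t c 0)) => j; exact: mY. Qed.

End finite_choice.

Section euler_measurability.
Context {R : realType} {d q : nat} (D : switching_data R d q) (C c0 : R).
Hypothesis HD : regular_data C c0 D.

Lemma mvec_euler_step disp (T : measurableType disp) (X Z : T -> 'cV[R]_d) h j :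
  mvec X -> mvec Z -> mvec (fun t => euler_step D h j (X t) (Z t)).
Proof.
move=> mX mZ; apply: mvecD; first apply: mvecD => //.
  apply: mvecZ => // c.
  apply: (measurable_elip (L := C) (phi := fun x => drift D j x c 0) mX) => x y.
  apply: le_trans (reg_drift_lip HD j x y).
  by rewrite (le_trans _ (coord_le_enorm _ c))// !mxE.
apply: mvecZ => //; apply: mvec_mulmx => // a b.
pose e : 'cV[R]_d := delta_mx b 0.
apply: (measurable_elip (L := C * enorm e) (phi := fun x => vol D j x a b) mX) => x y.
rewrite mulrAC; apply: le_trans (reg_vol_lip HD j x y e).
apply: le_trans (coord_le_enorm _ a); rewrite le_eqVlt; apply/orP; left; apply/eqP.
congr `|_|; rewrite mxE (bigD1 b)//= !mxE !eqxx mulr1 big1 ?addr0// => k kb.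
by rewrite !mxE (negbTE kb) mulr0.
Qed.

End euler_measurability.

Section decoupling.
Context {R : realType} {d q : nat} disp (Omega : measurableType disp).
Context (P : probability Omega R) (M : R) (theta : Omega -> 'cV[R]_d).
Context (D : switching_data R d q) (C c0 : R).
Hypothesis Hth : noise P M theta.
Hypothesis gth : gaussian_vector P 1 theta.
Hypothesis HD : regular_data C c0 D.
Variables (G : set (set Omega)) (Z : Omega -> 'cV[R]_d).
Hypotheses (HG : sigma_algebra setT G) (Gm : G `<=` measurable).
Hypotheses (gZ : gaussian_vector P 1 Z) (indZ : independent_of P G Z).
Variable h : R.
Local Notation TG := (g_sigma_algebraType G).
Variables (I : Omega -> 'I_q) (X : Omega -> 'cV[R]_d).
Hypotheses (GI : forall j, G [set o | I o = j]) (mX : mvec (X : TG -> 'cV[R]_d)).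

Definition step_mean (phi : 'I_q -> 'cV[R]_d -> R) j y :=
  Ex P (fun o => phi j (euler_step D h j y (theta o))).

(** Given the past, regime and position are constants, and [Z] may be replaced by [theta].
    Positivity of [phi] opens the way to Tonelli, so that integrability is part of the
    conclusion. *)
Lemma step_decouple (phi : 'I_q -> 'cV[R]_d -> R) L :
  (forall j, elip L (phi j)) -> (forall j y, 0 <= phi j y) ->
  L1 P (fun o => step_mean phi (I o) (X o)) ->
  L1 P (fun o => phi (I o) (euler_step D h (I o) (X o) (Z o))) /\
  Ex P (fun o => phi (I o) (euler_step D h (I o) (X o) (Z o))) =
  Ex P (fun o => step_mean phi (I o) (X o)).
Proof.
move=> phiL phi0 iS; have mZ := gaussian_vector_mvec gZ.
have mI (j : 'I_q) : measurable ([set o | I o = j] : set TG).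
  by rewrite (measurable_sub HG).
have mf : measurable_fun setT (fun p : (TG * @mcV R d)%type =>
    (phi (I p.1) (euler_step D h (I p.1) (X p.1) p.2))%:E).
  apply/measurable_EFinP.
  apply: (measurable_choice (I := fun p : (TG * @mcV R d)%type => I p.1) _
    (f := fun j p => phi j (euler_step D h j (X p.1) p.2))).
    move=> j; rewrite -[X in measurable X]setTI.
    exact: (@measurable_fst _ _ TG (@mcV R d) measurableT _ (mI j)).
  move=> j; apply: (measurable_elip _ (phiL j)); apply: (mvec_euler_step HD).
    by move=> c; exact: (measurableT_comp (mX c) measurable_fst).
  by move=> c; exact: (measurableT_comp (mvec_id c) measurable_snd).
pose f o z := (phi (I o) (euler_step D h (I o) (X o) z))%:E.
have f0 o z : (0 <= f o z)%E by rewrite lee_fin.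
have fr := freeze_ge0 HG Gm mZ indZ (f := f) mf f0.
have inner o : (\int[P]_o' (phi (I o) (euler_step D h (I o) (X o) (Z o')))%:E)%E =
    (step_mean phi (I o) (X o))%:E.
  rewrite (gaussian_vector_integral (f := fun z => (phi (I o) (euler_step D h (I o) (X o) z))%:E) gZ gth).
    by rewrite Ex_EFin//; exact: (pol_lin Hth (pol_elip Hth _ _ _ _ (phiL (I o)))).
  apply/measurable_EFinP; apply: (measurable_elip _ (phiL (I o))).
  by apply: (mvec_euler_step HD); [exact: mvec_cst|exact: mvec_id].
have tot : (\int[P]_o (phi (I o) (euler_step D h (I o) (X o) (Z o)))%:E)%E =
    (Ex P (fun o => step_mean phi (I o) (X o)))%:E.
  by rewrite -Ex_EFin// fr; apply: eq_integral => o _; rewrite inner.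
have mI' j : measurable [set o | I o = j] := Gm (GI j).
have mX' : mvec X by move=> c; exact: (measurable_fun_sub HG Gm (mX c)).
have i1 : L1 P (fun o => phi (I o) (euler_step D h (I o) (X o) (Z o))).
  apply/integrableP; split.
    apply/measurable_EFinP.
    apply: (measurable_choice mI' (f := fun j o => phi j (euler_step D h j (X o) (Z o)))) => j.
    by apply: (measurable_elip _ (phiL j)); exact: (mvec_euler_step HD).
  under eq_integral do rewrite /= ger0_norm//.
  by rewrite tot ltry.
by split=> //; apply: EFin_inj; rewrite -Ex_EFin.
Qed.

End decoupling.

(** * Martingale increments *)

Section brownian_increments.
Context {R : realType} {d : nat} disp (Omega : measurableType disp).
Context (P : probability Omega R) (F : R -> set (set Omega)) (W : R -> Omega -> 'cV[R]_d).
Hypotheses (F_usual : usual_filtration P F) (W_brownian : brownian_motion P F W).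
Variable h : R.
Hypothesis h0 : 0 < h.

Local Notation Ft l := (F (l%:R * h)).
Local Notation Z l := (brownian_incr W h l).

Let time_ge0 (l : nat) : 0 <= l%:R * h. Proof. by rewrite mulr_ge0// ltW. Qed.

Let time_lt (l : nat) : l%:R * h < l.+1%:R * h. Proof. by rewrite ltr_pM2r// ltr_nat. Qed.

Lemma grid_sigma_algebra l : sigma_algebra setT (Ft l).
Proof. exact: (filtration_sigma_algebra F_usual). Qed.

Lemma grid_measurable l : Ft l `<=` measurable.
Proof. exact: (filtration_measurable F_usual). Qed.

Lemma grid_nondecreasing l l' : (l <= l')%N -> Ft l `<=` Ft l'.
Proof.
by move=> ll'; apply: (filtration_nondecreasing F_usual) => //; rewrite ler_pM2r// ler_nat.
Qed.

Lemma brownian_incr_gaussian l : gaussian_vector P 1 (Z l).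
Proof.
have e : Num.sqrt (l.+1%:R * h - l%:R * h) = Num.sqrt h.
  by rewrite -mulrBl -natr1 addrAC subrr add0r mul1r.
apply: gaussian_vector_scale; first by rewrite sqrtr_gt0.
rewrite -e; exact: (brownian_gaussian W_brownian (time_ge0 l) (time_lt l)).
Qed.

Lemma brownian_incr_independent l : independent_of P (Ft l) (Z l).
Proof.
move=> A B GA mB; have i0 : 0 < (Num.sqrt h)^-1 by rewrite invr_gt0 sqrtr_gt0.
pose B' j := [set y | B j ((Num.sqrt h)^-1 * y)].
have e : in_rect (Z l) B = in_rect (fun w => W (l.+1%:R * h) w - W (l%:R * h) w) B'.
  by apply/seteqP; split=> w /= hw j; have := hw j; rewrite /B' !mxE.
rewrite e; apply: (brownian_independent W_brownian (time_ge0 l) (time_lt l)) => // j.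
rewrite -[X in measurable X]setTI.
have mf : measurable_fun setT (fun y : R => (Num.sqrt h)^-1 * y) by exact: measurable_funM.
exact: mf.
Qed.

Lemma mvec_sub l (X : Omega -> 'cV[R]_d) :
  mvec (X : g_sigma_algebraType (Ft l) -> 'cV[R]_d) -> mvec X.
Proof.
move=> mX c; exact: (measurable_fun_sub (grid_sigma_algebra l) (@grid_measurable l) (mX c)).
Qed.

Lemma mvec_grid_mono l l' (X : Omega -> 'cV[R]_d) : (l <= l')%N ->
  mvec (X : g_sigma_algebraType (Ft l) -> 'cV[R]_d) ->
  mvec (X : g_sigma_algebraType (Ft l') -> 'cV[R]_d).
Proof.
move=> ll' mX c _ B mB; have := mX c measurableT B mB.
rewrite (measurable_sub (grid_sigma_algebra l)) (measurable_sub (grid_sigma_algebra l')).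
exact: grid_nondecreasing.
Qed.

Lemma mvec_adapted l : mvec (W (l%:R * h) : g_sigma_algebraType (Ft l) -> 'cV[R]_d).
Proof.
move=> c _ B mB; rewrite setTI (measurable_sub (grid_sigma_algebra l)).
exact: (brownian_adapted W_brownian (time_ge0 l)).
Qed.

Lemma mvec_brownian_incr l : mvec (Z l : g_sigma_algebraType (Ft l.+1) -> 'cV[R]_d).
Proof.
apply: mvecZ => //; apply: mvecB; first exact: mvec_adapted.
exact: (mvec_grid_mono (leqnSn l) (mvec_adapted (l := l))).
Qed.

Context {q : nat} (D : switching_data R d q) (C c0 M : R) (theta : Omega -> 'cV[R]_d).
Hypothesis Hth : noise P M theta.
Hypothesis gth : gaussian_vector P 1 theta.
Hypothesis HD : regular_data C c0 D.
Hypothesis h1 : h <= 1.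

Local Notation V := (dpv P theta D h).
Local Notation S n := (step_mean P theta D h (V n)).
Let C1 : 1 <= C := reg_ge1 HD.
Let C0 : 0 <= C := le_trans ler01 C1.
Let hge0 : 0 <= h := ltW h0.
Let K0 : 0 <= kstep M C := kstep_ge0 Hth HD.

Lemma step_mean_elip phi L j : 0 <= L -> (forall j, elip L (phi j)) ->
  elip (L * (1 + kstep M C * h)) (step_mean P theta D h phi j).
Proof.
move=> L0 phiL x y; rewrite /step_mean.
have i1 := L1_step D Hth h j x (phiL j).
have i2 := L1_step D Hth h j y (phiL j).
have i3 := pol_lin Hth (pol_dist D Hth h j x y).
rewrite -ExB// (le_trans (Ex_abs (L1B i1 i2)))//.
apply: (@le_trans _ _ (Ex P (fun o => L * enorm (euler_step D h j x (theta o) - euler_step D h j y (theta o))))).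
  by apply: Ex_le => [||o]; [exact: L1_norm (L1B i1 i2)|exact: L1Z|exact: phiL].
by rewrite ExZ// -mulrA ler_wpM2l// (Ex_dist Hth HD hge0 h1).
Qed.

Section process.
Variables (k m : nat) (x : 'cV[R]_d) (I : nat -> Omega -> 'I_q) (X : nat -> Omega -> 'cV[R]_d).
Hypothesis HI : forall l j, (k <= l < m)%N -> Ft l [set o | I l o = j].
Hypothesis X0 : forall o, X k o = x.
Hypothesis XS : forall l o, (k <= l < m)%N ->
  X l.+1 o = euler_step D h (I l o) (X l o) (Z l o).

Lemma process_mvec l : (k <= l <= m)%N -> mvec (X l : g_sigma_algebraType (Ft l) -> 'cV[R]_d).
Proof.
move=> /andP[kl]; rewrite -(subnKC kl); elim: (l - k)%N => [|n ih].
  rewrite addn0 => _; rewrite (_ : X k = cst x); first exact: mvec_cst.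
  exact/funext.
rewrite addnS => hm; have kn : (k <= k + n < m)%N by rewrite leq_addr.
have mX := mvec_grid_mono (leqnSn (k + n)) (ih (ltnW hm)).
rewrite (_ : X _ = fun o => euler_step D h (I (k + n) o) (X (k + n) o) (Z (k + n) o)); last first.
  by apply/funext => o; rewrite XS.
apply: (@mvec_choice R q _ (g_sigma_algebraType (Ft (k + n).+1)) (I (k + n)) _ d
  (fun j o => euler_step D h j (X (k + n) o) (Z (k + n) o))).
  move=> j; rewrite (measurable_sub (grid_sigma_algebra (k + n).+1)).
  exact: (grid_nondecreasing (leqnSn (k + n)) (HI j kn)).
by move=> j; apply: (mvec_euler_step HD) => //; exact: mvec_brownian_incr.
Qed.

Let process_mvecT l : (k <= l <= m)%N -> mvec (X l).
Proof. by move=> hl; apply: mvec_sub; exact: process_mvec hl. Qed.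

Let decouple l phi L : (k <= l < m)%N ->
  (forall j, elip L (phi j)) -> (forall j y, 0 <= phi j y) ->
  L1 P (fun o => step_mean P theta D h phi (I l o) (X l o)) ->
  L1 P (fun o => phi (I l o) (X l.+1 o)) /\
  Ex P (fun o => phi (I l o) (X l.+1 o)) =
  Ex P (fun o => step_mean P theta D h phi (I l o) (X l o)).
Proof.
move=> kl phiL phi0 iS.
have kl' : (k <= l <= m)%N by case/andP: kl => -> /ltnW ->.
have := step_decouple Hth gth HD (grid_sigma_algebra l) (fun A => @grid_measurable l A)
  (brownian_incr_gaussian l) (@brownian_incr_independent l) (fun j => HI j kl)
  (process_mvec kl') phiL phi0 iS.
rewrite (_ : (fun o => phi (I l o) (euler_step D h (I l o) (X l o) (Z l o))) =
             (fun o => phi (I l o) (X l.+1 o)))//.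
by apply/funext => o; rewrite XS.
Qed.

Let L1_step_mean l phi L B : (k <= l < m)%N -> 0 <= L -> 0 <= B ->
  (forall j, elip L (phi j)) -> (forall j y, `|phi j y| <= B * wgt y) ->
  L1 P (fun o => wgt (X l o)) ->
  L1 P (fun o => step_mean P theta D h phi (I l o) (X l o)).
Proof.
move=> kl L0 B0 phiL phiB iw.
have kl' : (k <= l <= m)%N by case/andP: kl => -> /ltnW ->.
apply: (L1_dom _ _ (L1Z (B * (1 + kstep M C * h)) iw)).
  apply: (measurable_choice (I := I l) _ (f := fun j o => step_mean P theta D h phi j (X l o))) => j.
    exact: grid_measurable (HI j kl).
  exact: (@measurable_elip R d _ _ (X l) _ (step_mean P theta D h phi j) (process_mvecT kl') (step_mean_elip j L0 phiL)).
move=> o; rewrite /step_mean; set j := I l o; set y := X l o.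
have i1 := L1_step D Hth h j y (phiL j).
have i2 := L1_step D Hth h j y (@elip_wgt R d).
rewrite (le_trans (Ex_abs i1))//.
apply: (@le_trans _ _ (Ex P (fun o => B * wgt (euler_step D h j y (theta o))))).
  by apply: Ex_le => [||o']; [exact: L1_norm|exact: L1Z|exact: phiB].
by rewrite ExZ// -mulrA ler_wpM2l// (Ex_wgt Hth HD hge0 h1).
Qed.

Lemma process_L1 l : (k <= l <= m)%N -> L1 P (fun o => wgt (X l o)).
Proof.
move=> /andP[kl]; rewrite -(subnKC kl); elim: (l - k)%N => [|n ih].
  rewrite addn0 => _; under eq_fun do rewrite X0; exact: L1_cst.
rewrite addnS => hm; have kn : (k <= k + n < m)%N by rewrite leq_addr.
have iw := ih (ltnW hm).
have wB (j : 'I_q) y : `|(fun _ : 'I_q => @wgt R d) j y| <= 1 * wgt y.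
  by rewrite mul1r ger0_norm// wgt_ge0.
have := @decouple (k + n) (fun _ => @wgt R d) 1 kn (fun _ => @elip_wgt R d)
  (fun _ y => wgt_ge0 y).
by case; first exact: (L1_step_mean kn ler01 ler01 (fun _ => @elip_wgt R d) wB iw).
Qed.

Definition mart_incr l (o : Omega) : R :=
  V (m - l.+1) (I l o) (X l.+1 o) - S (m - l.+1) (I l o) (X l o).

(** Decoupling is stated for nonnegative functions, while [V] is signed: it is applied to B wgt + V
    and to B wgt, both nonnegative by the growth bound, and the results are subtracted. *)
Lemma mart_incr_mean l : (k <= l < m)%N -> L1 P (mart_incr l) /\ Ex P (mart_incr l) = 0.
Proof.
move=> kl; have kl' : (k <= l <= m)%N by case/andP: kl => -> /ltnW ->.
have iw := process_L1 kl'.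
set n := (m - l.+1)%N; set B := C * rho0 M C h ^+ n.
have B0 : 0 <= B by rewrite mulr_ge0// exprn_ge0// (le_trans _ (rho0_ge1 Hth HD hge0)).
have Vw j y : `|V n j y| <= B * wgt y by exact: (dpv_growth Hth HD hge0 h1).
have VL : forall j, elip (lipc M C h C n) (V n j).
  exact: (dpv_elip Hth HD hge0 h1 C0 (reg_cost_lip HD)).
have L0 : 0 <= lipc M C h C n by exact: (lipc_ge0 Hth HD hge0).
pose phi (j : 'I_q) y := B * wgt y + V n j y.
have phiL j : elip (B + lipc M C h C n) (phi j).
  move=> y z; rewrite /phi (_ : _ - _ = B * (wgt y - wgt z) + (V n j y - V n j z)); last by ring.
  rewrite (le_trans (ler_normD _ _))// mulrDl lerD ?VL// normrM ger0_norm//.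
  by rewrite ler_wpM2l// wgt_dist.
have phi0 j y : 0 <= phi j y.
  by have := Vw j y; rewrite ler_norml /phi => /andP[+ _]; lra.
have phiB j y : `|phi j y| <= (2 * B) * wgt y.
  by rewrite ger0_norm//; have := Vw j y; rewrite ler_norml /phi => /andP[_ +]; lra.
pose psi (_ : 'I_q) (y : 'cV[R]_d) := B * wgt y.
have psi0 j y : 0 <= psi j y by rewrite mulr_ge0// wgt_ge0.
have psiL j : elip B (psi j).
  by move=> y z; rewrite -mulrBr normrM ger0_norm// ler_wpM2l// wgt_dist.
have psiB j y : `|psi j y| <= B * wgt y by rewrite ger0_norm.
have iS1 := L1_step_mean kl (addr_ge0 B0 L0) (mulr_ge0 (ler0n _ 2) B0) phiL phiB iw.
have iS2 := L1_step_mean kl B0 B0 psiL psiB iw.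
have [i1 e1] := decouple kl phiL phi0 iS1.
have [i2 e2] := decouple kl psiL psi0 iS2.
have iSV := L1_step_mean kl L0 B0 VL Vw iw.
have {}i2 : L1 P (fun o => B * wgt (X l.+1 o)) by [].
have {}e2 : Ex P (fun o => B * wgt (X l.+1 o)) = Ex P (fun o => step_mean P theta D h psi (I l o) (X l o)) by [].
have eV : (fun o => V n (I l o) (X l.+1 o)) =
    (fun o => phi (I l o) (X l.+1 o) - B * wgt (X l.+1 o)).
  by apply/funext => o; rewrite /phi; ring.
have eS o : S n (I l o) (X l o) =
    step_mean P theta D h phi (I l o) (X l o)
    - step_mean P theta D h psi (I l o) (X l o).
  rewrite /step_mean -ExB//.
  - by apply: eq_Ex => o'; rewrite /phi /psi; ring.
  - exact: (L1_step D Hth h _ _ (phiL _)).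
  - exact: (L1_step D Hth h _ _ (psiL _)).
have iV : L1 P (fun o => V n (I l o) (X l.+1 o)) by rewrite eV; exact: L1B.
split; first exact: L1B.
rewrite /mart_incr (ExB iV iSV).
rewrite -/n eV (ExB i1 i2) e1 e2 -ExB// -(eq_Ex _ eS) subrr//.
Qed.

Lemma mart_sum_mean (a : R) :
  L1 P (fun o => a + \sum_(k <= l < m) mart_incr l o) /\
  Ex P (fun o => a + \sum_(k <= l < m) mart_incr l o) = a.
Proof.
have iS : forall s, (forall l, l \in s -> (k <= l < m)%N) ->
    L1 P (fun o => \sum_(l <- s) mart_incr l o) /\
    Ex P (fun o => \sum_(l <- s) mart_incr l o) = 0.
  elim=> [_|l s ih hs].
    by under eq_fun do rewrite big_nil; split; [exact: L1_cst|rewrite Ex_cst].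
  under eq_fun do rewrite big_cons.
  have [i1 e1] := mart_incr_mean (hs l (mem_head _ _)).
  have [|i2 e2] := ih; first by move=> l' l's; apply: hs; rewrite inE l's orbT.
  by split; [exact: L1D|rewrite ExD// e1 e2 addr0].
have [|i e] := iS (index_iota k m); first by move=> l; rewrite mem_index_iota.
by split; [apply: L1D => //; exact: L1_cst|rewrite ExD ?Ex_cst ?e ?addr0//; exact: L1_cst].
Qed.

End process.
End brownian_increments.

(** * Pathwise payoff bound *)

Section nonmeasurable_integrands.
Context {R : realType} disp (Omega : measurableType disp) (P : probability Omega R).
Local Open Scope ereal_scope.

(** The integral of a nonnegative function is a supremum over simple functions below it, hence
    monotone for arbitrary functions. Payoffs can thus be compared with their bound without a proof
    of their measurability. *)
Lemma ge0_le_integralT (f g : Omega -> \bar R) :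
  (forall o, 0 <= f o) -> (forall o, f o <= g o) -> \int[P]_o f o <= \int[P]_o g o.
Proof.
move=> f0 fg; have g0 o : 0 <= g o := le_trans (f0 o) (fg o).
rewrite !ge0_integralTE//; apply: ereal_sup_le => _ [u uf <-].
by exists u => // o; exact: le_trans (uf o) (fg o).
Qed.

Lemma le_integralT (f g : Omega -> \bar R) :
  (forall o, f o <= g o) -> \int[P]_o f o <= \int[P]_o g o.
Proof.
move=> fg; rewrite integralE [leRHS]integralE; apply: leeB; apply: ge0_le_integralT => o.
- exact: funepos_ge0.
- by rewrite !funeposE ge_max !le_max fg lexx orbT.
- exact: funeneg_ge0.
- by rewrite !funenegE ge_max !le_max leeN2 fg lexx orbT.
Qed.

(* In a complete probability space an integrand may be changed arbitrarily on
   a negligible set, without losing measurability. *)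
Lemma ae_le_integral_complete (B : set Omega) (f g : Omega -> R) :
  P.-negligible `<=` measurable -> P.-negligible B -> L1 P g ->
  (forall o, ~ B o -> (f o <= g o)%R) ->
  \int[P]_o (f o)%:E <= \int[P]_o (g o)%:E.
Proof.
move=> cpl nB ig fg; pose g' o := if o \in B then f o else g o.
have mg := L1_measurable ig.
have mg' : measurable_fun setT g'.
  move=> _ Y mY; rewrite setTI.
  rewrite (_ : _ @^-1` _ = (g @^-1` Y `\` B) `|` (g' @^-1` Y `&` B)).
    apply: measurableU.
      by apply: measurableD; [rewrite -[X in measurable X]setTI; exact: mg|exact: cpl].
    by apply: cpl; apply: negligibleS nB; exact: subIsetr.
  apply/seteqP; split=> o /=; rewrite /g'; case: ifPn => [/set_mem oB|/negP oB] h.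
  - by right; split.
  - by left; split=> // oB'; apply: oB; exact: mem_set.
  - by case: h => [[]|[]].
  - by case: h => [[]|[]].
rewrite -(@ae_eq_integral _ _ _ P setT (fun o => (g o)%:E) (fun o => (g' o)%:E))//.
- apply: le_integralT => o; rewrite lee_fin /g'; case: ifPn => // /negP oB.
  by apply: fg => oB'; apply: oB; exact: mem_set.
- exact/measurable_EFinP.
- exact/measurable_EFinP.
- apply: negligibleS nB => o /= h; apply: contrapT => oB; apply: h => _.
  by rewrite /g' memNset.
Qed.

End nonmeasurable_integrands.

(** * Switching times along one path *)

Section switching_times.
Context {R : realType} (T : Type) {q : nat} (a : control T R q) (o : T).
Hypothesis mono : forall n, (switch_time a n o <= switch_time a n.+1 o)%E.

Lemma switch_time_mono n n' : (n <= n')%N -> (switch_time a n o <= switch_time a n' o)%E.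
Proof.
move=> /subnKC <-; elim: (n' - n)%N => [|r ih]; first by rewrite addn0.
by rewrite addnS (le_trans ih).
Qed.

(** The strict upper bound selects the last of several simultaneous switches, and monotone times
    make this index unique. *)
Lemma regime_atE n s :
  (switch_time a n o <= s%:E < switch_time a n.+1 o)%E -> regime_at a s o = switch_regime a n o.
Proof.
move=> hn; rewrite /regime_at (@xget_subset1 _ _ _ n)// => n1 n2 /= /andP[h1 h2] /andP[h3 h4].
have [n12|n12|//] := ltngtP n1 n2.
  by have := lt_le_trans h2 (le_trans (switch_time_mono n12) h3); rewrite ltxx.
by have := lt_le_trans h4 (le_trans (switch_time_mono n12) h1); rewrite ltxx.
Qed.

Lemma nb_switchesE Th N : (switch_time a N o <= Th%:E < switch_time a N.+1 o)%E ->
  nb_switches Th a o = N.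
Proof.
move=> /andP[h1 h2]; rewrite /nb_switches.
rewrite (_ : [set n | _] = [set` seq_fset tt (iota 1 N)]); last first.
  have memE n : (n \in seq_fset tt (iota 1 N)) = (0 < n <= N)%N.
    by rewrite seq_fsetE mem_iota add1n ltnS.
  apply/seteqP; split=> n; rewrite /= memE.
    move=> [n1 hn]; rewrite n1/= leqNgt; apply/negP => Nn.
    by have := lt_le_trans h2 (le_trans (switch_time_mono Nn) hn); rewrite ltxx.
  by move=> /andP[-> nN]; split=> //; exact: le_trans (switch_time_mono nN) h1.
by rewrite set_fsetK size_seq_fset undup_id ?iota_uniq// size_iota.
Qed.

Lemma switch_time_bracket s : (switch_time a 0%N o <= s%:E)%E ->
  (exists n, (s%:E < switch_time a n o)%E) ->
  exists n, (switch_time a n o <= s%:E < switch_time a n.+1 o)%E.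
Proof.
move=> h0 ex; case: (ex_minnP ex) => -[|n] hn nmin.
  by have := lt_le_trans hn h0; rewrite ltxx.
exists n; rewrite hn andbT leNgt; apply/negP => /nmin.
by rewrite ltnn.
Qed.

End switching_times.

Section pathwise.
Context {R : realType} {d q : nat} (T : Type).
Variables (D : switching_data R d q) (W : R -> T -> 'cV[R]_d) (C c0 : R).
Hypothesis HD : regular_data C c0 D.

(** By the triangular inequality, merging simultaneous switches into a direct one cannot increase
    the cost; an empty chain is covered by the zero diagonal. *)
Lemma cost_chain (i : nat -> 'I_q) (y : 'cV[R]_d) p r :
  cost D (i p) (i (p + r)%N) y <= \sum_(p.+1 <= n < (p + r).+1) cost D (i n.-1) (i n) y.
Proof.
elim: r => [|r ih]; first by rewrite addn0 (reg_cost_diag HD) big_geq.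
rewrite addnS big_nat_recr/=; last by rewrite ltnS leq_addr.
apply: le_trans (reg_cost_tri HD (i p) (i (p + r)%N) _ y) _.
by rewrite lerD2r.
Qed.

Variables (Th h : R) (m k : nat) (a : control T R q) (o : T) (x : 'cV[R]_d) (i : 'I_q).
Hypotheses (h0 : 0 < h) (Thm : Th = m%:R * h) (km : (k <= m)%N).
Hypothesis mono : forall n, (switch_time a n o <= switch_time a n.+1 o)%E.
Hypothesis grid : forall n, (switch_time a n o <= Th%:E)%E ->
  exists l, [/\ (k <= l)%N, (l <= m)%N & switch_time a n o = (l%:R * h)%:E].
Hypothesis t0 : switch_time a 0%N o = (k%:R * h)%:E.
Hypothesis i0 : switch_regime a 0%N o = i.
Hypothesis fin : exists n, (Th%:E < switch_time a n o)%E.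

Local Notation X l := (euler_scheme D W h k x a l o).
Local Notation I l := (regime_at a (l%:R * h) o).
Definition prev_regime l := if l == k then i else I l.-1.

Lemma grid_indexE l : grid_index h (l%:R * h)%:E = l.
Proof. by rewrite /grid_index /= mulfK ?gt_eqF// natrK. Qed.

(** Simultaneous switches are merged by [cost_chain], and a switch at the horizon is removed by the
    obstacle condition on [terminal]. What remains has one decision per grid time, as in the
    recursion. *)
Lemma euler_payoff_le :
  euler_payoff D W Th h m k x a o <=
  \sum_(k <= l < m) (running D (I l) (X l) * h - cost D (prev_regime l) (I l) (X l))
  + terminal D (prev_regime m) (X m).
Proof.
have hl l : (l <= m)%N -> ((l%:R * h)%:E <= Th%:E :> \bar R)%E.
  by move=> lm; rewrite lee_fin Thm ler_pM2r// ler_nat.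
have ex l : (k <= l <= m)%N ->
    exists n, (switch_time a n o <= (l%:R * h)%:E < switch_time a n.+1 o)%E.
  move=> /andP[kl lm]; apply: switch_time_bracket => //.
    by rewrite t0 lee_fin ler_pM2r// ler_nat.
  by have [n hn] := fin; exists n; exact: le_lt_trans (hl _ lm) hn.
pose c n := cost D (switch_regime a n.-1 o) (switch_regime a n o) (X (grid_index h (switch_time a n o))).
(* By induction on l, with [n] the index of the last switch not after t_l: the costs of the net
   switches are charged to the actual ones. *)
have key l n : (k <= l <= m)%N ->
    (switch_time a n o <= (l%:R * h)%:E < switch_time a n.+1 o)%E ->
    \sum_(k <= p < l.+1) cost D (prev_regime p) (I p) (X p) <= \sum_(1 <= p < n.+1) c p.
  move=> /andP[kl]; rewrite -(subnKC kl); elim: (l - k)%N n => [|r ih] n.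
    rewrite addn0 => _ hn; rewrite big_nat1 /prev_regime eqxx (regime_atE mono hn) -i0.
    have := cost_chain (fun n => switch_regime a n o) (X k) 0 n; rewrite add0n => hc.
    apply: (le_trans hc); apply: ler_sum_nat => p /andP[p1 pn].
    rewrite /c; suff -> : switch_time a p o = (k%:R * h)%:E by rewrite grid_indexE.
    have /andP[hn1 _] := hn; apply/eqP; rewrite eq_le.
    rewrite (le_trans (switch_time_mono mono _) hn1)//=.
    by rewrite -t0 (switch_time_mono mono).
  rewrite addnS => hm hn; have [|n' hn'] := ex (k + r)%N; first by rewrite leq_addr/= ltnW.
  have {}ih := ih n' (ltnW hm) hn'.
  rewrite big_nat_recr; last by rewrite -addnS leq_addr.
  have [/andP[h1 h2] /andP[h3 h4]] := (hn, hn').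
  have n'n : (n' <= n)%N.
    rewrite leqNgt; apply/negP => nn'.
    have := lt_le_trans h2 (le_trans (switch_time_mono mono nn') h3).
    by rewrite lte_fin ltr_pM2r// ltr_nat ltnNge leqW.
  rewrite [leRHS](big_cat_nat (n := n'.+1))//.
  apply: lerD => //; rewrite /prev_regime (_ : (k + r).+1 == k = false); last first.
    by apply/negbTE; rewrite neq_ltn ltnS leq_addr orbT.
  rewrite (regime_atE mono hn) (regime_atE mono hn').
  have := cost_chain (fun n => switch_regime a n o) (X (k + r).+1) n' (n - n').
  rewrite subnKC// => hc; apply: (le_trans hc).
  apply: ler_sum_nat => p /andP[p1 pn].
  (* A switch of index p > n' comes after t_(k+r), not after t_(k+r+1), and lies on the grid, so it
     takes place exactly at t_(k+r+1). *)
  rewrite /c; suff -> : switch_time a p o = ((k + r).+1%:R * h)%:E by rewrite grid_indexE.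
  have hp : (switch_time a p o <= ((k + r).+1%:R * h)%:E)%E.
    exact: le_trans (switch_time_mono mono (pn : (p <= n)%N)) h1.
  have [l' [_ _ e]] := grid (le_trans hp (hl _ hm)).
  rewrite e; congr (_%:R * h)%:E; apply/eqP; rewrite eqn_leq.
  move: hp; rewrite e lee_fin ler_pM2r// ler_nat => ->/=.
  have := lt_le_trans h4 (switch_time_mono mono p1).
  by rewrite e lte_fin ltr_pM2r// ltr_nat.
have [|n hn] := ex m; first by rewrite km leqnn.
have := key m n _ hn; rewrite km leqnn => /(_ isT) hc.
have hn' : (switch_time a n o <= Th%:E < switch_time a n.+1 o)%E by rewrite Thm.
rewrite /euler_payoff (nb_switchesE mono hn').
have ob := reg_obstacle HD (prev_regime m) (I m) (X m).
rewrite big_nat_recr//= in hc.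
rewrite sumrB; rewrite -/c; move: hc ob.
set A := \sum_(k <= l < m) _ * h; set B := \sum_(k <= l < m) cost _ _ _ _.
set E := \sum_(1 <= _ < _) _; lra.
Qed.

End pathwise.

(** * Dynamic programming principle *)

Section admissible_controls.
Context {R : realType} {q : nat} disp (Omega : measurableType disp).
Context (P : probability Omega R) (F : R -> set (set Omega)).
Hypothesis F_usual : usual_filtration P F.

Lemma usual_negligible_measurable : P.-negligible `<=` measurable.
Proof.
move=> A /(filtration_complete F_usual); exact: (filtration_measurable F_usual (lexx 0)).
Qed.

Context (Th h : R) (m k : nat) (i : 'I_q) (a : control Omega R q).
Hypothesis Ha : admissible P F Th h m k i a.

Lemma regime_at_measurable s j : 0 <= s -> F s [set o | regime_at a s o = j].
Proof.
move=> s0; have HG := filtration_sigma_algebra F_usual s0.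
pose TG := g_sigma_algebraType (F s).
pose A n : set TG := [set o | (switch_time a n o <= s%:E)%E].
pose B n : set TG := [set o | switch_regime a n o = j].
have mA n : measurable (A n) by rewrite (measurable_sub HG); exact: (adm_stopping Ha n).2.
have mBA n : measurable (B n `&` A n).
  by rewrite (measurable_sub HG); exact: (adm_regime Ha n j).2.
have mi : measurable ([set o : TG | i = j]).
  have [->|ij] := eqVneq i j.
    by rewrite (_ : [set _ | _] = setT)//; apply/seteqP; split.
  by rewrite (_ : [set _ | _] = set0)//; apply/seteqP; split=> // o /= /eqP; rewrite (negbTE ij).
rewrite -(measurable_sub HG).
(* Either some n is the last switch not after [s], or none exists and the default index 0 of
   [regime_at] yields the initial regime. *)
rewrite (_ : [set o | _] = \bigcup_n ((B n `&` A n) `\` A n.+1) `|`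
    (\bigcap_n ~` (A n `\` A n.+1) `&` [set o : TG | i = j])).
  apply: measurableU; first by apply: bigcupT_measurable => n; exact: measurableD.
  apply: measurableI => //; apply: bigcapT_measurable => n.
  by apply: measurableC; exact: measurableD.
have bracket n (o : TG) : (switch_time a n o <= s%:E < switch_time a n.+1 o)%E <->
    (A n `\` A n.+1) o.
  split=> [/andP[h1 h2]|[h1 /negP h2]]; last by rewrite h1 ltNge.
  by split=> //; apply/negP; rewrite -ltNge.
apply/seteqP; split=> o /=.
  have [[n hn]|hn] := pselect (exists n, (A n `\` A n.+1) o).
    rewrite (regime_atE (fun n => adm_nondecreasing Ha n o) (proj2 (bracket n o) hn)) => e.
    by left; exists n => //; case: hn.
  rewrite /regime_at xgetPN => [|n hn']; last by apply: hn; exists n; apply/bracket.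
  rewrite (adm_start_regime Ha) => e; right; split=> // n _ hn'.
  by apply: hn; exists n.
case=> [[n _ [[e h1] h2]]|[hn e]].
  by rewrite (regime_atE (fun n => adm_nondecreasing Ha n o) (proj2 (bracket n o) (conj h1 h2))).
rewrite /regime_at xgetPN ?(adm_start_regime Ha)// => n hn'.
by apply: (hn n) => //; apply/bracket.
Qed.

Lemma adm_finite_negligible : P.-negligible [set o | ~ exists n, (Th%:E < switch_time a n o)%E].
Proof.
have [N [_ hN]] := adm_finite Ha; apply: negligibleS hN => o /= ho h'.
by apply: ho; exists (N o).
Qed.

End admissible_controls.

Section dynamic_programming_principle.
Context {R : realType} {d q : nat} disp (Omega : measurableType disp).
Context (P : probability Omega R) (F : R -> set (set Omega)) (W : R -> Omega -> 'cV[R]_d).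
Context (D : switching_data R d q) (C c0 M : R) (theta : Omega -> 'cV[R]_d).
Hypotheses (F_usual : usual_filtration P F) (W_brownian : brownian_motion P F W).
Hypotheses (Hth : noise P M theta) (gth : gaussian_vector P 1 theta).
Hypothesis HD : regular_data C c0 D.
Variables (Th h : R) (m k : nat).
Hypotheses (h0 : 0 < h) (h1 : h <= 1) (Thm : Th = m%:R * h) (km : (k <= m)%N).
Variables (i : 'I_q) (x : 'cV[R]_d).

Local Notation V := (dpv P theta D h).
Local Notation S n := (step_mean P theta D h (V n)).

Lemma euler_schemeS (a : control Omega R q) l o : (k <= l)%N ->
  euler_scheme D W h k x a l.+1 o =
  euler_step D h (regime_at a (l%:R * h) o) (euler_scheme D W h k x a l o) (brownian_incr W h l o).
Proof. by move=> kl; rewrite /= ltnNge kl. Qed.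

Section telescoping.
Variables (J : nat -> 'I_q) (Y : nat -> 'cV[R]_d).
Let p l := if l == k then i else J l.-1.
Let gain := \sum_(k <= l < m) (running D (J l) (Y l) * h - cost D (p l) (J l) (Y l))
  + terminal D (p m) (Y m).
Let bound := V (m - k) i (Y k) +
  \sum_(k <= l < m) (V (m - l.+1) (J l) (Y l.+1) - S (m - l.+1) (J l) (Y l)).

(** Telescoping of V along the path: the two sides differ by the sum of the deficits of the
    decisions [J], nonnegative in general and zero for optimal ones. *)
Let boundE : bound = gain +
  \sum_(k <= l < m) (V (m - l) (p l) (Y l) - dpu P theta D h (m - l.+1) (p l) (J l) (Y l)).
Proof.
pose u l := V (m - l) (p l) (Y l).
have pS l : (k <= l)%N -> p l.+1 = J l by move=> kl; rewrite /p ifF//; apply/eqP; lia.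
have tele := telescope_sumr u km.
have um : u m = terminal D (p m) (Y m) by rewrite /u subnn.
have uk : u k = V (m - k) i (Y k) by rewrite /u /p eqxx.
rewrite /bound /gain -um -uk -/p (_ : u m = u k + \sum_(k <= l < m) (u l.+1 - u l)); last first.
  by rewrite tele addrC subrK.
suff -> : \sum_(k <= l < m) (V (m - l.+1) (J l) (Y l.+1) - S (m - l.+1) (J l) (Y l)) =
    \sum_(k <= l < m) (running D (J l) (Y l) * h - cost D (p l) (J l) (Y l))
    + \sum_(k <= l < m) (u l.+1 - u l)
    + \sum_(k <= l < m) (u l - dpu P theta D h (m - l.+1) (p l) (J l) (Y l)) by ring.
rewrite -!big_split; apply: eq_big_nat => l /andP[kl lm].
by rewrite /u (pS _ kl) /dpu /step_mean /=; ring.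
Qed.

Lemma gain_le_martingale : gain <= bound.
Proof.
rewrite boundE lerDl big_nat; apply: sumr_ge0 => l /andP[kl lm].
rewrite subr_ge0 -(subnSK lm); exact: dpv_ge.
Qed.

Lemma gain_eq_martingale :
  (forall l, (k <= l < m)%N ->
    V (m - l) (p l) (Y l) = dpu P theta D h (m - l.+1) (p l) (J l) (Y l)) ->
  gain = bound.
Proof.
move=> opt; rewrite boundE big_nat big1 ?addr0// => l hl.
by rewrite opt ?subrr.
Qed.

End telescoping.

Lemma expected_payoff_le a : admissible P F Th h m k i a ->
  ('E_P[euler_payoff D W Th h m k x a] <= (V (m - k) i x)%:E)%E.
Proof.
move=> Ha; rewrite unlock.
pose I l o := regime_at a (l%:R * h) o.
pose X l o := euler_scheme D W h k x a l o.
have HI l j : (k <= l < m)%N -> F (l%:R * h) [set o | I l o = j].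
  by move=> _; apply: (regime_at_measurable F_usual Ha); rewrite mulr_ge0// ltW.
have X0 o : X k o = x by rewrite /X; case: k => //= k'; rewrite ltnSn.
have XS l o : (k <= l < m)%N -> X l.+1 o = euler_step D h (I l o) (X l o) (brownian_incr W h l o).
  by move=> /andP[kl _]; exact: euler_schemeS.
have [iM eM] := mart_sum_mean F_usual W_brownian h0 Hth gth HD h1 HI X0 XS (V (m - k) i x).
rewrite -[in leRHS]eM -Ex_EFin//.
(* The pathwise bound is applied off the null set where the switching times never pass the
   horizon. *)
apply: (ae_le_integral_complete (usual_negligible_measurable F_usual) (adm_finite_negligible Ha) iM).
move=> o /contrapT fin.
apply: le_trans (euler_payoff_le W HD x h0 Thm km (fun n => adm_nondecreasing Ha n o)
  (fun n => @adm_grid _ _ _ _ _ _ _ _ _ _ _ _ Ha n o) (adm_start_time Ha o)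
  (adm_start_regime Ha o) fin) _.
have := gain_le_martingale (I^~ o) (X^~ o); rewrite X0; exact.
Qed.

(** * The greedy feedback control attains the value *)

Section optimal_control.

(** A fixed rule of choice among the regimes attaining the maximum; the fallback [j] is never
    reached, see [best_regimeP]. *)
Definition best_regime n (j : 'I_q) y : 'I_q :=
  odflt j [pick j' | dpu P theta D h n j j' y == V n.+1 j y].

Lemma best_regimeP n j y : V n.+1 j y = dpu P theta D h n j (best_regime n j y) y.
Proof.
rewrite /best_regime; case: pickP => [j' /eqP//|no].
by have [j' e] := dpv_opt P theta D h n j y; have := no j'; rewrite e eqxx.
Qed.

Lemma measurable_dpu n i0 j disp' (T : measurableType disp') (Y : T -> 'cV[R]_d) :
  mvec Y -> measurable_fun setT (fun t => dpu P theta D h n i0 j (Y t)).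
Proof.
move=> mY; have C0 : 0 <= C := le_trans ler01 (reg_ge1 HD).
apply: measurable_funB; first apply: measurable_funD.
- apply: (measurable_elip (phi := S n j) mY).
  apply: (step_mean_elip h0 Hth HD h1 j (lipc_ge0 Hth HD (ltW h0) n C0)).
  exact: (dpv_elip Hth HD (ltW h0) h1 C0 (reg_cost_lip HD)).
- by apply: measurable_funM => //; exact: (measurable_elip mY (reg_running_lip HD j)).
- exact: (measurable_elip mY (reg_cost_lip HD i0 j)).
Qed.

Lemma measurable_best_regime n disp' (T : measurableType disp') (J : T -> 'I_q)
    (Y : T -> 'cV[R]_d) j :
  (forall j, measurable [set t | J t = j]) -> mvec Y ->
  measurable [set t | best_regime n (J t) (Y t) = j].
Proof.
move=> mJ mY.
(* The choice depends on the position only through the finite pattern telling which regimes attain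
   the maximum; each pattern is a measurable event, and there are finitely many. *)
pose b i0 t := [ffun j' : 'I_q => dpu P theta D h n i0 j' (Y t) == V n.+1 i0 (Y t)].
pose G i0 (c : {ffun 'I_q -> bool}) := odflt i0 [pick j' | c j'].
have bG i0 t : best_regime n i0 (Y t) = G i0 (b i0 t).
  by rewrite /best_regime /G; congr odflt; apply: eq_pick => j'; rewrite ffunE.
have mb i0 (c : {ffun 'I_q -> bool}) : measurable [set t | b i0 t = c].
  rewrite (_ : [set t | _] = \bigcap_(j' in [set: 'I_q]) [set t | (dpu P theta D h n i0 j' (Y t) == V n.+1 i0 (Y t)) = c j']).
    apply: fin_bigcap_measurable => // j' _.
    have m1 := measurable_dpu n i0 j' mY.
    have [L lL] := dpv_elipP Hth HD (ltW h0) h1 n.+1 i0.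
    have m2 := measurable_elip mY lL.
    have := measurable_fun_eqr m1 m2.
    move=> /(_ measurableT [set c j'] (I)).
    by rewrite setTI.
  apply/seteqP; split=> t /=; first by move=> <- j' _; rewrite /b ffunE.
  by move=> h'; apply/ffunP => j'; rewrite ffunE h'.
rewrite (_ : [set t | _] = \bigcup_(p in [set p : 'I_q * {ffun 'I_q -> bool} | G p.1 p.2 = j])
    ([set t | J t = p.1] `&` [set t | b p.1 t = p.2])).
  by apply: fin_bigcup_measurable => // p _; exact: measurableI.
apply/seteqP; split=> t /=; first by rewrite bG => e; exists (J t, b (J t) t).
by case=> -[i0 c] /= e [Ji bc]; rewrite Ji bG bc.
Qed.

(** After n > 0 steps: the regime chosen at t_(k+n-1) and the position at t_(k+n). The first
    argument of [best_regime] is the number of steps left once the current one is made. *)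
Fixpoint best_state (n : nat) (o : Omega) : 'I_q * 'cV[R]_d :=
  if n is n'.+1 then
    let s := best_state n' o in
    let j := best_regime (m - (k + n').+1) s.1 s.2 in
    (j, euler_step D h j s.2 (brownian_incr W h (k + n') o))
  else (i, x).

(* A regime chosen at [t_(k+n)] takes effect at the switch of index [n + 1]:
   the control is allowed to switch at [t_k], and "switches" at every grid
   point before the horizon, possibly to the same regime at no cost. *)
Definition best_control : control Omega R q := Control
  (fun n _ => if (n <= m - k)%N then ((k + n.-1)%:R * h)%:E else +oo%E)
  (fun n o => (best_state (minn n (m - k)) o).1).

Lemma best_state_measurable n :
  (forall j, F ((k + n)%:R * h) [set o | (best_state n o).1 = j]) /\
  mvec (fun o : g_sigma_algebraType (F ((k + n)%:R * h)) => (best_state n o).2).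
Proof.
elim: n => [|n [mJ mY]].
  split=> [j|]; last exact: mvec_cst.
  have HG := grid_sigma_algebra F_usual h0 (k + 0).
  rewrite -(measurable_sub HG) /=; have [->|ij] := eqVneq i j.
    by rewrite (_ : [set _ | _] = setT)//; apply/seteqP; split.
  by rewrite (_ : [set _ | _] = set0)//; apply/seteqP; split=> // o /= /eqP; rewrite (negbTE ij).
have HG := grid_sigma_algebra F_usual h0 (k + n).
have HG' := grid_sigma_algebra F_usual h0 (k + n).+1.
have mJ' j : F ((k + n)%:R * h) [set o | (best_state n.+1 o).1 = j].
  rewrite -(measurable_sub HG).
  apply: (@measurable_best_regime _ _ (g_sigma_algebraType (F ((k + n)%:R * h)))) => // j'.
  by rewrite (measurable_sub HG).
rewrite addnS; have mono := grid_nondecreasing F_usual h0 (leqnSn (k + n)).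
split=> [j|]; first exact: mono.
apply: (@mvec_choice R q _ (g_sigma_algebraType (F ((k + n).+1%:R * h)))
  (fun o => (best_state n.+1 o).1) _ d
  (fun j o => euler_step D h j (best_state n o).2 (brownian_incr W h (k + n) o))) => j.
  by rewrite (measurable_sub HG'); exact: mono.
apply: (mvec_euler_step HD).
  exact: (mvec_grid_mono F_usual h0 (leqnSn (k + n)) mY).
exact: (mvec_brownian_incr F_usual W_brownian h0).
Qed.

(** The regime of index n is decided one step before the position of index n is known, hence the
    predecessor; for n = 0 it is the deterministic initial regime. *)
Lemma best_regime_measurable n j :
  F ((k + n.-1)%:R * h) [set o | (best_state n o).1 = j].
Proof.
case: n => [|n] /=; first by have [+ _] := best_state_measurable 0; exact.
have [mJ mY] := best_state_measurable n.
have HG := grid_sigma_algebra F_usual h0 (k + n).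
rewrite -(measurable_sub HG).
apply: (@measurable_best_regime _ _ (g_sigma_algebraType (F ((k + n)%:R * h)))) => // j'.
by rewrite (measurable_sub HG).
Qed.

Lemma best_control_admissible : admissible P F Th h m k i best_control.
Proof.
have F0 t : 0 <= t -> F t set0.
  by move=> t0; have [] := filtration_sigma_algebra F_usual t0.
have FT t : 0 <= t -> F t setT.
  move=> t0; have HG := filtration_sigma_algebra F_usual t0.
  by rewrite -(measurable_sub HG).
have hk l : 0 <= l%:R * h by rewrite mulr_ge0// ltW.
split=> [n | n o | n o | n j | o | o | ].
- split=> [? | t t0] /=; first by case: ifP; rewrite ?leey// lee_fin.
  set c := (X in (X <= _)%E); have [ct|ct] := boolP (c <= t%:E)%E.
    by rewrite (_ : [set _ | _] = setT); [exact: FT|apply/seteqP; split].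
  by rewrite (_ : [set _ | _] = set0); [exact: F0|apply/seteqP; split=> // o /=; rewrite (negbTE ct)].
- rewrite /=; case: ifPn => hn; case: ifPn => hn'; rewrite ?leey// ?lee_fin.
    by rewrite ler_pM2r// ler_nat; lia.
  by move: hn hn'; lia.
- rewrite /=; case: ifPn => hn; last by rewrite leye_eq.
  rewrite lee_fin Thm ler_pM2r// ler_nat => hm.
  by exists (k + n.-1)%N; split=> //; lia.
- rewrite /stopped_sigma /=; have mj := best_regime_measurable (minn n (m - k)) j.
  split=> [|t t0]; first exact: (grid_measurable F_usual h0 mj).
  case: ifPn => hn; last first.
    rewrite (_ : _ `&` _ = set0); first exact: F0.
    by apply/seteqP; split=> // o /= []; rewrite leye_eq.
  have [ct|ct] := boolP (((k + n.-1)%:R * h)%:E <= t%:E)%E.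
    rewrite (_ : _ `&` _ = [set o | (best_state (minn n (m - k)) o).1 = j]).
      move: mj; rewrite (minn_idPl hn); apply: (filtration_nondecreasing F_usual (hk _)).
      by move: ct; rewrite lee_fin.
    by apply/seteqP; split=> o /=; [case|].
  rewrite (_ : _ `&` _ = set0); first exact: F0.
  by apply/seteqP; split=> // o /= [_ h']; case: (negP ct).
- by rewrite /= addn0.
- by rewrite /= min0n.
- exists (cst (m - k).+1); split; first exact: measurable_cst.
  by apply: aeW => o /=; rewrite ltnn ltry.
Qed.

(** The successor accounts for index 0, the initial regime, which also sits at t_k; the decision
    made at t_k has index 1. *)
Lemma best_control_regime l o : (k <= l < m)%N ->
  regime_at best_control (l%:R * h) o = (best_state (l - k).+1 o).1.
Proof.
move=> /andP[kl lm].
rewrite (regime_atE (fun n => adm_nondecreasing best_control_admissible n o) (n := (l - k).+1)).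
  by rewrite /= (minn_idPl _)//; lia.
rewrite /= (_ : (l - k < m - k)%N); last by lia.
rewrite subnKC// lexx/=; case: ifPn => _; last exact: ltry.
by rewrite lte_fin ltr_pM2r// ltr_nat; lia.
Qed.

Lemma best_control_scheme n o : (k + n <= m)%N ->
  euler_scheme D W h k x best_control (k + n) o = (best_state n o).2.
Proof.
elim: n => [_|n ih hn].
  by rewrite addn0 /=; case: k => //= k'; rewrite ltnSn.
rewrite addnS euler_schemeS ?leq_addr// ih; last by lia.
by rewrite best_control_regime; [rewrite addKn|lia].
Qed.

Lemma expected_payoff_best_control :
  ('E_P[euler_payoff D W Th h m k x best_control] = (V (m - k) i x)%:E)%E.
Proof.
have Ha := best_control_admissible; rewrite unlock.
pose I l o := regime_at best_control (l%:R * h) o.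
pose X l o := euler_scheme D W h k x best_control l o.
have HI l j : (k <= l < m)%N -> F (l%:R * h) [set o | I l o = j].
  by move=> _; apply: (regime_at_measurable F_usual Ha); rewrite mulr_ge0// ltW.
have X0 o : X k o = x by rewrite /X; case: k => //= k'; rewrite ltnSn.
have XS l o : (k <= l < m)%N -> X l.+1 o = euler_step D h (I l o) (X l o) (brownian_incr W h l o).
  by move=> /andP[kl _]; exact: euler_schemeS.
have [iM eM] := mart_sum_mean F_usual W_brownian h0 Hth gth HD h1 HI X0 XS (V (m - k) i x).
rewrite -[in RHS]eM -Ex_EFin//; apply: eq_integral => o _; congr EFin.
have prevE l : (k <= l <= m)%N -> (if l == k then i else I l.-1 o) = (best_state (l - k) o).1.
  move=> /andP[kl lm]; case: eqP => [->|/eqP lk]; first by rewrite subnn.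
  rewrite /I best_control_regime; last by lia.
  by rewrite (_ : (l.-1 - k).+1 = (l - k)%N)//; lia.
have XE l : (k <= l <= m)%N -> X l o = (best_state (l - k) o).2.
  by move=> /andP[kl lm]; rewrite /X -best_control_scheme ?subnKC.
have := gain_eq_martingale (J := I^~ o) (Y := X^~ o); rewrite X0 => <-; last first.
  move=> l /andP[kl lm]; have hl : (k <= l <= m)%N by rewrite kl ltnW.
  rewrite (prevE l hl) (XE l hl) /I best_control_regime ?kl//= subnKC//.
  by rewrite -(subnSK lm) -best_regimeP.
have mono n := adm_nondecreasing Ha n o.
(* No new decision is made at the horizon, so the terminal payoff is evaluated in the last regime
   chosen. *)
have Im : I m o = (best_state (m - k) o).1.
  rewrite /I (regime_atE mono (n := (m - k)%N)); first by rewrite /= minnn.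
  rewrite /= leqnn ltnn ltry andbT lee_fin ler_pM2r// ler_nat; lia.
rewrite /euler_payoff (nb_switchesE mono (N := (m - k)%N)); last first.
  rewrite /= leqnn ltnn ltry andbT lee_fin Thm ler_pM2r// ler_nat; lia.
have mm : (k <= m <= m)%N by rewrite km leqnn.
rewrite (prevE m mm) -Im sumrB addrAC; congr (_ - _ + _).
rewrite big_add1 (big_addn 0 m k predT); apply: eq_big_nat => n /andP[_ hn].
have hn' : (k <= n + k <= m)%N by lia.
have hn2 : (k <= n + k < m)%N by lia.
rewrite (prevE _ hn') /I best_control_regime// addnK /= (minn_idPl _); last by lia.
rewrite (minn_idPl _); last by lia.
rewrite hn (addnC n k) grid_indexE//; congr cost.
Qed.

End optimal_control.

Lemma euler_value_dpv (q0 : Th / m%:R = h) :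
  euler_value P F D W Th m i k x = (V (m - k) i x)%:E.
Proof.
rewrite /euler_value q0; apply/eqP; rewrite eq_le; apply/andP; split.
  by apply: ge_ereal_sup => _ [a Ha <-]; exact: expected_payoff_le.
rewrite -expected_payoff_best_control; apply: ereal_sup_ubound.
by exists best_control => //; exact: best_control_admissible.
Qed.

End dynamic_programming_principle.

(** * Constants uniform in the time step *)

Lemma exprDn_le_expR (R : realType) (y a : R) n : 0 <= y -> n%:R * y <= a ->
  (1 + y) ^+ n <= expR a.
Proof.
move=> y0 ya; apply: (@le_trans _ _ (expR (n%:R * y))); last by rewrite ler_expR.
by rewrite expRM_natl lerXn2r ?nnegrE ?expR_ge0 ?addr_ge0// expR_ge1Dx.
Qed.

Lemma ler_pM3 (R : realType) (a b c a' b' c' : R) : 0 <= a -> 0 <= b -> 0 <= c ->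
  a <= a' -> b <= b' -> c <= c' -> a * b * c <= a' * b' * c'.
Proof. by move=> a0 b0 c0' aa bb cc; rewrite ler_pM ?mulr_ge0// ler_pM. Qed.

Section quantization_error_norm.
Context {R : realType} {d : nat} disp (Omega : measurableType disp).
Context (P : probability Omega R) (theta : Omega -> 'cV[R]_d) (projw : 'cV[R]_d -> 'cV[R]_d).

Lemma quant_error_pow n : (0 < n)%N ->
  fine (quant_error P theta projw n%:R) ^+ n =
  Ex P (fun o => enorm (projw (theta o) - theta o) ^+ n).
Proof.
move=> n0; have nR : n%:R != 0 :> R by rewrite pnatr_eq0 -lt0n.
rewrite -powR_mulrn ?fine_ge0 ?Lnorm_ge0// -fine_poweR powR_Lnorm//.
congr fine; apply: eq_integral => o _ /=.
by rewrite ger0_norm ?enorm_ge0// powR_mulrn ?enorm_ge0// enormB.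
Qed.

Lemma gaussian_noise : gaussian_vector P 1 theta -> noise P (@gmom4 R d) theta.
Proof.
move=> g; split.
- exact: gaussian_vector_mvec g.
- exact: enorm4_L1.
- exact: enorm4_le.
- by move=> j; exact: gaussian_coord_mean.
Qed.

End quantization_error_norm.

Section constants.
Context {R : realType}.
Variables (M C c0 Th : R).

(** The value given to [Lb]: it bounds 2 C rho0^n as long as n h <= Th. *)
Definition lip_growth : R := 2 * C * expR ((kstep M C + 1) * Th).
(** The value given to [Mc]: a sum, so that both C <= Mc and C <= Mc c0 hold. *)
Definition lip_cost : R := C + C / c0.
Definition lip_local : R :=
  lip_cost * expR ((2 * kstep M C + kenergy M C lip_growth + 1) * Th)
  * (lip_growth + 2 * (1 + lip_growth ^+ 2) + 2).
Definition lip_global : R := expR (kstep M C * Th) * (C + C * Th).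
(** Each of the n local errors contains a factor h once normalized as in the theorem, and n h <= Th.
    The exponentials come from powers of [rq2] and [rq4]; the 1 serves the mesh term of constant
    costs. *)
Definition step_factor : R := Th * (1 + expR (k7 M C * Th) + expR (k8 M C * Th)).
(** The 1 comes from [xfac], the rest from the power of [rq2]; likewise for [expo4] with [zfac] and
    [rq4]. *)
Definition expo2 : R := 1 + k7 M C * Th.
Definition expo4 : R := 1 + k8 M C * Th.

(* The norms only serve to make every term of the sum nonnegative. *)
Definition final_constant : R :=
  `|expo2| + `|expo4| + `|lip_local * k9 M C * step_factor|
  + `|lip_global * k9 M C * step_factor|.

End constants.

Section estimate.
Context {R : realType} {d q N : nat} disp (Omega : measurableType disp).
Context (P : probability Omega R) (M : R) (theta : Omega -> 'cV[R]_d).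
Context (D : switching_data R d q) (C c0 Th : R).
Hypothesis Hth : noise P M theta.
Hypothesis HD : regular_data C c0 D.
Variables (w : 'I_N -> 'cV[R]_d) (projw : 'cV[R]_d -> 'cV[R]_d).
Hypothesis Hq : quantizer theta w projw.
Variables (delta Rad : R) (projX : 'cV[R]_d -> 'cV[R]_d).
Hypotheses (d_gt0 : (0 < d)%N) (delta0 : 0 < delta) (Rad0 : 0 < Rad).
Hypothesis HX : closest_projection (space_grid delta Rad) projX.
Variables (h : R) (m : nat).
Hypotheses (h0 : 0 < h) (h1 : h <= 1) (Thm : Th = m%:R * h).

Local Notation V := (dpv P theta D h).
Local Notation Vhat := (quant_value D h projX w (quant_weight P theta w projw)).
Local Notation E2 := (qerr2 P theta projw).
Local Notation E4 := (qerr4 P theta projw).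
Local Notation K := (final_constant M C c0 Th).
Local Notation sf := (step_factor M C Th).
Local Notation Xf := (xfac P theta projw h).
Local Notation Zf := (zfac P theta projw h).
Local Notation q2 := (rq2 P M theta C projw h).
Local Notation q4 := (rq4 P M theta C projw h).
Local Notation c7 := (expR (k7 M C * Th)).
Local Notation c8 := (expR (k8 M C * Th)).

Let M0 : 0 <= M := noiseM_ge0 Hth.
Let C1 : 1 <= C := reg_ge1 HD.
Let C0 : 0 <= C := le_trans ler01 C1.
Let c00 : 0 < c0 := reg_gt0 HD.
Let hge0 : 0 <= h := ltW h0.
Let ks0 : 0 <= kstep M C := kstep_ge0 Hth HD.
Let ke0 L : 0 <= kenergy M C L := kenergy_ge0 Hth HD L.
Let k80 : 0 <= k8 M C := k8_ge0 Hth HD.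
Let E20 : 0 <= E2 := qerr2_ge0 P theta projw.
Let E40 : 0 <= E4 := qerr4_ge0 P theta projw.

Let k70 : 0 <= k7 M C.
Proof.
have h3 : 0 <= k3 C by rewrite /k3 addr_ge0 ?sqr_ge0// mulr_ge0.
by rewrite /k7 addr_ge0// mulr_ge0// addr_ge0// /kz !addr_ge0// !mulr_ge0 ?sqr_ge0 ?addr_ge0.
Qed.

Let nh n : (n <= m)%N -> n%:R * h <= Th.
Proof. by move=> nm; rewrite Thm ler_pM2r// ler_nat. Qed.

Let Th0 : 0 <= Th. Proof. by rewrite Thm mulr_ge0. Qed.

Let pow_step c n : 0 <= c -> (n <= m)%N -> (1 + c * h) ^+ n <= expR (c * Th).
Proof.
move=> c0' nm; apply: exprDn_le_expR; first exact: mulr_ge0.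
by rewrite mulrCA ler_wpM2l// nh.
Qed.

Lemma lip_growth_ge1 : 1 <= lip_growth M C Th.
Proof.
have e1 : 1 <= expR ((kstep M C + 1) * Th) by rewrite -expR0 ler_expR mulr_ge0// addr_ge0.
rewrite /lip_growth -mulrA; have := ler_pM ler01 ler01 C1 e1; rewrite mulr1; lra.
Qed.

Lemma dpv_local_elip n i x y : (n <= m)%N ->
  `|V n i x - V n i y| <= lip_local M C c0 Th * (wgt x + wgt y) * enorm (x - y).
Proof.
move=> nm; have L1 := lip_growth_ge1.
have L0 := le_trans ler01 L1.
have cc : 0 <= C / c0 by rewrite divr_ge0// ltW.
have hL n' : (n' <= m)%N -> 2 * C * rho0 M C h ^+ n' <= lip_growth M C Th.
  move=> nm'; rewrite /lip_growth ler_wpM2l ?mulr_ge0//.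
  by apply: pow_step => //; exact: addr_ge0.
have Mc1 : C <= lip_cost C c0 by rewrite lerDl.
have Mc2 : C <= lip_cost C c0 * c0.
  by rewrite mulrDl divfK ?gt_eqF// lerDr mulr_ge0// ltW.
apply: (le_trans (dpv_local_lip Hth HD hge0 h1 L1 hL Mc1 Mc2 i x y nm)).
have w0 : 0 <= (wgt x + wgt y) by rewrite addr_ge0 ?wgt_ge0.
rewrite ler_wpM2r ?enorm_ge0// ler_wpM2r// /lip_local ler_wpM2r//.
  by rewrite !addr_ge0// mulr_ge0// addr_ge0// sqr_ge0.
rewrite ler_wpM2l ?(le_trans C0)//; apply: pow_step => //.
by rewrite !addr_ge0// mulr_ge0.
Qed.

Lemma dpv_global_elip n i x y : (forall i j y z, cost D i j y = cost D i j z) ->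
  (n <= m)%N -> `|V n i x - V n i y| <= lip_global M C Th * enorm (x - y).
Proof.
move=> cst_cost nm.
have e0 i' j' : elip 0 (cost D i' j').
  by move=> y' z'; rewrite (cst_cost i' j' y' z') subrr normr0 mul0r.
apply: le_trans (dpv_uniform_elip Hth HD hge0 h1 e0 n i x y) _.
rewrite ler_wpM2r ?enorm_ge0// /lip_global ler_pM ?exprn_ge0 ?addr_ge0 ?mulr_ge0//.
  exact: pow_step.
by rewrite lerD2l mulrCA ler_wpM2l// nh.
Qed.

Lemma lip_local_ge0 : 0 <= lip_local M C c0 Th.
Proof.
have L0 := le_trans ler01 lip_growth_ge1.
have cc : 0 <= C / c0 by rewrite divr_ge0// ltW.
rewrite /lip_local !mulr_ge0 ?expR_ge0 ?addr_ge0//.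
by rewrite mulr_ge0// addr_ge0// sqr_ge0.
Qed.

Lemma lip_global_ge0 : 0 <= lip_global M C Th.
Proof. by rewrite /lip_global mulr_ge0 ?expR_ge0// addr_ge0// mulr_ge0. Qed.

Local Notation qw := (qwt delta h).
Let D0 : 0 <= delta / h. Proof. by rewrite divr_ge0// ltW. Qed.

(** A loss of E2 per step, without a factor h, accumulates to n E2 = (n h) (E2 / h) <= Th E2 / h in
    the exponent. *)
Let rq2_pow n : (n <= m)%N -> Xf * q2 ^+ n <=
  c7 * expR (expo2 M C Th * (E2 / h)).
Proof.
move=> nm; have e20 : 0 <= E2 / h by rewrite divr_ge0.
have -> : expo2 M C Th * (E2 / h) = E2 / h + k7 M C * (Th * (E2 / h)).
  by rewrite /expo2 [LHS]mulrDl mul1r -[in LHS]mulrA.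
rewrite expRD mulrCA ler_wpM2l ?expR_ge0//.
rewrite -expRD; apply: exprDn_le_expR; first by rewrite mulr_ge0// addr_ge0.
rewrite [leLHS]mulrCA -mulrDr ler_wpM2l// mulrDr lerD ?nh//.
by rewrite -[in leLHS](divfK (lt0r_neq0 h0) E2) mulrCA mulrC ler_wpM2r// nh.
Qed.

Let rq2_pow' n : (n <= m)%N -> q2 ^+ n <=
  c7 * expR (expo2 M C Th * (E2 / h)).
Proof.
move=> nm; apply: le_trans (rq2_pow nm); rewrite ler_peMl ?exprn_ge0//.
  by rewrite (le_trans ler01)// lerDl mulr_ge0// addr_ge0.
by rewrite /xfac -expR0 ler_expR divr_ge0.
Qed.

Let rq4_pow n : (n <= m)%N -> Zf * q4 ^+ n <=
  c8 * expR (expo4 M C Th * (E4 / h ^+ 2)).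
Proof.
move=> nm; have h20 : 0 <= E4 / h ^+ 2 by rewrite divr_ge0 ?sqr_ge0.
have -> : expo4 M C Th * (E4 / h ^+ 2) = E4 / h ^+ 2 + k8 M C * (Th * (E4 / h ^+ 2)).
  by rewrite /expo4 [LHS]mulrDl mul1r -[in LHS]mulrA.
rewrite expRD mulrCA ler_wpM2l ?expR_ge0//.
rewrite -expRD; apply: exprDn_le_expR; first by rewrite mulr_ge0// addr_ge0 ?divr_ge0.
rewrite [leLHS]mulrCA -mulrDr ler_wpM2l// mulrDr lerD ?nh//.
have -> : E4 / h = E4 / h ^+ 2 * h by field; rewrite gt_eqF.
by rewrite mulrCA mulrC ler_wpM2r// nh.
Qed.

Let k90 : 0 <= k9 M C.
Proof. by rewrite /k9 !mulr_ge0 ?sqr_ge0 ?addr_ge0 ?mulr_ge0. Qed.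

Let sf0 : 0 <= sf.
Proof. by rewrite /step_factor mulr_ge0// !addr_ge0 ?expR_ge0. Qed.

Let K0 : 0 <= K. Proof. by rewrite /final_constant !addr_ge0. Qed.

Let K_ge : [/\ expo2 M C Th <= K, expo4 M C Th <= K,
  lip_local M C c0 Th * k9 M C * sf <= K &
  lip_global M C Th * k9 M C * sf <= K].
Proof.
rewrite /final_constant; move: (expo2 _ _ _) (expo4 _ _ _) (lip_local _ _ _ _ * _ * _) (lip_global _ _ _ * _ * _).
move=> a b c e; have := (ler_norm a, ler_norm b, ler_norm c, ler_norm e).
have := (normr_ge0 a, normr_ge0 b, normr_ge0 c, normr_ge0 e).
by move=> [[[? ?] ?] ?] [[[? ?] ?] ?]; split; lra.
Qed.

Variables (e2 e4 : R) (x : 'cV[R]_d).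
Hypotheses (e20 : 0 <= e2) (e2E : e2 ^+ 2 = E2) (e4E : e4 ^+ 4 = E4).

Local Notation B := (1 + enorm x + delta / h).
Local Notation Q := (1 + enorm x ^+ 2 + (delta / h) ^+ 2).
Local Notation EX := (expR (K * h^-1 * e2 ^+ 2)).
Local Notation EZ := (expR (K * h^-1 ^+ 2 * e4 ^+ 4)).
Local Notation a2 := ((Num.sqrt h)^-1 * e2).

Let sqrtE2 : Num.sqrt E2 = e2. Proof. by rewrite -e2E sqrtr_sqr ger0_norm. Qed.

Let EX_ge : expR (expo2 M C Th * (E2 / h)) <= EX.
Proof.
have [K_expo2 _ _ _] := K_ge.
by rewrite ler_expR e2E -mulrA [h^-1 * _]mulrC ler_wpM2r// divr_ge0.
Qed.

Let EX1 : 1 <= EX.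
Proof. by rewrite -expR0 ler_expR !mulr_ge0 ?invr_ge0 ?sqr_ge0. Qed.

Let EZ_ge : expR (expo4 M C Th * (E4 / h ^+ 2)) <= EZ.
Proof.
have [_ K_expo4 _ _] := K_ge.
rewrite ler_expR e4E exprVn -mulrA [(h ^+ 2)^-1 * _]mulrC ler_wpM2r//.
by rewrite divr_ge0// sqr_ge0.
Qed.

Let qw0 : 0 <= qw x. Proof. exact: qwt_ge0. Qed.

Let qwB : qw x <= B. Proof. exact: qwt_le. Qed.

Let qwQ : qw x ^+ 2 = Q. Proof. by rewrite qwt_sqr addrAC. Qed.

Let a20 : 0 <= a2. Proof. by rewrite mulr_ge0// invr_ge0 sqrtr_ge0. Qed.

Let time_err n : (n <= m)%N -> n%:R * (Num.sqrt h * e2) <= Th * a2.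
Proof.
move=> nm; have sE : Num.sqrt h = h * (Num.sqrt h)^-1.
  by rewrite -[X in X * _](sqr_sqrtr hge0) expr2 mulfK// gt_eqF// sqrtr_gt0.
by rewrite [in leLHS]sE -[h * _ * _]mulrA [leLHS]mulrA ler_wpM2r// nh.
Qed.

Let time_delta n : (n <= m)%N -> n%:R * delta <= Th * (delta / h).
Proof.
by move=> nm; rewrite -[in leLHS](divfK (lt0r_neq0 h0) delta) mulrCA mulrC ler_wpM2r// nh.
Qed.

Let time_Rad n : (n <= m)%N -> n%:R / Rad <= Th * (Rad * h)^-1.
Proof.
move=> nm; rewrite invfM [Rad^-1 * _]mulrC mulrA ler_wpM2r ?invr_ge0 ?(ltW Rad0)//.
by rewrite ler_pdivlMr// nh.
Qed.

Let sf7 : Th * c7 <= sf.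
Proof. by rewrite ler_wpM2l// addrAC lerDr addr_ge0 ?expR_ge0. Qed.

Let sf8 : Th * c8 <= sf.
Proof. by rewrite ler_wpM2l// lerDr addr_ge0 ?expR_ge0. Qed.

Let sf1 : Th <= sf.
Proof. by rewrite /step_factor ler_peMr// -addrA lerDl addr_ge0 ?expR_ge0. Qed.

Let xr2 n : (n <= m)%N -> Xf * q2 ^+ n <= c7 * EX.
Proof. by move=> nm; rewrite (le_trans (rq2_pow nm))// ler_wpM2l ?expR_ge0. Qed.

Let r2 n : (n <= m)%N -> q2 ^+ n <= c7 * EX.
Proof. by move=> nm; rewrite (le_trans (rq2_pow' nm))// ler_wpM2l ?expR_ge0. Qed.

Let zr4 n : (n <= m)%N -> Zf * q4 ^+ n <= c8 * EZ.
Proof. by move=> nm; rewrite (le_trans (rq4_pow nm))// ler_wpM2l ?expR_ge0. Qed.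

Let x0 : 0 <= Xf. Proof. exact: expR_ge0. Qed.
Let z0 : 0 <= Zf. Proof. exact: expR_ge0. Qed.
Let r20 n : 0 <= q2 ^+ n.
Proof. by rewrite exprn_ge0// addr_ge0// mulr_ge0// addr_ge0. Qed.
Let r40 n : 0 <= q4 ^+ n.
Proof. by rewrite exprn_ge0// addr_ge0// mulr_ge0// addr_ge0// divr_ge0. Qed.
Let B0 : 0 <= B. Proof. exact: le_trans qwB. Qed.
Let Q0 : 0 <= Q. Proof. by rewrite -qwQ sqr_ge0. Qed.
Let EX0 : 0 <= EX := expR_ge0 _.
Let EZ0 : 0 <= EZ := expR_ge0 _.
Let rD : 0 <= (Rad * h)^-1. Proof. by rewrite invr_ge0 mulr_ge0// ltW. Qed.
Let Rad_inv0 : 0 <= Rad^-1. Proof. by rewrite invr_ge0 ltW. Qed.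
Let sqrtM0 : 0 <= Num.sqrt h * e2. Proof. by rewrite mulr_ge0 ?sqrtr_ge0. Qed.
Let dge0 : 0 <= delta. Proof. exact: ltW. Qed.
Let qwBB : qw x ^+ 2 <= B * B. Proof. by rewrite expr2 ler_pM. Qed.

Lemma quant_estimate1 n i : (n <= m)%N ->
  `|V n i x - Vhat n i x| <=
  K * EX * B * (delta / h + a2 * B + (Rad * h)^-1 * EZ * Q).
Proof.
move=> nm; have [_ _ KL _] := K_ge.
apply: (le_trans (quant_error1 Hth HD Hq d_gt0 delta0 Rad0 HX h0 h1 lip_local_ge0
  (fun n i y z hn => dpv_local_elip i y z hn) i x nm)).
rewrite sqrtE2.
have t1 : n%:R * (Num.sqrt h * e2 * Xf * q2 ^+ n * qw x ^+ 2)
    <= sf * (EX * B * (a2 * B)).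
  have -> : n%:R * (Num.sqrt h * e2 * Xf * q2 ^+ n * qw x ^+ 2)
    = n%:R * (Num.sqrt h * e2) * (Xf * q2 ^+ n) * qw x ^+ 2 by ring.
  apply: (@le_trans _ _ (Th * a2 * (c7 * EX) * (B * B))).
    by apply: ler_pM3; rewrite ?mulr_ge0 ?sqr_ge0 ?time_err ?xr2.
  have -> : Th * a2 * (c7 * EX) * (B * B) =
    Th * c7 * (EX * B * (a2 * B)) by ring.
  by rewrite ler_wpM2r// !mulr_ge0 ?invr_ge0.
have t2 : n%:R * (delta * Xf * q2 ^+ n * qw x)
    <= sf * (EX * B * (delta / h)).
  have -> : n%:R * (delta * Xf * q2 ^+ n * qw x) =
    n%:R * delta * (Xf * q2 ^+ n) * qw x by ring.
  apply: (@le_trans _ _ (Th * (delta / h) * (c7 * EX) * B)).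
    by apply: ler_pM3; rewrite ?mulr_ge0 ?time_delta ?xr2.
  have -> : Th * (delta / h) * (c7 * EX) * B =
    Th * c7 * (EX * B * (delta / h)) by ring.
  by rewrite ler_wpM2r// !mulr_ge0 ?invr_ge0.
have t3 : n%:R * (Zf / Rad * q4 ^+ n * qw x ^+ 3)
    <= sf * (EX * B * ((Rad * h)^-1 * EZ * Q)).
  have -> : n%:R * (Zf / Rad * q4 ^+ n * qw x ^+ 3) =
    n%:R / Rad * (Zf * q4 ^+ n) * (qw x * qw x ^+ 2) by ring.
  apply: (@le_trans _ _ (Th * (Rad * h)^-1 * (c8 * EZ) * (B * Q))).
    by rewrite qwQ; apply: ler_pM3; rewrite ?mulr_ge0 ?time_Rad ?zr4// ler_wpM2r.
  (* This term comes without [EX]; the explicit factor 1 is then raised to [EX] to fit under the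
     common prefactor. *)
  have -> : Th * (Rad * h)^-1 * (c8 * EZ) * (B * Q) =
    Th * c8 * (1 * B * ((Rad * h)^-1 * EZ * Q)) by ring.
  apply: ler_pM; rewrite ?mulr_ge0 ?expR_ge0//.
  by rewrite ler_wpM2r ?mulr_ge0// ler_wpM2r.
have A0 : 0 <= EX * B * (delta / h + a2 * B + (Rad * h)^-1 * EZ * Q).
  apply: mulr_ge0; first exact: mulr_ge0.
  by apply: addr_ge0; [apply: addr_ge0 => //; exact: mulr_ge0|apply: mulr_ge0 => //; exact: mulr_ge0].
have -> : K * EX * B * (delta / h + a2 * B + (Rad * h)^-1 * EZ * Q) =
  K * (EX * B * (delta / h + a2 * B + (Rad * h)^-1 * EZ * Q)) by ring.
apply: le_trans (ler_wpM2r A0 KL); rewrite -[leRHS]mulrA ler_wpM2l//; first exact: (mulr_ge0 lip_local_ge0).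
apply: le_trans (lerD (lerD t1 t2) t3) _; rewrite -!mulrDr.
by rewrite [a2 * B + _]addrC.
Qed.

Lemma quant_estimate2 n i : (forall i j y z, cost D i j y = cost D i j z) -> (n <= m)%N ->
  `|V n i x - Vhat n i x| <=
  K * (a2 * EX * B + delta / h + (Rad * h)^-1 * EZ * Q).
Proof.
move=> cst_cost nm; have [_ _ _ KL] := K_ge.
apply: (le_trans (quant_error2 Hth HD Hq d_gt0 delta0 Rad0 HX h0 h1 lip_global_ge0
  (fun n i y z hn => dpv_global_elip i y z cst_cost hn) i x nm)).
rewrite sqrtE2.
have t1 : n%:R * (Num.sqrt h * e2 * q2 ^+ n * qw x) <= sf * (a2 * EX * B).
  have -> : n%:R * (Num.sqrt h * e2 * q2 ^+ n * qw x)
    = n%:R * (Num.sqrt h * e2) * q2 ^+ n * qw x by ring.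
  apply: (@le_trans _ _ (Th * a2 * (c7 * EX) * B)).
    by apply: ler_pM3; rewrite ?mulr_ge0 ?time_err ?r2.
  have -> : Th * a2 * (c7 * EX) * B =
    Th * c7 * (a2 * EX * B) by ring.
  by rewrite ler_wpM2r// !mulr_ge0 ?invr_ge0.
have t2 : n%:R * delta <= sf * (delta / h).
  exact: le_trans (time_delta nm) (ler_wpM2r D0 sf1).
have t3 : n%:R * (Zf / Rad * q4 ^+ n * qw x ^+ 2)
    <= sf * ((Rad * h)^-1 * EZ * Q).
  have -> : n%:R * (Zf / Rad * q4 ^+ n * qw x ^+ 2) =
    n%:R / Rad * (Zf * q4 ^+ n) * qw x ^+ 2 by ring.
  apply: (@le_trans _ _ (Th * (Rad * h)^-1 * (c8 * EZ) * Q)).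
    by rewrite qwQ; apply: ler_pM3; rewrite ?mulr_ge0 ?time_Rad ?zr4.
  have -> : Th * (Rad * h)^-1 * (c8 * EZ) * Q =
    Th * c8 * ((Rad * h)^-1 * EZ * Q) by ring.
  by rewrite ler_wpM2r//; apply: mulr_ge0 => //; exact: mulr_ge0.
have A0 : 0 <= a2 * EX * B + delta / h + (Rad * h)^-1 * EZ * Q.
  by apply: addr_ge0; [apply: addr_ge0 => //; do 2?apply: mulr_ge0|apply: mulr_ge0 => //; exact: mulr_ge0].
apply: le_trans (ler_wpM2r A0 KL); rewrite -[leRHS]mulrA ler_wpM2l//; first exact: (mulr_ge0 lip_global_ge0).
by apply: le_trans (lerD (lerD t1 t2) t3) _; rewrite -!mulrDr.
Qed.

End estimate.

Theorem theorem4p1 (R : realType) (d q : nat) (Th : R)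
    (disp : measure_display) (Omega : measurableType disp)
    (P : probability Omega R) (F : R -> set (set Omega))
    (W : R -> Omega -> 'cV[R]_d) (D : switching_data R d q)
    (d_gt0 : (0 < d)%N) (Th_gt0 : 0 < Th)
    (F_usual : usual_filtration P F) (W_brownian : brownian_motion P F W)
    (D_assumptions : switching_assumptions D) :
  exists K : R,
  forall (m : nat) (delta Rad : R) (N : nat)
    (projX : 'cV[R]_d -> 'cV[R]_d)
    (theta : Omega -> 'cV[R]_d) (w : 'I_N -> 'cV[R]_d)
    (projw : 'cV[R]_d -> 'cV[R]_d),
  (1 <= m)%N -> Th / m%:R <= 1 -> 0 < delta -> 0 < Rad ->
  closest_projection (space_grid delta Rad) projX ->
  gaussian_vector P 1 theta ->
  optimal_quantizer P theta w projw ->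
  forall (k : nat) (x : 'cV[R]_d) (i : 'I_q),
  (k <= m)%N -> space_grid delta Rad x ->
  let h := Th / m%:R in
  let e2 := fine (quant_error P theta projw 2) in
  let e4 := fine (quant_error P theta projw 4) in
  let vbar := euler_value P F D W Th m i k x in
  let vhat := quant_value D h projX w (quant_weight P theta w projw)
                (m - k) i x in
  (`|vbar - vhat%:E| <=
     (K * expR (K * h^-1 * e2 ^+ 2) * (1 + enorm x + delta / h) *
      (delta / h + (Num.sqrt h)^-1 * e2 * (1 + enorm x + delta / h)
       + (Rad * h)^-1 * expR (K * h^-1 ^+ 2 * e4 ^+ 4) *
         (1 + enorm x ^+ 2 + (delta / h) ^+ 2)))%:E)%E
  /\
  ((forall i' j' y z, cost D i' j' y = cost D i' j' z) ->
   (`|vbar - vhat%:E| <=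
     (K * ((Num.sqrt h)^-1 * e2 * expR (K * h^-1 * e2 ^+ 2) *
             (1 + enorm x + delta / h)
           + delta / h + (Rad * h)^-1 * expR (K * h^-1 ^+ 2 * e4 ^+ 4) *
             (1 + enorm x ^+ 2 + (delta / h) ^+ 2)))%:E)%E).
Proof.
have [C [c0 HD]] := regular_dataP D_assumptions.
(* The constant is chosen before m, delta, Rad and N: it depends on the Gaussian fourth moment in
   dimension d, on the coefficients through [C] and [c0], and on the horizon. *)
exists (final_constant (@gmom4 R d) C c0 Th).
move=> m delta Rad N projX theta w projw m1 h1 delta0 Rad0 HX g [Hq _] k x i km _.
move=> h e2 e4 vbar vhat.
have m0 : 0 < m%:R :> R by rewrite ltr0n.
have h0 : 0 < h by rewrite divr_gt0.
have Thm : Th = m%:R * h by rewrite /h mulrC divfK// gt_eqF.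
have Hth := gaussian_noise g.
have e20 : 0 <= e2 by rewrite fine_ge0// Lnorm_ge0.
have e2E : e2 ^+ 2 = qerr2 P theta projw by exact: quant_error_pow.
have e4E : e4 ^+ 4 = qerr4 P theta projw by exact: quant_error_pow.
have -> : vbar = (dpv P theta D h (m - k) i x)%:E.
  exact: (euler_value_dpv F_usual W_brownian Hth g HD h0 h1 Thm km i x erefl).
have mk : (m - k <= m)%N by rewrite leq_subr.
rewrite -EFinB abse_EFin !lee_fin; split=> [|cst_cost].
  exact: (quant_estimate1 Hth HD Hq d_gt0 delta0 Rad0 HX h0 h1 Thm x e20 e2E e4E i mk).
exact: (quant_estimate2 Hth HD Hq d_gt0 delta0 Rad0 HX h0 h1 Thm x e20 e2E e4E i cst_cost mk).
Qed.
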